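(* Let $\mathfrak{t}$ be a triangulation of the $\infty$-gon which is locally finite or has a fountain, and let $\mathcal{T}$ be the cluster tilting subcategory of $D$ corresponding to $\mathfrak{t}$. Then the exchange quiver $Q_{\mathfrak{t}}$ is an ice quiver whose principal part is the (Gabriel) quiver of $\mathcal{T}$, where the mutable vertex $(i,j)$ of $Q_{\mathfrak{t}}$ corresponds to the indecomposable object of $D$ with coordinates $(i,j)$.
   Context: The $\infty$-gon is the line of integers $\mathbb{Z}$. An arc is a pair of integers $(m,n)$ with $m\le n-2$; a side is a pair $(n,n+1)$. Arcs $(i,j)$ and $(m,n)$ intersect if $i<m<j<n$ or $m<i<n<j$. A triangulation is a maximal set of pairwise non-intersecting arcs. A triangulation is locally finite if for every integer $n$ only finitely many of its arcs have $n$ as an endpoint; it has a fountain at $n$ if it contains infinitely many arcs of the form $(n,p)$ and infinitely many of the form $(m,n)$. Exchange quiver $Q_{\mathfrak{t}}$: an ice quiver with one frozen vertex for each side $(i,i+1)$, $i\in\mathbb{Z}$, and one mutable vertex for each arc in $\mathfrak{t}$. For every triple $i<j<k$ such that each of $(i,j),(j,k),(i,k)$ is an arc of $\mathfrak{t}$ or a side, there are arrows $(i,j)\to(i,k)\to(j,k)\to(i,j)$; all arrows between two frozen vertices are then discarded. There are no other arrows. The principal part is the full subquiver on the mutable vertices. Let $k$ be a field and view $k[X]$ as a differential graded algebra with $X$ in homological degree $1$ and zero differential. $D=D^f(k[X])$ is the derived category of differential graded $k[X]$-modules with finite-dimensional homology over $k$; it is a Hom-finite Krull–Schmidt triangulated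 category with shift functor $\Sigma$. Its Auslander–Reiten quiver is $\mathbb{Z}\vec{A}_{+\infty}$. Isomorphism classes of indecomposable objects are given coordinates by pairs of integers $(m,n)$ with $m\le n-2$, so that the arrows of the Auslander–Reiten quiver are $(m,n)\to(m,n+1)$ and (when $m+1\le n-2$) $(m,n)\to(m+1,n)$, and $\Sigma(m,n)=(m-1,n-1)$. Thus indecomposables correspond bijectively to arcs of the $\infty$-gon. The subcategory $\mathcal{T}$ corresponding to $\mathfrak{t}$ is the full subcategory of finite direct sums of indecomposables whose arcs lie in $\mathfrak{t}$. It is known (Holm–Jørgensen) that $\mathcal{T}$ is cluster tilting, i.e. functorially finite with $\mathcal{T}=(\Sigma^{-1}\mathcal{T})^{\perp}={}^{\perp}(\Sigma\mathcal{T})$, exactly when $\mathfrak{t}$ is a triangulation that is locally finite or has a fountain. The Gabriel quiver of $\mathcal{T}$ has as vertices the isomorphism classes of indecomposable objects of $\mathcal{T}$, and the number of arrows from $x$ to $y$ is the $k$-dimension of the space of irreducible maps $\mathrm{rad}_{\mathcal{T}}(x,y)/\mathrm{rad}^2_{\mathcal{T}}(x,y)$. *)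

(* Defs.v *)
From HB Require Import structures.
From mathcomp Require Import all_boot all_order all_algebra.
From mathcomp Require Import boolp classical_sets functions cardinality.

Set Implicit Arguments.
Unset Strict Implicit.
Unset Printing Implicit Defensive.

Import Order.TTheory GRing.Theory Num.Theory.
Local Open Scope classical_set_scope.
Local Open Scope ring_scope.

Definition is_arc (a : int * int) : Prop := a.1 <= a.2 - 2.

Definition is_side (a : int * int) : Prop := a.2 = a.1 + 1.

Definition crossing (a b : int * int) : Prop :=
  (a.1 < b.1 /\ b.1 < a.2 /\ a.2 < b.2) \/
  (b.1 < a.1 /\ a.1 < b.2 /\ b.2 < a.2).

Definition noncrossing (t : set (int * int)) : Prop :=
  (forall a, t a -> is_arc a) /\ (forall a b, t a -> t b -> ~ crossing a b).

Definition triangulation (t : set (int * int)) : Prop :=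
  noncrossing t /\ forall t', noncrossing t' -> t `<=` t' -> t' = t.

Definition locally_finite (t : set (int * int)) : Prop :=
  forall n : int, finite_set [set a | t a /\ (a.1 = n \/ a.2 = n)].

Definition fountain_at (t : set (int * int)) (n : int) : Prop :=
  infinite_set [set a | t a /\ a.1 = n] /\
  infinite_set [set a | t a /\ a.2 = n].

Definition has_fountain (t : set (int * int)) : Prop :=
  exists n : int, fountain_at t n.

Record quiver : Type := Quiver {
  vertex : Type;
  arrow : Type;
  source : arrow -> vertex;
  target : arrow -> vertex }.

Definition arrows_between (Q : quiver) (u v : vertex Q) : Type :=
  {a : arrow Q | source a = u /\ target a = v}.

Definition has_card (A : Type) (n : nat) : Prop :=
  exists f : 'I_n -> A, bijective f.

Definition full_subquiver (Q : quiver) (P : vertex Q -> Prop) : quiver :=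
  @Quiver {v : vertex Q | P v}
    {a : arrow Q | P (source a) /\ P (target a)}
    (fun a => exist P (source (sval a)) (proj1 (svalP a)))
    (fun a => exist P (target (sval a)) (proj2 (svalP a))).

Record marked_quiver : Type := MarkedQuiver {
  mquiver :> quiver;
  frozen : vertex mquiver -> Prop }.

(* As usual in cluster theory, an ice quiver may be infinite but is locally
   finite and has neither loops nor 2-cycles. *)
Definition is_ice_quiver (Q : marked_quiver) : Prop :=
  [/\ forall a : arrow Q, ~ (frozen (source a) /\ frozen (target a)),
      forall a : arrow Q, source a <> target a,
      forall a b : arrow Q, ~ (target a = source b /\ target b = source a) &
      forall v : vertex Q,
        finite_set [set a : arrow Q | source a = v \/ target a = v]].

Definition principal_part (Q : marked_quiver) : quiver :=
  @full_subquiver Q (fun v => ~ frozen v).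

Section ExchangeQuiver.
Variable t : set (int * int).

Definition edge (a : int * int) : Prop := t a \/ is_side a.

Definition evertex : Type := {a : int * int | edge a}.

Record triangle : Type := Triangle {
  tri_i : int;
  tri_j : int;
  tri_k : int;
  tri_lt_ij : tri_i < tri_j;
  tri_lt_jk : tri_j < tri_k;
  tri_edge_ij : edge (tri_i, tri_j);
  tri_edge_jk : edge (tri_j, tri_k);
  tri_edge_ik : edge (tri_i, tri_k) }.

Definition tri_ij (x : triangle) : evertex := exist edge _ (tri_edge_ij x).
Definition tri_jk (x : triangle) : evertex := exist edge _ (tri_edge_jk x).
Definition tri_ik (x : triangle) : evertex := exist edge _ (tri_edge_ik x).

Inductive tri_arrow : Type :=
  | IJ_to_IK of triangle
  | IK_to_JK of triangle
  | JK_to_IJ of triangle.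

Definition tri_source (a : tri_arrow) : evertex :=
  match a with
  | IJ_to_IK x => tri_ij x | IK_to_JK x => tri_ik x | JK_to_IJ x => tri_jk x
  end.

Definition tri_target (a : tri_arrow) : evertex :=
  match a with
  | IJ_to_IK x => tri_ik x | IK_to_JK x => tri_jk x | JK_to_IJ x => tri_ij x
  end.

Definition efrozen (v : evertex) : Prop := is_side (sval v).

Definition exchange_quiver : marked_quiver :=
  @MarkedQuiver
    (@Quiver evertex
       {a : tri_arrow | ~ (efrozen (tri_source a) /\ efrozen (tri_target a))}
       (fun a => tri_source (sval a)) (fun a => tri_target (sval a)))
    efrozen.

Definition mutable_arc (v : vertex (principal_part exchange_quiver)) :
  int * int := sval (sval v).

End ExchangeQuiver.

Definition ZA_vertex : Type := {a : int * int | is_arc a}.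

Definition ZA_step (a b : int * int) : Prop :=
  b = (a.1, a.2 + 1) \/ b = (a.1 + 1, a.2).

Definition ZA_infty : quiver :=
  @Quiver ZA_vertex
    {p : ZA_vertex * ZA_vertex | ZA_step (sval p.1) (sval p.2)}
    (fun p => (sval p).1) (fun p => (sval p).2).

(* k[X] is the differential graded algebra with X in homological degree 1 and
   zero differential.  The differential lowers the homological degree by 1, X raises it by 1.
   The Leibniz rule for a left module thus reads
   d (X m) = - X (d m).  The differential into degree i is
   indexed by its target, and [dg_d i \o dg_d (i + 1)] and the like
   typecheck without casts because every integer is of the form i + 1. *)
Record dgmod (k : fieldType) : Type := DGMod {
  dg_car :> int -> lmodType k;
  dg_d : forall i : int, {linear dg_car (i + 1) -> dg_car i};
  dg_X : forall i : int, {linear dg_car i -> dg_car (i + 1)};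
  dg_dd : forall (i : int) (m : dg_car (i + 1 + 1)),
    dg_d i (dg_d (i + 1) m) = 0;
  dg_dX : forall (i : int) (m : dg_car (i + 1)),
    dg_d (i + 1) (dg_X (i + 1) m) = - dg_X i (dg_d i m) }.

Record dgmap (k : fieldType) (M N : dgmod k) : Type := DGMap {
  dgf :> forall i : int, {linear M i -> N i};
  dgf_d : forall (i : int) (m : M (i + 1)),
    dgf i (dg_d M i m) = dg_d N i (dgf (i + 1) m);
  dgf_X : forall (i : int) (m : M i),
    dgf (i + 1) (dg_X M i m) = dg_X N i (dgf i m) }.

(* A homotopy is k[X]-linear of degree 1, whence the sign. *)
Definition homotopic (k : fieldType) (M N : dgmod k) (f g : dgmap M N) : Prop :=
  exists h : forall i : int, {linear M i -> N (i + 1)},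
    (forall (i : int) (m : M i),
       h (i + 1) (dg_X M i m) = - dg_X N (i + 1) (h i m)) /\
    (forall (i : int) (m : M (i + 1)),
       f (i + 1) m - g (i + 1) m =
         dg_d N (i + 1) (h (i + 1) m) + h i (dg_d M i m)).

Section DGModules.
Variable k : fieldType.
Implicit Types M N L A B : dgmod k.

Definition cycle M (i : int) (z : M (i + 1)) : Prop := dg_d M i z = 0.

Definition boundary M (i : int) (z : M i) : Prop :=
  exists w : M (i + 1), z = dg_d M i w.

(* All but finitely many homology spaces vanish and each is spanned by the
   classes of finitely many cycles. *)
Definition fin_homology M : Prop :=
  (exists N : int, forall i : int, N < `|i| ->
     forall z : M (i + 1), cycle z -> boundary z) /\
  (forall i : int, exists (n : nat) (e : 'I_n -> M (i + 1)),
     (forall l, cycle (e l)) /\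
     forall z : M (i + 1), cycle z ->
       exists c : 'I_n -> k, boundary (z - \sum_(l < n) c l *: e l)).

Definition quasi_iso M N (f : dgmap M N) : Prop :=
  (forall (i : int) (z : M (i + 1)),
     cycle z -> boundary (f (i + 1) z) -> boundary z) /\
  (forall (i : int) (z : N (i + 1)), cycle z ->
     exists y : M (i + 1), cycle y /\ boundary (z - f (i + 1) y)).

Definition dgid M : dgmap M M.
Proof. by exists (fun i => idfun : {linear M i -> M i}). Defined.

Definition dgcomp M N L (g : dgmap N L) (f : dgmap M N) : dgmap M L.
Proof.
exists (fun i => (g i \o f i) : {linear M i -> L i}) => i m /=.
- by rewrite !dgf_d.
- by rewrite !dgf_X.
Defined.

Definition dgzero M N : dgmap M N.
Proof.
by exists (fun i => \0 : {linear M i -> N i}) => i m /=; rewrite linear0.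
Defined.

Definition dgadd M N (f g : dgmap M N) : dgmap M N.
Proof.
exists (fun i => (f i \+ g i) : {linear M i -> N i}) => i m /=.
- by rewrite !dgf_d linearD.
- by rewrite !dgf_X linearD.
Defined.

Definition dgscale M N (c : k) (f : dgmap M N) : dgmap M N.
Proof.
exists (fun i => (c \*: f i) : {linear M i -> N i}) => i m /=.
- by rewrite dgf_d linearZ.
- by rewrite dgf_X linearZ.
Defined.

Lemma quasi_iso_id M : quasi_iso (dgid M).
Proof.
split=> // i z cz; exists z; split=> //=.
by exists 0; rewrite subrr linear0.
Qed.

Lemma quasi_iso_comp M N L (g : dgmap N L) (f : dgmap M N) :
  quasi_iso g -> quasi_iso f -> quasi_iso (dgcomp g f).
Proof.
move=> [gi gs] [fi fs]; split=> [i z cz bz|i z cz].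
- apply: fi => //; apply: gi => //.
  by rewrite /cycle -dgf_d cz linear0.
- have [y [cy [w zw]]] := gs i z cz; have [x [cx [v yv]]] := fs i y cy.
  exists x; split=> //; exists (w + g (i + 1 + 1) v).
  by rewrite linearD /= -zw -dgf_d -yv linearB /= addrA subrK.
Qed.

(* (Sigma^-1 M)_i = M_(i+1).  Unlike Sigma, its inverse needs no cast. *)

Definition desuspension M : dgmod k.
Proof.
exists (fun i => M (i + 1) : lmodType k)
  (fun i => (\- dg_d M (i + 1)) : {linear M (i + 1 + 1) -> M (i + 1)})
  (fun i => (\- dg_X M (i + 1)) : {linear M (i + 1) -> M (i + 1 + 1)})
  => i m /=.
- by rewrite linearN opprK dg_dd.
- by rewrite (linearN (dg_d M _)) (linearN (dg_X M _)) dg_dX.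
Defined.

(* The homotopy pullback of A -f-> N <-s- B: it provides the Ore squares by
   which roofs are composed and brought to a common denominator. *)

Section HomotopyPullback.
Variables (A B N : dgmod k) (f : dgmap A N) (s : dgmap B N).

Definition hpb_car (i : int) : lmodType k := (A i * B i * N (i + 1)%R)%type.

Definition hpb_dfun (i : int) (x : hpb_car (i + 1)) : hpb_car i :=
  (dg_d A i x.1.1, dg_d B i x.1.2,
   f (i + 1) x.1.1 - s (i + 1) x.1.2 - dg_d N (i + 1) x.2).

Definition hpb_Xfun (i : int) (x : hpb_car i) : hpb_car (i + 1) :=
  (dg_X A i x.1.1, dg_X B i x.1.2, - dg_X N (i + 1) x.2).

Lemma hpb_dfun_linear i : linear (@hpb_dfun i).
Proof.
move=> c [[a b] n] [[a' b'] n']; rewrite /hpb_dfun /= !linearP.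
congr (_, _, _); rewrite /= [X in X + _ = _]addrACA.
by rewrite [in RHS]scalerDr [in RHS]scalerDr [RHS]addrACA.
Qed.

Lemma hpb_Xfun_linear i : linear (@hpb_Xfun i).
Proof.
move=> c [[a b] n] [[a' b'] n']; rewrite /hpb_Xfun /= !linearP.
by congr (_, _, _); rewrite /= ?opprD ?scalerN.
Qed.

HB.instance Definition _ (i : int) :=
  GRing.isLinear.Build k (hpb_car (i + 1)) (hpb_car i) _ (@hpb_dfun i)
    (@hpb_dfun_linear i).
HB.instance Definition _ (i : int) :=
  GRing.isLinear.Build k (hpb_car i) (hpb_car (i + 1)) _ (@hpb_Xfun i)
    (@hpb_Xfun_linear i).

Definition hpb : dgmod k.
Proof.
exists hpb_car (fun i => @hpb_dfun i : {linear _ -> _})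
  (fun i => @hpb_Xfun i : {linear _ -> _}) => i [[a b] n].
- rewrite /= /hpb_dfun /= !dg_dd !dgf_d.
  by rewrite !(linearB (dg_d N _)) dg_dd subr0 subrr.
- rewrite /= /hpb_dfun /hpb_Xfun /= !dg_dX !dgf_X (linearN (dg_d N _)) dg_dX.
  by congr (_, _, _); rewrite /= !(linearB (dg_X N _)) !opprK.
Defined.

Definition hpb_fst : dgmap hpb A.
Proof.
by exists (fun i => (fst \o fst : hpb_car i -> A i) : {linear hpb_car i -> A i}).
Defined.

Definition hpb_snd : dgmap hpb B.
Proof.
by exists (fun i => (snd \o fst : hpb_car i -> B i) : {linear hpb_car i -> B i}).
Defined.

Lemma hpb_homotopic : homotopic (dgcomp f hpb_fst) (dgcomp s hpb_snd).
Proof.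
exists (fun i => (snd : hpb_car i -> N (i + 1)) : {linear hpb_car i -> N (i + 1)}).
split=> // i x /=.
by rewrite [RHS]addrC subrK.
Qed.

Lemma quasi_iso_hpb_fst : quasi_iso s -> quasi_iso hpb_fst.
Proof.
move=> [si ss]; split=> [i [[a b] n] /= [da db dn] [a' /= aa']|i a da].
- have fE : f (i + 1) a = dg_d N (i + 1) n + s (i + 1) b.
    by move/eqP: dn; rewrite subr_eq0 subr_eq => /eqP.
  have [b' bb'] : boundary b.
    apply: si => //; exists (f (i + 1 + 1) a' - n).
    by rewrite (linearB (dg_d N _)) -dgf_d -aa' fE [RHS]addrC addKr.
  have [|y [cy [w zw]]] := ss _ (s (i + 1 + 1) b' - f (i + 1 + 1) a' + n).
    rewrite /cycle (linearD (dg_d N _)) (linearB (dg_d N _)) -!dgf_d -aa' -bb'.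
    by rewrite fE opprD [X in X + _ = _]addrCA (subrr (s _ b)) addr0 addNr.
  exists (a', b' - y, - w); rewrite /= /hpb_dfun /=; congr (_, _, _) => //.
    by rewrite (linearB (dg_d B _)) cy subr0.
  rewrite (linearN (dg_d N _)) opprK -zw (linearB (s _)).
  set u := f _ a'; set v := s _ b'; set x := s _ y.
  have -> : u - (v - x) = x - (v - u) by rewrite !opprB addrCA.
  by rewrite -(addrA x) -(addrA (v - u)) addKr addrCA (subrr x) addr0.
- have cfa : cycle (f (i + 1) a) by rewrite /cycle -dgf_d da linear0.
  have [b [db [n bn]]] := ss i _ cfa.
  exists (a, b, n); split; last by exists 0; rewrite linear0 subrr.
  by rewrite /cycle /= /hpb_dfun /= da db bn subrr.
Qed.

End HomotopyPullback.

(* The derived category is the localization of the homotopy category at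
   quasi-isomorphisms.  Its morphisms M -> N are the roofs M <-s- A -f-> N up
   to [roof_eq]; the operations below are operations on representatives. *)

Record roof M N : Type := Roof {
  apex : dgmod k;
  roof_s : dgmap apex M;
  roof_f : dgmap apex N;
  roof_qis : quasi_iso roof_s }.

Definition roof_eq M N (r r' : roof M N) : Prop :=
  exists (C : dgmod k) (u : dgmap C (apex r)) (u' : dgmap C (apex r')),
    [/\ quasi_iso (dgcomp (roof_s r) u),
        homotopic (dgcomp (roof_s r) u) (dgcomp (roof_s r') u') &
        homotopic (dgcomp (roof_f r) u) (dgcomp (roof_f r') u')].

Definition roof_of M N (f : dgmap M N) : roof M N :=
  Roof f (quasi_iso_id M).

Definition roof_id M : roof M M := roof_of (dgid M).

Definition roof_zero M N : roof M N := roof_of (dgzero M N).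

Definition roof_comp M N L (r' : roof N L) (r : roof M N) : roof M L :=
  Roof (dgcomp (roof_f r') (hpb_snd (roof_f r) (roof_s r')))
    (quasi_iso_comp (roof_qis r)
       (quasi_iso_hpb_fst (roof_f r) (roof_qis r'))).

Definition roof_add M N (r r' : roof M N) : roof M N :=
  Roof (dgadd (dgcomp (roof_f r) (hpb_fst (roof_s r) (roof_s r')))
              (dgcomp (roof_f r') (hpb_snd (roof_s r) (roof_s r'))))
    (quasi_iso_comp (roof_qis r)
       (quasi_iso_hpb_fst (roof_s r) (roof_qis r'))).

Definition roof_scale M N (c : k) (r : roof M N) : roof M N :=
  Roof (dgscale c (roof_f r)) (roof_qis r).

Definition roof_sub M N (r r' : roof M N) : roof M N :=
  roof_add r (roof_scale (-1) r').

Definition roof_sum M N (n : nat) (r : 'I_n -> roof M N) : roof M N :=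
  \big[@roof_add M N/roof_zero M N]_(l < n) r l.

Definition roof_invertible M N (r : roof M N) : Prop :=
  exists r' : roof N M,
    roof_eq (roof_comp r' r) (roof_id M) /\
    roof_eq (roof_comp r r') (roof_id N).

Definition D_iso M N : Prop := exists r : roof M N, roof_invertible r.

Definition D_zero M : Prop := roof_eq (roof_id M) (roof_zero M M).

Definition D_direct_sum M (n : nat) (N : 'I_n -> dgmod k) : Prop :=
  exists (inj : forall l, roof (N l) M) (prj : forall l, roof M (N l)),
    [/\ forall l, roof_eq (roof_comp (prj l) (inj l)) (roof_id (N l)),
        forall l l', l != l' ->
          roof_eq (roof_comp (prj l') (inj l)) (roof_zero (N l) (N l')) &
        roof_eq (roof_sum (fun l => roof_comp (inj l) (prj l))) (roof_id M)].

Definition subcat : Type := dgmod k -> Prop.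

Definition Df : subcat := fin_homology.

Definition indecomposable (T : subcat) M : Prop :=
  [/\ T M, ~ D_zero M &
      forall N : 'I_2 -> dgmod k, (forall l, T (N l)) -> D_direct_sum M N ->
        exists l, D_zero (N l)].

(* The Jacobson radical. *)
Definition rad M N (r : roof M N) : Prop :=
  forall r' : roof N M,
    roof_invertible (roof_sub (roof_id M) (roof_comp r' r)).

Definition rad2 (T : subcat) M N (r : roof M N) : Prop :=
  exists (n : nat) (L : 'I_n -> dgmod k)
         (g : forall l, roof M (L l)) (h : forall l, roof (L l) N),
    (forall l, [/\ T (L l), rad (g l) & rad (h l)]) /\
    roof_eq r (roof_sum (fun l => roof_comp (h l) (g l))).

(* dim_k rad_T(M, N) / rad_T^2(M, N) = n, witnessed by a basis *)
Definition irr_dim (T : subcat) M N (n : nat) : Prop :=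
  exists e : 'I_n -> roof M N,
    [/\ forall l, rad (e l),
        forall r : roof M N, rad r -> exists c : 'I_n -> k,
          rad2 T (roof_sub r (roof_sum (fun l => roof_scale (c l) (e l)))) &
        forall c : 'I_n -> k,
          rad2 T (roof_sum (fun l => roof_scale (c l) (e l))) ->
          forall l, c l = 0].

(* Q is the Gabriel quiver of T, the vertex v being the isomorphism class of
   obj v. *)
Definition is_gabriel_quiver (T : subcat) (Q : quiver)
    (obj : vertex Q -> dgmod k) : Prop :=
  [/\ forall v, indecomposable T (obj v),
      forall v w, D_iso (obj v) (obj w) -> v = w,
      forall M, indecomposable T M -> exists v, D_iso M (obj v) &
      forall v w, exists n : nat,
        has_card (arrows_between v w) n /\ irr_dim T (obj v) (obj w) n].

(* The Auslander-Reiten quiver of D^f(k[X]) is its Gabriel quiver.  The rule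
   Sigma (m, n) = (m - 1, n - 1) is expressed with the inverse of Sigma.
   The values of [coord] outside the arcs are irrelevant. *)
Definition is_coordinate_system (coord : int * int -> dgmod k) : Prop :=
  is_gabriel_quiver Df (Q := ZA_infty) (fun a => coord (sval a)) /\
  forall a : int * int, is_arc a ->
    D_iso (coord a) (desuspension (coord (a.1 - 1, a.2 - 1))).

Definition arc_subcat (coord : int * int -> dgmod k) (t : set (int * int)) :
    subcat :=
  fun M => fin_homology M /\
     exists (n : nat) (a : 'I_n -> int * int),
       (forall l, t (a l)) /\ D_direct_sum M (fun l => coord (a l)).

End DGModules.

(* Main.v *)
Require Import Defs.
From HB Require Import structures.
From mathcomp Require Import all_boot all_order all_algebra.
From mathcomp Require Import boolp classical_sets functions cardinality.
From mathcomp Require Import zify ring.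
Import Defs.
Set Implicit Arguments.
Unset Strict Implicit.
Unset Printing Implicit Defensive.
Import Order.TTheory GRing.Theory Num.Theory.
Local Open Scope ring_scope.

(** Over the hereditary ring [k[X]] every object of [D^f] is determined by its
    homology, a graded module of finite length; the indecomposable objects are
    therefore the interval modules, one-dimensional in the degrees of an
    interval and zero outside.  An arc [(m, n)] names the interval
    [[-n, -m - 2]].  Both facts are used only in the form of explicit models:
    [Pmod u v], free on two generators, computes morphisms out of the interval
    module on [[u + 1, v]] ([Pmod_lift], [hof_surj], [hof_inj]), and the
    injective model [Imod u v] receives morphisms given by linear functionals
    ([to_Imod]).

    Morphisms.  Between two interval modules the space of morphisms has
    dimension at most one ([hom_span]).  It is spanned by a map of modules (a
    hom map) or by an extension class (an ext map), according to two mutually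
    exclusive inequalities between the arcs ([hom_arcs], [ext_arcs]), and
    vanishes otherwise ([hom_zero]).  Compositions hom-hom, hom-ext and ext-hom
    are nonzero as soon as the inequalities allow it ([std_comp]), because on
    the models they are given by the same formulas.

    Coordinates.  An object with finite homology which is not zero has an
    interval module as a direct summand: start the interval at a homology class
    that survives a maximal number of multiplications by [X], and split with a
    functional that detects its last multiple ([Df_indecomposable]).  Hence the
    coordinate system induces a bijection between arcs and interval modules.
    Morphisms that do not go one step along the Auslander-Reiten quiver factor
    through such a step ([Df_not_step_rad2]), so this bijection is an injective
    map of quivers; the quiver has no automorphisms but the translations
    ([s_translation]), and all inequalities between arcs are invariant under
    translation.  So the objects [coord a] have the morphisms of the interval
    modules ([coord_std] and the lemmas that follow it).

    Arrows.  Let [a] and [b] be distinct arcs of the triangulation with a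
    nonzero morphism from [a] to [b].  As they do not cross, they share an
    endpoint, and they are two edges of a triangle in the cyclic order of the
    arrows of the exchange quiver.  If the third edge is missing from the
    triangulation, some arc of the triangulation crosses it by maximality; not
    crossing [a] and [b], this arc has their common endpoint as an endpoint and
    the morphism factors through it ([not_qarrow_middle]).  If the third edge is
    there, no arc of the triangulation can carry such a factorization
    ([qarrow_no_middle]).  Since endomorphism rings are [k], radical morphisms
    through a direct sum reduce to those through its summands
    ([rad_comp_sum0]), and the irreducible morphisms of the subcategory are
    exactly the arrows of the exchange quiver. *)

(** * Homotopies, cycles and boundaries *)
Section Homotopy.
Variable k : fieldType.
Implicit Types M N L A B C : dgmod k.

Section LinearRules.
Variables (M N : dgmod k) (f : dgmap M N) (i : int).
Lemma dN (x : M (i + 1)) : dg_d M i (- x) = - dg_d M i x.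
Proof. exact: linearN. Qed.
Lemma dD (x y : M (i + 1)) : dg_d M i (x + y) = dg_d M i x + dg_d M i y.
Proof. exact: linearD. Qed.
Lemma dB (x y : M (i + 1)) : dg_d M i (x - y) = dg_d M i x - dg_d M i y.
Proof. exact: linearB. Qed.
Lemma dZ c (x : M (i + 1)) : dg_d M i (c *: x) = c *: dg_d M i x.
Proof. exact: linearZ. Qed.
Lemma XN (x : M i) : dg_X M i (- x) = - dg_X M i x.
Proof. exact: linearN. Qed.
Lemma XD (x y : M i) : dg_X M i (x + y) = dg_X M i x + dg_X M i y.
Proof. exact: linearD. Qed.
Lemma XZ c (x : M i) : dg_X M i (c *: x) = c *: dg_X M i x.
Proof. exact: linearZ. Qed.
Lemma fN (x : M i) : f i (- x) = - f i x.
Proof. exact: linearN. Qed.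
Lemma fD (x y : M i) : f i (x + y) = f i x + f i y.
Proof. exact: linearD. Qed.
Lemma fB (x y : M i) : f i (x - y) = f i x - f i y.
Proof. exact: linearB. Qed.
Lemma fZ c (x : M i) : f i (c *: x) = c *: f i x.
Proof. exact: linearZ. Qed.
End LinearRules.

Lemma htp_eq M N (f g : dgmap M N) : (forall i m, f i m = g i m) -> homotopic f g.
Proof.
move=> fg; exists (fun i => \0 : {linear M i -> N (i + 1)}); split=> i m /=.
  by rewrite linear0 oppr0.
by rewrite fg subrr linear0 add0r.
Qed.

Lemma htp_refl M N (f : dgmap M N) : homotopic f f.
Proof. exact: htp_eq. Qed.

Lemma htp_sym M N (f g : dgmap M N) : homotopic f g -> homotopic g f.
Proof.
case=> h [hX hd]; exists (fun i => (\- h i) : {linear M i -> N (i + 1)}).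
split=> i m /=; first by rewrite hX XN.
by rewrite -opprB hd dN opprD.
Qed.

Lemma htp_trans M N (f g e : dgmap M N) :
  homotopic f g -> homotopic g e -> homotopic f e.
Proof.
case=> h [hX hd] [h' [hX' hd']].
exists (fun i => (h i \+ h' i) : {linear M i -> N (i + 1)}).
split=> i m /=; first by rewrite hX hX' XD opprD.
by rewrite -(subrK (g (i + 1) m) (f _ m)) -addrA hd hd' dD addrACA.
Qed.

Lemma htp_compl M N L (u : dgmap N L) (f g : dgmap M N) :
  homotopic f g -> homotopic (dgcomp u f) (dgcomp u g).
Proof.
case=> h [hX hd].
exists (fun i => (u (i + 1) \o h i) : {linear M i -> L (i + 1)}).
split=> i m /=; first by rewrite hX fN dgf_X.
by rewrite -fB hd fD dgf_d.
Qed.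

Lemma htp_compr M N L (u : dgmap M N) (f g : dgmap N L) :
  homotopic f g -> homotopic (dgcomp f u) (dgcomp g u).
Proof.
case=> h [hX hd].
exists (fun i => (h i \o u i) : {linear M i -> L (i + 1)}).
by split=> i m /=; rewrite ?dgf_X ?hX // hd dgf_d.
Qed.

Lemma htp_add M N (f g f' g' : dgmap M N) :
  homotopic f g -> homotopic f' g' -> homotopic (dgadd f f') (dgadd g g').
Proof.
case=> h [hX hd] [h' [hX' hd']].
exists (fun i => (h i \+ h' i) : {linear M i -> N (i + 1)}).
split=> i m /=; first by rewrite hX hX' XD opprD.
by rewrite opprD addrACA hd hd' dD addrACA.
Qed.

Lemma htp_scale M N (c : k) (f g : dgmap M N) :
  homotopic f g -> homotopic (dgscale c f) (dgscale c g).
Proof.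
case=> h [hX hd].
exists (fun i => (c \*: h i) : {linear M i -> N (i + 1)}).
split=> i m /=; first by rewrite hX XZ scalerN.
by rewrite -scalerBr hd scalerDr dZ.
Qed.

Lemma htp_boundary M N (f g : dgmap M N) i (z : M (i + 1)) :
  homotopic f g -> cycle z -> boundary (f (i + 1) z - g (i + 1) z).
Proof.
case=> h [hX hd] cz; exists (h (i + 1) z).
by rewrite hd cz linear0 addr0.
Qed.

Lemma boundary0 M i : boundary (0 : M i).
Proof. by exists 0; rewrite linear0. Qed.

Lemma boundaryD M i (x y : M i) : boundary x -> boundary y -> boundary (x + y).
Proof. by move=> [a ->] [b ->]; exists (a + b); rewrite linearD. Qed.

Lemma boundaryZ M i c (x : M i) : boundary x -> boundary (c *: x).
Proof. by move=> [a ->]; exists (c *: a); rewrite linearZ. Qed.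

Lemma boundaryN M i (x : M i) : boundary x -> boundary (- x).
Proof. by move=> [a ->]; exists (- a); rewrite linearN. Qed.

Lemma cycleB M i (x y : M (i + 1)) : cycle x -> cycle y -> cycle (x - y).
Proof. by rewrite /cycle dB => -> ->; rewrite subrr. Qed.

Lemma cycleZ M i c (x : M (i + 1)) : cycle x -> cycle (c *: x).
Proof. by rewrite /cycle dZ => ->; rewrite scaler0. Qed.

Lemma cycleD M i (x y : M (i + 1)) : cycle x -> cycle y -> cycle (x + y).
Proof. by rewrite /cycle dD => -> ->; rewrite addr0. Qed.

Lemma cycle_map M N (f : dgmap M N) i (x : M (i + 1)) :
  cycle x -> cycle (f _ x).
Proof. by rewrite /cycle -dgf_d => ->; rewrite linear0. Qed.

Lemma boundary_map M N (f : dgmap M N) i (x : M i) :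
  boundary x -> boundary (f _ x).
Proof. by case=> w ->; exists (f _ w); rewrite dgf_d. Qed.

Lemma boundary_trans M i (x y : M i) : boundary (x - y) -> boundary y -> boundary x.
Proof. by move=> bxy bY; rewrite -(subrK y x); apply: boundaryD. Qed.

Lemma quasi_iso_htp M N (f g : dgmap M N) :
  homotopic f g -> quasi_iso f -> quasi_iso g.
Proof.
move=> fg [fi fs]; split=> [i z cz bz|i z cz].
  apply: fi => //; apply: boundary_trans bz; exact: htp_boundary.
have [y [cy bY]] := fs i z cz; exists y; split=> //.
rewrite -(subrK (f _ y) z) -addrA; apply: boundaryD => //; exact: htp_boundary.
Qed.

Lemma quasi_iso_cancel M N L (g : dgmap N L) (f : dgmap M N) :
  quasi_iso g -> quasi_iso (dgcomp g f) -> quasi_iso f.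
Proof.
move=> [gi gs] [gfi gfs]; split=> [i z cz bz|i z cz].
  by apply: gfi => //=; apply: boundary_map.
have [y [cy bY]] := gfs i _ (cycle_map g cz); exists y; split=> //.
apply: gi; first by apply: cycleB => //; apply: cycle_map.
by rewrite fB.
Qed.

Section Pair.
Variables (A B N : dgmod k) (f : dgmap A N) (s : dgmap B N).

(** The third component of the map to the homotopy pullback is the homotopy
    itself; this turns each identity up to homotopy into an honest map. *)
Lemma hpb_lift E (a : dgmap E A) (b : dgmap E B) :
  homotopic (dgcomp f a) (dgcomp s b) ->
  exists p : dgmap E (hpb f s),
    (forall i x, hpb_fst f s i (p i x) = a i x) /\
    (forall i x, hpb_snd f s i (p i x) = b i x).
Proof.
case=> h [hX hd].
pose q i x : hpb f s i := (a i x, b i x, h i x).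
have ql i : linear (q i).
  by move=> c x y; rewrite /q !linearP.
pose qL i := GRing.isLinear.Build k _ _ _ (q i) (ql i).
pose qq i : {linear E i -> hpb f s i} := HB.pack (q i) (qL i).
have qd i m : qq i (dg_d E i m) = dg_d (hpb f s) i (qq (i + 1) m).
  rewrite /= /q /hpb_dfun /= !dgf_d; congr (_, _, _).
  by have /= -> := hd i m; rewrite addrAC subrr add0r.
have qX i m : qq (i + 1) (dg_X E i m) = dg_X (hpb f s) i (qq i m).
  by rewrite /= /q /hpb_Xfun /= !dgf_X hX.
by exists (DGMap qd qX).
Qed.

End Pair.

End Homotopy.

(** * Operations on roofs are well defined *)
Section Roofs.
Variable k : fieldType.
Implicit Types M N L A B C : dgmod k.

Local Notation "f ~ g" := (homotopic f g) (at level 70).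
Local Notation "f <.> g" := (dgcomp f g) (at level 40, left associativity).

Lemma htp_assoc M N L A (f : dgmap L A) (g : dgmap N L) (h : dgmap M N) :
  f <.> g <.> h ~ f <.> (g <.> h).
Proof. exact: htp_eq. Qed.

Lemma htp_compr_assoc M N L A B (f : dgmap N A) (f' : dgmap B A) (g : dgmap M N)
    (g' : dgmap M B) (h : dgmap L M) :
  f <.> g ~ f' <.> g' -> f <.> (g <.> h) ~ f' <.> (g' <.> h).
Proof.
move=> H; apply: htp_trans (htp_sym (htp_assoc _ _ _)) _.
apply: htp_trans (htp_assoc _ _ _); exact: htp_compr.
Qed.

Lemma roof_eq_refl M N (r : roof M N) : roof_eq r r.
Proof.
exists (apex r), (dgid _), (dgid _); split; try exact: htp_refl.
by apply: quasi_iso_htp (roof_qis r); apply: htp_eq.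
Qed.

Lemma roof_eq_sym M N (r r' : roof M N) : roof_eq r r' -> roof_eq r' r.
Proof.
case=> C [u [u' [q ss ff]]]; exists C, u', u; split; try exact: htp_sym.
exact: quasi_iso_htp q.
Qed.

(** The two witnesses are joined over their common apex by a homotopy pullback,
    whose first projection is a quasi-isomorphism because [v] is one. *)
Lemma roof_eq_trans M N (r r' r'' : roof M N) :
  roof_eq r r' -> roof_eq r' r'' -> roof_eq r r''.
Proof.
case=> C [u [u' [q ss ff]]] [D [v [v' [q' ss' ff']]]].
have qv : quasi_iso v by apply: quasi_iso_cancel q'; apply: roof_qis.
pose e := hpb_fst u' v; pose d := hpb_snd u' v.
have ed : u' <.> e ~ v <.> d := hpb_homotopic u' v.
exists (hpb u' v), (u <.> e), (v' <.> d); split.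
- apply: quasi_iso_htp (htp_assoc _ _ _) _.
  by apply: quasi_iso_comp => //; apply: quasi_iso_hpb_fst.
- apply: htp_trans (htp_compr_assoc _ ss) _.
  apply: htp_trans (htp_compl _ ed) _; exact: htp_compr_assoc.
- apply: htp_trans (htp_compr_assoc _ ff) _.
  apply: htp_trans (htp_compl _ ed) _; exact: htp_compr_assoc.
Qed.

(** The homotopy pullback of the two witnesses maps to both composites, by the
    universal property of the homotopy pullbacks that define these. *)
Lemma roof_comp_congr M N L (r r1 : roof M N) (r' r1' : roof N L) :
  roof_eq r r1 -> roof_eq r' r1' -> roof_eq (roof_comp r' r) (roof_comp r1' r1).
Proof.
case: r r1 => A s f q [A1 s1 f1 q1]; case: r' r1' => B t f' q' [B1 t1 f1' q1'].
case=> C [u [u1 /= [qu ss ff]]] [D [v [v1 /= [qv tt gg]]]].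
pose e := hpb_fst (f <.> u) (t <.> v); pose d := hpb_snd (f <.> u) (t <.> v).
have qe : quasi_iso e by apply: quasi_iso_hpb_fst.
have ed : f <.> u <.> e ~ t <.> v <.> d := hpb_homotopic _ _.
have [p [p1 p2]] : exists p : dgmap (hpb (f <.> u) (t <.> v)) (hpb f t),
    (forall i x, hpb_fst f t i (p i x) = (u <.> e) i x) /\
    (forall i x, hpb_snd f t i (p i x) = (v <.> d) i x).
  apply: hpb_lift; apply: htp_trans (htp_sym (htp_assoc _ _ _)) _.
  exact: htp_trans ed (htp_assoc _ _ _).
have [p' [p1' p2']] : exists p : dgmap (hpb (f <.> u) (t <.> v)) (hpb f1 t1),
    (forall i x, hpb_fst f1 t1 i (p i x) = (u1 <.> e) i x) /\
    (forall i x, hpb_snd f1 t1 i (p i x) = (v1 <.> d) i x).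
  apply: hpb_lift; apply: htp_trans (htp_sym (htp_assoc _ _ _)) _.
  apply: htp_trans (htp_compr _ (htp_sym ff)) _.
  apply: htp_trans ed _; apply: htp_trans (htp_compr _ tt) _.
  exact: htp_assoc.
have S1 : s <.> u <.> e ~ s <.> hpb_fst f t <.> p.
  by apply: htp_eq => i x /=; congr (s i _); rewrite -[LHS]p1.
have S2 : s1 <.> u1 <.> e ~ s1 <.> hpb_fst f1 t1 <.> p'.
  by apply: htp_eq => i x /=; congr (s1 i _); rewrite -[LHS]p1'.
exists (hpb (f <.> u) (t <.> v)), p, p'; split=> /=.
- apply: quasi_iso_htp S1 _; exact: quasi_iso_comp.
- apply: htp_trans (htp_sym S1) _; apply: htp_trans S2.
  exact: htp_compr.
- apply: (@htp_trans _ _ _ _ (f' <.> v <.> d)).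
    by apply: htp_eq => i x /=; congr (f' i _); rewrite -[RHS]p2.
  apply: (@htp_trans _ _ _ _ (f1' <.> v1 <.> d)); first exact: htp_compr.
  by apply: htp_eq => i x /=; congr (f1' i _); rewrite -[LHS]p2'.
Qed.

Lemma roof_add_congr M N (r r1 : roof M N) (r' r1' : roof M N) :
  roof_eq r r1 -> roof_eq r' r1' -> roof_eq (roof_add r r') (roof_add r1 r1').
Proof.
case: r r1 => A s f q [A1 s1 f1 q1]; case: r' r1' => B t f' q' [B1 t1 f1' q1'].
case=> C [u [u1 /= [qu ss ff]]] [D [v [v1 /= [qv tt gg]]]].
pose e := hpb_fst (s <.> u) (t <.> v); pose d := hpb_snd (s <.> u) (t <.> v).
have qe : quasi_iso e by apply: quasi_iso_hpb_fst.
have ed : s <.> u <.> e ~ t <.> v <.> d := hpb_homotopic _ _.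
have [p [p1 p2]] : exists p : dgmap (hpb (s <.> u) (t <.> v)) (hpb s t),
    (forall i x, hpb_fst s t i (p i x) = (u <.> e) i x) /\
    (forall i x, hpb_snd s t i (p i x) = (v <.> d) i x).
  apply: hpb_lift; apply: htp_trans (htp_sym (htp_assoc _ _ _)) _.
  exact: htp_trans ed (htp_assoc _ _ _).
have [p' [p1' p2']] : exists p : dgmap (hpb (s <.> u) (t <.> v)) (hpb s1 t1),
    (forall i x, hpb_fst s1 t1 i (p i x) = (u1 <.> e) i x) /\
    (forall i x, hpb_snd s1 t1 i (p i x) = (v1 <.> d) i x).
  apply: hpb_lift; apply: htp_trans (htp_sym (htp_assoc _ _ _)) _.
  apply: htp_trans (htp_compr _ (htp_sym ss)) _.
  apply: htp_trans ed _; apply: htp_trans (htp_compr _ tt) _.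
  exact: htp_assoc.
have S1 : s <.> u <.> e ~ s <.> hpb_fst s t <.> p.
  by apply: htp_eq => i x /=; congr (s i _); rewrite -[LHS]p1.
have S2 : s1 <.> u1 <.> e ~ s1 <.> hpb_fst s1 t1 <.> p'.
  by apply: htp_eq => i x /=; congr (s1 i _); rewrite -[LHS]p1'.
exists (hpb (s <.> u) (t <.> v)), p, p'; split=> /=.
- apply: quasi_iso_htp S1 _; exact: quasi_iso_comp.
- apply: htp_trans (htp_sym S1) _; apply: htp_trans S2.
  exact: htp_compr.
- apply: (@htp_trans _ _ _ _ (dgadd (f <.> u <.> e) (f' <.> v <.> d))).
    apply: htp_eq => i x /=.
    by congr (f i _ + f' i _); [rewrite -[RHS]p1 | rewrite -[RHS]p2].
  apply: (@htp_trans _ _ _ _ (dgadd (f1 <.> u1 <.> e) (f1' <.> v1 <.> d))).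
    by apply: htp_add; apply: htp_compr.
  apply: htp_eq => i x /=.
  by congr (f1 i _ + f1' i _); [rewrite -[LHS]p1' | rewrite -[LHS]p2'].
Qed.

Lemma roof_scale_congr M N c (r r' : roof M N) :
  roof_eq r r' -> roof_eq (roof_scale c r) (roof_scale c r').
Proof.
case=> C [u [u' [q ss ff]]]; exists C, u, u'; split=> //=.
apply: (@htp_trans _ _ _ _ (dgscale c (roof_f r <.> u))); first exact: htp_eq.
apply: (@htp_trans _ _ _ _ (dgscale c (roof_f r' <.> u'))); last exact: htp_eq.
exact: htp_scale.
Qed.

(** When the numerator of the first roof factors through the apex of the second,
    the homotopy pullback is not needed to compose. *)
Lemma roof_compE M N L A B (s : dgmap A M) (f : dgmap A N) (q : quasi_iso s)
    (t : dgmap B N) (g : dgmap B L) (q' : quasi_iso t) (b : dgmap A B) :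
  f ~ t <.> b -> roof_eq (roof_comp (Roof g q') (Roof f q)) (Roof (g <.> b) q).
Proof.
move=> fb; have [|p [p1 p2]] := @hpb_lift _ _ _ _ f t A (dgid A) b.
  by apply: htp_trans fb; apply: htp_eq.
exists A, p, (dgid A); split=> /=.
- by apply: quasi_iso_htp q; apply: htp_eq => i x /=; have /= -> := p1 i x.
- by apply: htp_eq => i x /=; have /= -> := p1 i x.
- by apply: htp_eq => i x /=; have /= -> := p2 i x.
Qed.

Lemma roof_addE M N A (s : dgmap A M) (q : quasi_iso s) (f g : dgmap A N) :
  roof_eq (roof_add (Roof f q) (Roof g q)) (Roof (dgadd f g) q).
Proof.
have [|p [p1 p2]] := @hpb_lift _ _ _ _ s s A (dgid A) (dgid A).
  exact: htp_refl.
exists A, p, (dgid A); split=> /=.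
- by apply: quasi_iso_htp q; apply: htp_eq => i x /=; have /= -> := p1 i x.
- by apply: htp_eq => i x /=; have /= -> := p1 i x.
- apply: htp_eq => i x /=.
  by have /= -> := p1 i x; have /= -> := p2 i x.
Qed.

Lemma roof_eq_frac M N A C (s : dgmap A M) (q : quasi_iso s) (f : dgmap A N)
    (s' : dgmap C M) (q' : quasi_iso s') (f' : dgmap C N) (u : dgmap C A) :
  s' ~ s <.> u -> f' ~ f <.> u -> roof_eq (Roof f' q') (Roof f q).
Proof.
move=> ss ff; exists C, (dgid C), u; split=> /=.
- by apply: quasi_iso_htp q'; apply: htp_eq.
- by apply: htp_trans ss; apply: htp_eq.
- by apply: htp_trans ff; apply: htp_eq.
Qed.

End Roofs.

(** * The derived category *)
Section DerivedCategory.
Variable k : fieldType.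
Implicit Types M N L A B C : dgmod k.

Local Notation "f ~ g" := (homotopic f g) (at level 70).
Local Notation "f <.> g" := (dgcomp f g) (at level 40, left associativity).

(** Morphisms of the derived category as equivalence classes, so that identities
    between them are equalities.  Roofs range over all dg-modules, so these types
    live in a universe above that of vector spaces, and the linear structure is
    given by explicit operations. *)
Definition hom M N : Type := {c : roof M N -> Prop | exists r, c = roof_eq r}.

Definition hcl M N (r : roof M N) : hom M N :=
  exist _ (roof_eq r) (ex_intro _ r erefl).

Lemma hclP M N (r r' : roof M N) : hcl r = hcl r' <-> roof_eq r r'.
Proof.
split=> [/(congr1 sval) /= ->|rr']; first exact: roof_eq_refl.
have e : roof_eq r = roof_eq r'.
  apply: funext => x; apply: propext; split; last exact: roof_eq_trans.
  exact/roof_eq_trans/roof_eq_sym.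
rewrite /hcl; move: (ex_intro _ _ _) (ex_intro _ _ _); rewrite e => p p'.
by congr exist; apply: Prop_irrelevance.
Qed.

Lemma hcl_surj M N (x : hom M N) : exists r, hcl r = x.
Proof.
case: x => c [r cr]; exists r; rewrite /hcl; move: (ex_intro _ _ _) (ex_intro _ _ _).
by rewrite -cr => p p'; congr exist; apply: Prop_irrelevance.
Qed.

(** A chosen representative; the operations below are those on representatives,
    and the lemmas [hcl_comp], [hcl_add], [hcl_scale] remove the choice. *)
Definition hrep M N (x : hom M N) : roof M N := projT1 (cid (hcl_surj x)).

Lemma hrepK M N (x : hom M N) : hcl (hrep x) = x.
Proof. exact: (projT2 (cid (hcl_surj x))). Qed.

Lemma roof_eq_hrep M N (r : roof M N) : roof_eq (hrep (hcl r)) r.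
Proof. by apply/hclP; rewrite hrepK. Qed.

Definition hcomp M N L (g : hom N L) (f : hom M N) : hom M L :=
  hcl (roof_comp (hrep g) (hrep f)).
Definition hadd M N (f g : hom M N) : hom M N := hcl (roof_add (hrep f) (hrep g)).
Definition hscale M N (c : k) (f : hom M N) : hom M N := hcl (roof_scale c (hrep f)).
Definition hzero M N : hom M N := hcl (roof_zero M N).
Definition hid M : hom M M := hcl (roof_id M).
Definition hof M N (f : dgmap M N) : hom M N := hcl (roof_of f).

Lemma hcl_comp M N L (g : roof N L) (f : roof M N) :
  hcl (roof_comp g f) = hcomp (hcl g) (hcl f).
Proof. by apply/hclP/roof_comp_congr; apply/roof_eq_sym/roof_eq_hrep. Qed.

Lemma hcl_add M N (g f : roof M N) : hcl (roof_add g f) = hadd (hcl g) (hcl f).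
Proof. by apply/hclP/roof_add_congr; apply/roof_eq_sym/roof_eq_hrep. Qed.

Lemma hcl_scale M N c (f : roof M N) : hcl (roof_scale c f) = hscale c (hcl f).
Proof. by apply/hclP/roof_scale_congr; apply/roof_eq_sym/roof_eq_hrep. Qed.

(** * Fractions *)

(** The morphism [f s^-1]. *)
Definition fr M N A (s : dgmap A M) (q : quasi_iso s) (f : dgmap A N) : hom M N :=
  hcl (Roof f q).

Lemma fr_ex M N (x : hom M N) :
  exists A (s : dgmap A M) (q : quasi_iso s) f, x = fr q f.
Proof. by case: (hcl_surj x) => -[A s f q] <-; exists A, s, q, f. Qed.

Lemma fr_eq M N A C (s : dgmap A M) (q : quasi_iso s) (f : dgmap A N)
    (s' : dgmap C M) (q' : quasi_iso s') (f' : dgmap C N) (u : dgmap C A) :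
  s' ~ s <.> u -> f' ~ f <.> u -> fr q f = fr q' f'.
Proof. by move=> ss ff; apply/hclP/roof_eq_sym/roof_eq_frac; eassumption. Qed.

Lemma fr_htp M N A (s : dgmap A M) (q : quasi_iso s) (f f' : dgmap A N) :
  f ~ f' -> fr q f = fr q f'.
Proof.
move=> ff; apply: (@fr_eq _ _ _ _ _ _ _ _ _ _ (dgid A)); first exact: htp_eq.
by apply: htp_trans (htp_sym ff) _; apply: htp_eq.
Qed.

Lemma fr_refine M N A C (s : dgmap A M) (q : quasi_iso s) (f : dgmap A N)
    (u : dgmap C A) (qu : quasi_iso u) :
  fr q f = fr (quasi_iso_comp q qu) (f <.> u).
Proof. by apply: (@fr_eq _ _ _ _ _ _ _ _ _ _ u); apply: htp_refl. Qed.

(** The Ore condition, which makes fractions composable: a numerator lifts along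
    a quasi-isomorphism once the denominator is enlarged. *)
Lemma lift_refine M N B (f : dgmap M N) (t : dgmap B N) :
  quasi_iso t -> exists C (u : dgmap C M) (b : dgmap C B),
    quasi_iso u /\ f <.> u ~ t <.> b.
Proof.
move=> q; exists (hpb f t), (hpb_fst f t), (hpb_snd f t).
split; [exact: quasi_iso_hpb_fst | exact: hpb_homotopic].
Qed.

(** Common denominators. *)
Lemma fr_common M N L (x : hom M N) (y : hom M L) :
  exists A (s : dgmap A M) (q : quasi_iso s) f g, x = fr q f /\ y = fr q g.
Proof.
have [A [s [q [f ->]]]] := fr_ex x; have [B [t [q' [g ->]]]] := fr_ex y.
have [C [u [b [qu sb]]]] := lift_refine s q'.
exists C, (s <.> u), (quasi_iso_comp q qu), (f <.> u), (g <.> b).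
split; first exact: fr_refine.
by apply: (@fr_eq _ _ _ _ _ _ _ _ _ _ b) => //; apply: htp_refl.
Qed.

Lemma fr_compE M N L A B (s : dgmap A M) (f : dgmap A N) (q : quasi_iso s)
    (t : dgmap B N) (g : dgmap B L) (q' : quasi_iso t) (b : dgmap A B) :
  f ~ t <.> b -> hcomp (fr q' g) (fr q f) = fr q (g <.> b).
Proof. by move=> fb; rewrite -hcl_comp; apply/hclP/roof_compE. Qed.

Lemma fr_addE M N A (s : dgmap A M) (q : quasi_iso s) (f g : dgmap A N) :
  hadd (fr q f) (fr q g) = fr q (dgadd f g).
Proof. by rewrite -hcl_add; apply/hclP/roof_addE. Qed.

Lemma fr_scaleE M N A (s : dgmap A M) (q : quasi_iso s) c (f : dgmap A N) :
  hscale c (fr q f) = fr q (dgscale c f).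
Proof. by rewrite -hcl_scale. Qed.

Lemma fr0 M N A (s : dgmap A M) (q : quasi_iso s) : fr q (dgzero A N) = hzero M N.
Proof. by apply/esym/(@fr_eq _ _ _ _ _ _ _ _ _ _ s); apply: htp_eq. Qed.

Lemma fr1 M A (s : dgmap A M) (q : quasi_iso s) : fr q s = hid M.
Proof. by apply/esym/(@fr_eq _ _ _ _ _ _ _ _ _ _ s); apply: htp_eq. Qed.

Lemma fr_lift M N B (x : hom M N) (t : dgmap B N) :
  quasi_iso t -> exists A (s : dgmap A M) (q : quasi_iso s) (b : dgmap A B),
    x = fr q (t <.> b).
Proof.
move=> qt; have [A [s [q [f ->]]]] := fr_ex x.
have [C [u [b [qu sb]]]] := lift_refine f qt.
exists C, (s <.> u), (quasi_iso_comp q qu), b.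
by rewrite (fr_refine _ _ qu); apply: fr_htp.
Qed.

Lemma fr_compT M N L A B (s : dgmap A M) (q : quasi_iso s)
    (t : dgmap B N) (g : dgmap B L) (q' : quasi_iso t) (b : dgmap A B) :
  hcomp (fr q' g) (fr q (t <.> b)) = fr q (g <.> b).
Proof. exact/fr_compE/htp_refl. Qed.

(** * The laws of a k-linear category *)

(** Lift the numerators successively, so that all three morphisms are fractions
    whose numerators factor through the next denominator. *)
Lemma hcompA M N L A (h : hom L A) (g : hom N L) (f : hom M N) :
  hcomp h (hcomp g f) = hcomp (hcomp h g) f.
Proof.
have [W [w [qw [h0 ->]]]] := fr_ex h.
have [B [t [qt [g0 ->]]]] := fr_lift g qw.
have [C [s [q [f0 ->]]]] := fr_lift f qt.
rewrite !fr_compT; rewrite (_ : fr q _ = fr q (w <.> (g0 <.> f0))).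
  by rewrite fr_compT; apply: fr_htp; apply: htp_eq.
exact/fr_htp/htp_assoc.
Qed.

Lemma hcomp1l M N (f : hom M N) : hcomp (hid N) f = f.
Proof.
have [A [s [q [f0 ->]]]] := fr_ex f.
rewrite -(fr1 (quasi_iso_id N)) (@fr_compE _ _ _ _ _ _ _ _ _ _ _ f0); last exact: htp_eq.
exact/fr_htp/htp_eq.
Qed.

Lemma hcomp1r M N (f : hom M N) : hcomp f (hid M) = f.
Proof.
have [A [s [q [f0 ->]]]] := fr_ex f.
rewrite -(fr1 q) (@fr_compE _ _ _ _ _ _ _ _ _ _ _ (dgid A)); last exact: htp_eq.
exact/fr_htp/htp_eq.
Qed.

Lemma haddC M N : commutative (@hadd M N).
Proof.
move=> x y; have [A [s [q [f [g [-> ->]]]]]] := fr_common x y.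
by rewrite !fr_addE; apply/fr_htp/htp_eq => i m /=; rewrite addrC.
Qed.

Lemma haddA M N : associative (@hadd M N).
Proof.
move=> x y z; have [A [s [q [f [g [-> ->]]]]]] := fr_common x y.
have [B [t [q' [h ->]]]] := fr_ex z; have [C [u [b [qu sb]]]] := lift_refine s q'.
rewrite (@fr_eq _ _ _ _ _ q' h _ (quasi_iso_comp q qu) (h <.> b) b) //; last exact: htp_refl.
rewrite !(fr_refine q _ qu) !fr_addE.
by apply/fr_htp/htp_eq => i m /=; rewrite addrA.
Qed.

Lemma hadd0l M N : left_id (hzero M N) (@hadd M N).
Proof.
move=> x; have [A [s [q [f ->]]]] := fr_ex x; rewrite -(fr0 _ q) fr_addE.
by apply/fr_htp/htp_eq => i m /=; rewrite add0r.
Qed.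

HB.instance Definition _ M N :=
  Monoid.isComLaw.Build (hom M N) (hzero M N) (@hadd M N)
    (@haddA M N) (@haddC M N) (@hadd0l M N).

Lemma hadd0r M N (x : hom M N) : hadd x (hzero M N) = x.
Proof. by rewrite haddC hadd0l. Qed.

Lemma hscale1 M N (x : hom M N) : hscale 1 x = x.
Proof.
have [A [s [q [f ->]]]] := fr_ex x; rewrite fr_scaleE.
by apply/fr_htp/htp_eq => i m /=; rewrite scale1r.
Qed.

Lemma hscale0 M N (x : hom M N) : hscale 0 x = hzero M N.
Proof.
have [A [s [q [f ->]]]] := fr_ex x; rewrite fr_scaleE -(fr0 _ q).
by apply/fr_htp/htp_eq => i m /=; rewrite scale0r.
Qed.

Lemma hscaleA M N a b (x : hom M N) : hscale a (hscale b x) = hscale (a * b) x.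
Proof.
have [A [s [q [f ->]]]] := fr_ex x; rewrite !fr_scaleE.
by apply/fr_htp/htp_eq => i m /=; rewrite scalerA.
Qed.

Lemma hscaleDl M N a b (x : hom M N) :
  hscale (a + b) x = hadd (hscale a x) (hscale b x).
Proof.
have [A [s [q [f ->]]]] := fr_ex x; rewrite !fr_scaleE fr_addE.
by apply/fr_htp/htp_eq => i m /=; rewrite scalerDl.
Qed.

Lemma hscaler0 M N a : hscale a (hzero M N) = hzero M N.
Proof. by rewrite -(hscale0 (hzero M N)) hscaleA mulr0. Qed.

Lemma hcompDl M N L (g g' : hom N L) (f : hom M N) :
  hcomp (hadd g g') f = hadd (hcomp g f) (hcomp g' f).
Proof.
have [B [t [qt [g0 [g1 [-> ->]]]]]] := fr_common g g'.
have [C [s [q [f0 ->]]]] := fr_lift f qt.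
by rewrite fr_addE !fr_compT fr_addE; apply/fr_htp/htp_eq.
Qed.

Lemma hcompDr M N L (g : hom N L) (f f' : hom M N) :
  hcomp g (hadd f f') = hadd (hcomp g f) (hcomp g f').
Proof.
have [B [t [qt [g0 ->]]]] := fr_ex g.
have [A [s [q [f0 [f1 [-> ->]]]]]] := fr_common f f'.
have [C [u [b [qu fb]]]] := lift_refine f0 qt.
have [D [v [d [qv fd]]]] := lift_refine (f1 <.> u) qt.
rewrite !(fr_refine q _ qu) !(fr_refine _ _ qv).
have -> : fr (quasi_iso_comp (quasi_iso_comp q qu) qv) (f0 <.> u <.> v)
   = fr (quasi_iso_comp (quasi_iso_comp q qu) qv) (t <.> (b <.> v)).
  by apply/fr_htp; apply: htp_trans (htp_compr _ fb) _; apply: htp_assoc.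
have -> : fr (quasi_iso_comp (quasi_iso_comp q qu) qv) (f1 <.> u <.> v)
   = fr (quasi_iso_comp (quasi_iso_comp q qu) qv) (t <.> d) by apply/fr_htp.
rewrite !fr_compT !fr_addE (@fr_compE _ _ _ _ _ _ _ _ _ _ _ (dgadd (b <.> v) d)).
  by apply/fr_htp/htp_eq => i m /=; rewrite linearD.
by apply: htp_eq => i m /=; rewrite linearD.
Qed.

Lemma hcompZl M N L a (g : hom N L) (f : hom M N) :
  hcomp (hscale a g) f = hscale a (hcomp g f).
Proof.
have [B [t [qt [g0 ->]]]] := fr_ex g; have [C [s [q [f0 ->]]]] := fr_lift f qt.
by rewrite !(fr_scaleE, fr_compT); apply/fr_htp/htp_eq.
Qed.

Lemma hcompZr M N L a (g : hom N L) (f : hom M N) :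
  hcomp g (hscale a f) = hscale a (hcomp g f).
Proof.
have [B [t [qt [g0 ->]]]] := fr_ex g; have [C [s [q [f0 ->]]]] := fr_lift f qt.
rewrite fr_compT !fr_scaleE (@fr_compE _ _ _ _ _ _ _ _ _ _ _ (dgscale a f0)).
  by apply/fr_htp/htp_eq => i m /=; rewrite fZ.
by apply: htp_eq => i m /=; rewrite fZ.
Qed.

Lemma hcomp0l M N L (f : hom M N) : hcomp (hzero N L) f = hzero M L.
Proof. by rewrite -(hscale0 (hzero N L)) hcompZl hscale0. Qed.

Lemma hcomp0r M N L (g : hom N L) : hcomp g (hzero M N) = hzero M L.
Proof. by rewrite -(hscale0 (hzero M N)) hcompZr hscale0. Qed.

Lemma haddN M N (x : hom M N) : hadd x (hscale (-1) x) = hzero M N.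
Proof. by rewrite -[x in hadd x _]hscale1 -hscaleDl subrr hscale0. Qed.

Lemma hadd_eq0 M N (x y : hom M N) : hadd x (hscale (-1) y) = hzero M N -> x = y.
Proof.
move=> H; rewrite -[LHS]hadd0r -(haddN y) [hadd y _]haddC haddA H; exact: hadd0l.
Qed.

(** * Morphisms of D induced by morphisms of dg-modules *)

Lemma hof_comp M N L (g : dgmap N L) (f : dgmap M N) :
  hof (g <.> f) = hcomp (hof g) (hof f).
Proof.
rewrite /hof -!/(fr (quasi_iso_id _) _) (@fr_compE _ _ _ _ _ _ _ _ _ _ _ f) //.
exact: htp_eq.
Qed.

Lemma hof_htp M N (f g : dgmap M N) : f ~ g -> hof f = hof g.
Proof. by move=> fg; apply: fr_htp. Qed.

Lemma hof_scale M N c (f : dgmap M N) : hof (dgscale c f) = hscale c (hof f).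
Proof. exact/esym/fr_scaleE. Qed.

Definition isoh M N (f : hom M N) : Prop :=
  exists g : hom N M, hcomp g f = hid M /\ hcomp f g = hid N.

(** The inverse of [s] is the fraction with denominator [s] and numerator 1. *)
Lemma hof_iso M N (s : dgmap M N) : quasi_iso s -> isoh (hof s).
Proof.
move=> q; exists (fr q (dgid M)); rewrite /hof -!/(fr (quasi_iso_id _) _); split.
  rewrite (@fr_compE _ _ _ _ _ _ _ _ _ _ _ (dgid M)); last exact: htp_eq.
  by rewrite -(fr1 (quasi_iso_id M)); apply/fr_htp/htp_eq.
rewrite (@fr_compE _ _ _ _ _ _ _ _ _ _ _ (dgid M)); last exact: htp_eq.
by rewrite -(fr1 q); apply/fr_htp/htp_eq.
Qed.

End DerivedCategory.

(** * Isomorphisms and direct sums in D *)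
Section CategoryTheory.
Variable k : fieldType.
Implicit Types M N L A B C X Y : dgmod k.
Implicit Types T : subcat k.

Lemma isoh_id M : isoh (hid M).
Proof. by exists (hid M); rewrite !hcomp1l. Qed.

Lemma isoh_comp M N L (g : hom N L) (f : hom M N) :
  isoh g -> isoh f -> isoh (hcomp g f).
Proof.
move=> [g' [g1 g2]] [f' [f1 f2]]; exists (hcomp f' g'); split.
  by rewrite hcompA -(hcompA f') g1 hcomp1r.
by rewrite hcompA -(hcompA g) f2 hcomp1r.
Qed.

Lemma roof_invertibleE M N (r : roof M N) : roof_invertible r <-> isoh (hcl r).
Proof.
split=> [[r' [e1 e2]]|[f [e1 e2]]].
  by exists (hcl r'); rewrite -!hcl_comp; split; apply/hclP.
exists (hrep f); split; apply/hclP; by rewrite hcl_comp hrepK.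
Qed.

Lemma D_isoE M N : D_iso M N <-> exists f : hom M N, isoh f.
Proof.
split=> [[r /roof_invertibleE h]|[f h]]; first by exists (hcl r).
by exists (hrep f); apply/roof_invertibleE; rewrite hrepK.
Qed.

Lemma D_iso_refl M : D_iso M M.
Proof. by apply/D_isoE; exists (hid M); apply: isoh_id. Qed.

Lemma D_iso_sym M N : D_iso M N -> D_iso N M.
Proof.
by move=> /D_isoE [f [g [e1 e2]]]; apply/D_isoE; exists g, f.
Qed.

Lemma D_iso_trans M N L : D_iso M N -> D_iso N L -> D_iso M L.
Proof.
move=> /D_isoE [f hf] /D_isoE [g hg]; apply/D_isoE; exists (hcomp g f).
exact: isoh_comp.
Qed.

Lemma D_iso_qis M N (s : dgmap M N) : quasi_iso s -> D_iso M N.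
Proof. by move=> /hof_iso h; apply/D_isoE; exists (hof s). Qed.

Lemma D_zeroE M : D_zero M <-> hid M = hzero M M.
Proof. by split=> [h|/hclP //]; apply/hclP. Qed.

Lemma D_zero_iso M N : D_iso M N -> D_zero M -> D_zero N.
Proof.
move=> /D_isoE [f [g [e1 e2]]] /D_zeroE z; apply/D_zeroE.
by rewrite -e2 -[f]hcomp1r z hcomp0r hcomp0l.
Qed.

Definition hsum M N n (f : 'I_n -> hom M N) : hom M N :=
  \big[@hadd k M N/hzero M N]_(l < n) f l.

Lemma hcl_sum M N n (r : 'I_n -> roof M N) :
  hcl (roof_sum r) = hsum (fun l => hcl (r l)).
Proof.
rewrite /roof_sum /hsum.
by apply: (big_morph (@hcl k M N)) => // x y; apply: hcl_add.
Qed.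

Lemma hcomp_suml M N L n (f : 'I_n -> hom N L) (g : hom M N) :
  hcomp (hsum f) g = hsum (fun l => hcomp (f l) g).
Proof.
apply: (big_morph (fun x => hcomp x g)); last exact: hcomp0l.
by move=> x y; apply: hcompDl.
Qed.

Lemma hcomp_sumr M N L n (g : hom N L) (f : 'I_n -> hom M N) :
  hcomp g (hsum f) = hsum (fun l => hcomp g (f l)).
Proof.
apply: (big_morph (hcomp g)); last exact: hcomp0r.
by move=> x y; apply: hcompDr.
Qed.

Lemma hsum0 M N n (f : 'I_n -> hom M N) :
  (forall l, f l = hzero M N) -> hsum f = hzero M N.
Proof. by move=> f0; rewrite /hsum big1. Qed.

Definition biproduct M n (N : 'I_n -> dgmod k) (inj : forall l, hom (N l) M)
    (prj : forall l, hom M (N l)) : Prop :=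
  [/\ forall l, hcomp (prj l) (inj l) = hid (N l),
      forall l l', l != l' -> hcomp (prj l') (inj l) = hzero (N l) (N l') &
      hsum (fun l => hcomp (inj l) (prj l)) = hid M].

Lemma D_direct_sumE M n (N : 'I_n -> dgmod k) :
  D_direct_sum M N <-> exists inj prj, @biproduct M n N inj prj.
Proof.
split=> [[i [p [e1 e2 e3]]]|[i [p [e1 e2 e3]]]].
  exists (fun l => hcl (i l)), (fun l => hcl (p l)); split=> [l|l l' ll|].
  - by rewrite -hcl_comp; apply/hclP.
  - by rewrite -hcl_comp; apply/hclP/e2.
  - move/hclP: e3; rewrite hcl_sum -/(hid M) => <-.
    by apply: eq_bigr => l _; rewrite hcl_comp.
exists (fun l => hrep (i l)), (fun l => hrep (p l)); split=> [l|l l' ll|].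
- by apply/hclP; rewrite hcl_comp !hrepK e1.
- by apply/hclP; rewrite hcl_comp !hrepK e2.
- apply/hclP; rewrite hcl_sum -/(hid M) -e3.
  by apply: eq_bigr => l _; rewrite hcl_comp !hrepK.
Qed.

Lemma D_direct_sum1 M (N : 'I_1 -> dgmod k) : D_iso M (N ord0) -> D_direct_sum M N.
Proof.
move=> /D_isoE [f [g [e1 e2]]]; apply/D_direct_sumE.
have H l : ord0 = l :> 'I_1 by rewrite [l]ord1.
exists (fun l => ecast z (hom (N z) M) (H l) g), (fun l => ecast z (hom M (N z)) (H l) f).
split=> [l|l l'|].
- by case: _ / (H l).
- by rewrite !ord1.
- rewrite /hsum big_ord1 -e1; move: (H ord0) => e.
  by rewrite (Prop_irrelevance e erefl).
Qed.

(** * Radical *)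

Definition hrad M N (f : hom M N) : Prop :=
  forall g : hom N M, isoh (hadd (hid M) (hscale (-1) (hcomp g f))).

Lemma radE M N (r : roof M N) : rad r <-> hrad (hcl r).
Proof.
split=> h g.
  have /roof_invertibleE := h (hrep g).
  by rewrite /roof_sub hcl_add hcl_scale hcl_comp hrepK.
by apply/roof_invertibleE; rewrite /roof_sub hcl_add hcl_scale hcl_comp; apply: h.
Qed.

Definition hrad2 T M N (f : hom M N) : Prop :=
  exists (n : nat) (L : 'I_n -> dgmod k)
         (g : forall l, hom M (L l)) (h : forall l, hom (L l) N),
    (forall l, [/\ T (L l), hrad (g l) & hrad (h l)]) /\
    f = hsum (fun l => hcomp (h l) (g l)).

Lemma rad2E T M N (r : roof M N) : rad2 T r <-> hrad2 T (hcl r).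
Proof.
split=> [[n [L [g [h [H e]]]]]|[n [L [g [h [H e]]]]]].
  exists n, L, (fun l => hcl (g l)), (fun l => hcl (h l)); split.
    by move=> l; have [? /radE ? /radE ?] := H l.
  move/hclP: e; rewrite hcl_sum => ->.
  by apply: eq_bigr => l _; rewrite hcl_comp.
exists n, L, (fun l => hrep (g l)), (fun l => hrep (h l)); split.
  by move=> l; have [? ? ?] := H l; split=> //; apply/radE; rewrite hrepK.
apply/hclP; rewrite hcl_sum e.
by apply: eq_bigr => l _; rewrite hcl_comp !hrepK.
Qed.

Lemma hrad_compl M N L (p : hom N L) (f : hom M N) : hrad f -> hrad (hcomp p f).
Proof. by move=> h g; rewrite hcompA. Qed.

(** All indecomposable objects of [D^f] turn out to be bricks.  Between bricks the
    radical is elementary: it contains all morphisms between nonisomorphic ones,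
    and no nonzero endomorphism. *)
Definition brick M : Prop :=
  hid M <> hzero M M /\ forall f : hom M M, exists c, f = hscale c (hid M).

Lemma brick_iso M N : D_iso M N -> brick M -> brick N.
Proof.
move=> MN [nz h]; split=> [/D_zeroE z|f].
  by apply: nz; apply/D_zeroE; apply: D_zero_iso z; apply: D_iso_sym.
move: MN => /D_isoE [u [v [e1 e2]]].
have [c e] := h (hcomp v (hcomp f u)); exists c.
rewrite -[LHS]hcomp1l -[LHS]hcomp1r -e2 hcompA.
rewrite -(hcompA _ f) -(hcompA u) e -(hcompA u) hcompZl hcomp1l hcompZr.
by [].
Qed.

Lemma isoh_scale M (c : k) : c != 0 -> isoh (hscale c (hid M)).
Proof.
move=> c0; exists (hscale c^-1 (hid M)).
by rewrite !hcompZl !hcompZr !hcomp1l !hscaleA mulVf // mulfV // hscale1.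
Qed.

(** If [1 - g f] is not invertible then [g f = 1], and [f g], a scalar with
    [f g f = f], is 1 too. *)
Lemma brick_rad M N (f : hom M N) : brick M -> brick N -> ~ D_iso M N -> hrad f.
Proof.
move=> [M0 Mk] [N0 Nk] MN g; have [c e] := Mk (hcomp g f).
rewrite e hscaleA mulN1r -{1}[hid M]hscale1 -hscaleDl.
apply: isoh_scale; apply/negP; rewrite subr_eq0 => /eqP c1.
have [c' e'] := Nk (hcomp f g); apply: MN; apply/D_isoE; exists f, g.
have gf : hcomp g f = hid M by rewrite e -c1 hscale1.
split=> //; rewrite e'.
have : hscale (1 - c') f = hzero M N.
  rewrite hscaleDl hscale1 -mulN1r -hscaleA.
  rewrite -[X in hscale c' X]hcomp1l -hcompZl -e' -hcompA gf hcomp1r.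
  exact: haddN.
have [->|] := eqVneq c' 1; first by rewrite hscale1.
rewrite eq_sym -subr_eq0 => c'0 /(congr1 (hscale (1 - c')^-1)).
rewrite hscaleA mulVf // hscale1 hscaler0 => f0; case: M0.
by rewrite -gf f0 hcomp0r.
Qed.

Lemma brick_rad0 M (f : hom M M) : brick M -> hrad f -> f = hzero M M.
Proof.
move=> [M0 Mk]; have [c ->] := Mk f; have [->|c0] := eqVneq c 0.
  by rewrite hscale0.
move=> /(_ (hscale c^-1 (hid M))); rewrite hcompZl hcompZr hcomp1l (hscaleA c^-1).
rewrite mulVf // hscale1 haddN => -[g [e _]]; case: M0.
by rewrite -e hcomp0r.
Qed.

(** If [h i] were an invertible scalar [c], then [h] would be killed by the
    invertible endomorphism [1 - c^-1 i h]. *)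
Lemma brick_rad_comp L M (h : hom L M) (i : hom M L) :
  brick M -> hrad h -> hcomp h i = hzero M M.
Proof.
move=> [M0 Mk] hr; have [c e] := Mk (hcomp h i); rewrite e.
have [->|c0] := eqVneq c 0; first by rewrite hscale0.
have [g [_ e']] := hr (hscale c^-1 i).
have : hcomp h (hadd (hid L) (hscale (-1) (hcomp (hscale c^-1 i) h))) = hzero L M.
  rewrite hcompDr hcomp1r hcompZr hcompZl hcompZr hcompA e hcompZl hcomp1l.
  by rewrite (hscaleA c^-1) mulVf // hscale1 haddN.
move=> /(congr1 (fun x => hcomp x g)); rewrite -hcompA e' hcomp1r hcomp0l => h0.
by rewrite -e h0 hcomp0l.
Qed.

(** The idempotents of a brick are scalars, hence 0 and 1. *)
Lemma brick_indecomposable T M : T M -> brick M -> indecomposable T M.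
Proof.
move=> TM [M0 Mk]; split=> // [/D_zeroE //|N _ /D_direct_sumE [i [p [e1 e2 e3]]]].
have [c e] := Mk (hcomp (i ord0) (p ord0)).
have [c0|c0] := eqVneq c 0.
  exists ord0; apply/D_zeroE; rewrite -(hcomp1r (hid _)) -(e1 ord0).
  by rewrite hcompA -(hcompA (p ord0)) e c0 hscale0 hcomp0r hcomp0l.
exists (lift ord0 ord0); apply/D_zeroE.
have p1 : p (lift ord0 ord0) = hzero _ _.
  have : hcomp (p (lift ord0 ord0)) (hcomp (i ord0) (p ord0)) = hzero _ _.
    by rewrite hcompA e2 // hcomp0l.
  rewrite e hcompZr hcomp1r => /(congr1 (hscale c^-1)).
  by rewrite hscaleA mulVf // hscale1 hscaler0.
by rewrite -e1 p1 hcomp0l.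
Qed.

Lemma biproduct_zero M (N : 'I_2 -> dgmod k) : D_direct_sum M N ->
  D_zero (N (lift ord0 ord0)) -> D_iso M (N ord0).
Proof.
move=> /D_direct_sumE [i [p [e1 e2 e3]]] /D_zeroE z; apply/D_isoE.
exists (p ord0), (i ord0); split=> //; rewrite -e3 /hsum !big_ord_recl big_ord0.
by rewrite -[i (lift _ _)]hcomp1r z !hcomp0r hcomp0l !hadd0r.
Qed.

(** Insert the identity of [L], as the sum of its projections, in the composite.
    A summand equal to [X] or [Y] contributes nothing, because a brick has no
    radical endomorphisms. *)
Lemma rad_comp_sum0 X Y L n (A : 'I_n -> dgmod k) (g : hom X L) (h : hom L Y) :
  D_direct_sum L A -> brick X -> brick Y -> hrad g -> hrad h ->
  (forall l, [\/ A l = X, A l = Y |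
     forall (u : hom X (A l)) (v : hom (A l) Y), hcomp v u = hzero X Y]) ->
  hcomp h g = hzero X Y.
Proof.
move=> /D_direct_sumE [i [p [e1 e2 e3]]] bX bY rg rh H.
rewrite -[h]hcomp1r -e3 hcomp_sumr hcomp_suml; apply: hsum0 => l.
rewrite hcompA -(hcompA (hcomp _ _)).
have HX B (q : hom L B) (j : hom B L) : B = X ->
    hcomp (hcomp h j) (hcomp q g) = hzero X Y.
  move=> e; subst B; have -> := brick_rad0 bX (hrad_compl q rg).
  by rewrite hcomp0r.
have HY B (q : hom L B) (j : hom B L) : B = Y ->
    hcomp (hcomp h j) (hcomp q g) = hzero X Y.
  by move=> e; subst B; rewrite (brick_rad_comp j bY rh) hcomp0l.
by case: (H l) => [/HX|/HY|]; apply.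
Qed.

Lemma hrad2_zero T X Y : hrad2 T (hzero X Y).
Proof.
exists 0%N, (fun _ => X), (fun _ => hid X), (fun _ => hzero X Y).
by split=> [[]|] //; rewrite hsum0 // => -[].
Qed.

Lemma hrad2_comp T X Y A (g : hom X A) (h : hom A Y) :
  T A -> hrad g -> hrad h -> hrad2 T (hcomp h g).
Proof.
move=> TA rg rh; exists 1%N, (fun _ => A), (fun _ => g), (fun _ => h); split=> //.
by rewrite /hsum big_ord1.
Qed.

Lemma irr_dim0 T X Y : (forall f : hom X Y, hrad f -> hrad2 T f) -> irr_dim T X Y 0.
Proof.
move=> H; exists (fun _ => roof_zero X Y); split=> [[]|r /radE /H rr|_ _ []] //.
exists (fun _ => 0); apply/rad2E.
rewrite /roof_sub hcl_add hcl_scale hcl_sum hsum0 ?hscaler0 ?hadd0r // => -[] //.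
Qed.

Lemma irr_dim1 T X Y (e : hom X Y) : hrad e -> e <> hzero X Y ->
  (forall f : hom X Y, exists c, f = hscale c e) ->
  (forall f : hom X Y, hrad2 T f -> f = hzero X Y) -> irr_dim T X Y 1.
Proof.
move=> re e0 span H; exists (fun _ => hrep e); split=> [l|r _|c].
- by apply/radE; rewrite hrepK.
- have [c rc] := span (hcl r); exists (fun _ => c); apply/rad2E.
  rewrite /roof_sub hcl_add hcl_scale hcl_sum /hsum big_ord1 hcl_scale hrepK -rc.
  by rewrite haddN; apply: hrad2_zero.
- move=> /rad2E; rewrite hcl_sum /hsum big_ord1 hcl_scale hrepK => /H ce l.
  have [//|c0] := eqVneq (c l) 0; case: e0.
  move: ce; rewrite [ord0]ord1 -(ord1 l) => /(congr1 (hscale (c l)^-1)).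
  by rewrite hscaleA mulVf // hscale1 hscaler0.
Qed.

(** The first vector of a basis of irreducible morphisms is outside the square of
    the radical, since its coordinate is not 0. *)
Lemma irr_dim_pos T X Y n : irr_dim T X Y n.+1 ->
  exists2 f : hom X Y, hrad f & ~ hrad2 T f.
Proof.
move=> [e [re _ H]]; exists (hcl (e ord0)); first exact/radE.
move=> r2; have := H (fun l => (l == ord0)%:R).
have H0 : rad2 T (roof_sum (fun l => roof_scale (l == ord0)%:R (e l))).
  apply/rad2E; rewrite hcl_sum /hsum big_ord_recl hcl_scale eqxx hscale1.
  rewrite big1 ?hadd0r // => l _.
  by rewrite hcl_scale hscale0.
by move=> /(_ H0 ord0) /eqP; rewrite eqxx oner_eq0.
Qed.

End CategoryTheory.

(** * Iterating a degree one map *)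
Section Orbits.

Lemma int_ge_ind (p : int) (Q : int -> Prop) : Q p ->
  (forall i, p <= i -> Q i -> Q (i + 1)) -> forall i, p <= i -> Q i.
Proof.
move=> Qp QS i pi; have -> : i = p + `|i - p|%N%:Z by lia.
elim: `|i - p|%N => [|n IH]; first by rewrite addr0.
have -> : p + n.+1%:Z = p + n%:Z + 1 by lia.
by apply: QS => //; lia.
Qed.

Variables (k : fieldType) (V : int -> lmodType k).
Variable s : forall i, {linear V i -> V (i + 1)}.

Definition orb_step (w : {i & V i}) : {i & V i} := Tagged V (s (tag w) (tagged w)).

(** Projection of a homogeneous element to degree [i]; working in the total space
    confines the transport along equalities of degrees to this definition. *)
Definition component (i : int) (w : {i & V i}) : V i :=
  match tag w =P i with
  | ReflectT e => ecast z (V z) e (tagged w)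
  | _ => 0
  end.

(** The image of [x] under the composite of the maps from degree [p] to degree
    [i], and 0 when [i < p]. *)
Definition orb (p i : int) (x : V p) : V i :=
  if p <= i then component i (iter `|i - p|%N orb_step (Tagged V x)) else 0.

Lemma component_step i w : component (i + 1) (orb_step w) = s i (component i w).
Proof.
case: w => j y; rewrite /component /=; case: eqP => [e|]; case: eqP => [e'|] //=.
- by subst; rewrite (eq_irrelevance e erefl).
- by case; apply: (addIr 1).
- by case; rewrite e'.
- by rewrite linear0.
Qed.

Lemma orb_id p (x : V p) : orb p x = x.
Proof.
rewrite /orb lexx (_ : `|p - p|%N = 0%N) /=; last by lia.
by rewrite /component /=; case: eqP => // e; rewrite (eq_irrelevance e erefl).
Qed.

Lemma orb_lt p i (x : V p) : i < p -> orb i x = 0.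
Proof. by move=> ip; rewrite /orb leNgt ip. Qed.

Lemma orbS p i (x : V p) : p <= i -> orb (i + 1) x = s i (orb i x).
Proof.
move=> pi; rewrite /orb pi (_ : p <= i + 1); last by lia.
by rewrite (_ : `|(i + 1)%R - p|%N = `|i - p|%N.+1) ?component_step //; lia.
Qed.

Lemma orb_linear p i : linear (@orb p i).
Proof.
have [pi|ip] := leP p i; last by move=> c x y; rewrite !orb_lt // scaler0 addr0.
move: i pi; apply: int_ge_ind => [|i pi IH] c x y; first by rewrite !orb_id.
by rewrite !orbS // IH linearP.
Qed.

HB.instance Definition _ p i :=
  GRing.isLinear.Build k (V p) (V i) _ (@orb p i) (@orb_linear p i).

Lemma orb_shift p i (x : V p) : p + 1 <= i -> orb i (s p x) = orb i x.
Proof.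
move: i; apply: int_ge_ind => [|i pi IH]; first by rewrite orb_id orbS // orb_id.
by rewrite !orbS ?IH //; lia.
Qed.

End Orbits.

(** * Models of the interval modules *)
Section Intervals.
Variable k : fieldType.
Implicit Types M N L : dgmod k.

Lemma dgmap_ex M N (f : forall i, M i -> N i) :
  (forall i, linear (f i)) ->
  (forall i m, f i (dg_d M i m) = dg_d N i (f (i + 1) m)) ->
  (forall i m, f (i + 1) (dg_X M i m) = dg_X N i (f i m)) ->
  exists g : dgmap M N, forall i x, g i x = f i x.
Proof.
move=> fl fd fX.
pose q i : {linear M i -> N i} := HB.pack (f i) (GRing.isLinear.Build k _ _ _ (f i) (fl i)).
by exists (@DGMap k M N q fd fX).
Qed.

Lemma homotopic_ex M N (f g : dgmap M N) (h : forall i, M i -> N (i + 1)) :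
  (forall i, linear (h i)) ->
  (forall i m, h (i + 1) (dg_X M i m) = - dg_X N (i + 1) (h i m)) ->
  (forall i m, f (i + 1) m - g (i + 1) m =
     dg_d N (i + 1) (h (i + 1) m) + h i (dg_d M i m)) ->
  homotopic f g.
Proof.
move=> hl hX hd.
pose q i : {linear M i -> N (i + 1)} := HB.pack (h i) (GRing.isLinear.Build k _ _ _ (h i) (hl i)).
by exists q.
Qed.

(** A line or zero, according to a boolean, with a coordinate [out] and a section
    [inn] defined in both cases: this avoids dependent case analysis on the
    support of a module. *)
Definition line (b : bool) : lmodType k := 'rV[k]_b.
Definition out b (x : line b) : k := \sum_(j < b) x 0 j.
Definition inn b (c : k) : line b := const_mx c.

Lemma out_linear b : linear_for *%R (@out b).
Proof.
move=> c x y; rewrite /out mulr_sumr -big_split; apply: eq_bigr => j _.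
by rewrite !mxE.
Qed.

Lemma outD b (x y : line b) : out (x + y) = out x + out y.
Proof. by rewrite -[x]scale1r out_linear mul1r scale1r. Qed.
Lemma outZ b c (x : line b) : out (c *: x) = c * out x.
Proof.
have o0 : out (0 : line b) = 0 by rewrite /out big1 // => j _; rewrite mxE.
by rewrite -[c *: x]addr0 out_linear o0 addr0.
Qed.
Lemma out0 b : out (0 : line b) = 0.
Proof. by rewrite -(scale0r 0) outZ mul0r. Qed.
Lemma outN b (x : line b) : out (- x) = - out x.
Proof. by rewrite -scaleN1r outZ mulN1r. Qed.

Lemma out_inn b c : out (inn b c) = if b then c else 0.
Proof. by case: b; rewrite /out ?big_ord1 ?big_ord0 // mxE. Qed.

Lemma out_inj b : injective (@out b).
Proof.
case: b => x y; rewrite /out ?big_ord1 ?big_ord0 => xy; apply/rowP => j.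
  by rewrite (ord1 j).
by case: j.
Qed.

Lemma out_off b (x : line b) : b = false -> out x = 0.
Proof. by move=> e; subst; rewrite /out big_ord0. Qed.

(** A dg-module with basis vectors [x_i] in the degrees of [A] and [y_i] in the
    degrees of [B], such that [X x_i = x_(i+1)], [X y_i = - y_(i+1)] and
    [d y_(i+1) = x_i], where vectors outside the supports are 0.  The hypothesis
    is what [d X = - X d] requires. *)
Section TwoLine.
Variables A B : int -> bool.
Hypothesis AB : forall i, A (i + 1) -> B (i + 1) -> B (i + 1 + 1) = A i.

Definition twoline_car (i : int) : lmodType k := (line (A i) * line (B i))%type.
Definition twoline_dfun i (x : twoline_car (i + 1)) : twoline_car i := (inn (A i) (out x.2), 0).
Definition twoline_Xfun i (x : twoline_car i) : twoline_car (i + 1) :=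
  (inn (A (i + 1)) (out x.1), inn (B (i + 1)) (- out x.2)).

Lemma twoline_ext i (x y : twoline_car i) : out x.1 = out y.1 -> out x.2 = out y.2 -> x = y.
Proof. by case: x y => a b [a' b'] /= /out_inj -> /out_inj ->. Qed.

Lemma twoline_dfun_linear i : linear (@twoline_dfun i).
Proof.
move=> c x y; apply: twoline_ext => /=; last by rewrite scaler0 addr0.
by rewrite !outD !outZ !out_inn; case: ifP => _; rewrite ?mulr0 ?addr0.
Qed.

Lemma twoline_Xfun_linear i : linear (@twoline_Xfun i).
Proof.
by move=> c x y; apply: twoline_ext => /=; rewrite !outD !outZ !out_inn;
  case: ifP => _; ring.
Qed.

HB.instance Definition _ i :=
  GRing.isLinear.Build k (twoline_car (i + 1)) (twoline_car i) _ (@twoline_dfun i) (@twoline_dfun_linear i).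
HB.instance Definition _ i :=
  GRing.isLinear.Build k (twoline_car i) (twoline_car (i + 1)) _ (@twoline_Xfun i) (@twoline_Xfun_linear i).

Definition twoline : dgmod k.
Proof.
exists twoline_car (fun i => @twoline_dfun i : {linear _ -> _})
  (fun i => @twoline_Xfun i : {linear _ -> _}) => i m.
- by apply: twoline_ext => //=; rewrite !out0.
- apply: twoline_ext => /=; last by rewrite outN out0 out_inn out0 oppr0 if_same oppr0.
  rewrite outN !out_inn.
  have := @AB i; have := @out_off _ m.2; move: (out m.2) => b.
  case: (A (i + 1)); last by rewrite oppr0.
  case: (B (i + 1)) => [_ /(_ isT isT) ->|-> //].
    by case: ifP; rewrite ?oppr0.
  by rewrite oppr0; do !case: ifP; rewrite oppr0.
Defined.

Lemma twoline_d1 i (x : twoline (i + 1)) : out (dg_d twoline i x).1 = if A i then out x.2 else 0.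
Proof. exact: out_inn. Qed.
Lemma twoline_d2 i (x : twoline (i + 1)) : out (dg_d twoline i x).2 = 0.
Proof. exact: out0. Qed.
Lemma twoline_X1 i (x : twoline i) : out (dg_X twoline i x).1 = if A (i + 1) then out x.1 else 0.
Proof. exact: out_inn. Qed.
Lemma twoline_X2 i (x : twoline i) : out (dg_X twoline i x).2 = if B (i + 1) then - out x.2 else 0.
Proof. exact: out_inn. Qed.
Lemma twoline_lin1 i c (x y : twoline i) : out (c *: x + y).1 = c * out x.1 + out y.1.
Proof. by rewrite /= outD outZ. Qed.
Lemma twoline_lin2 i c (x y : twoline i) : out (c *: x + y).2 = c * out x.2 + out y.2.
Proof. by rewrite /= outD outZ. Qed.
End TwoLine.

Section Models.
Variables u v : int.

(** The projective model: [x_(u+1)] and [y_(v+2)] generate it freely, and its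
    homology is spanned by the [x_i] with [u < i <= v].  The second support is
    also bounded by [u + 1] so that the axioms hold for all [u] and [v]; for
    [u <= v] that bound is implied by the other. *)
Definition P_supp1 (i : int) := u < i.
Definition P_supp2 (i : int) := (u + 1 < i) && (v + 1 < i).
Lemma P_supp i : P_supp1 (i + 1) -> P_supp2 (i + 1) -> P_supp2 (i + 1 + 1) = P_supp1 i.
Proof. rewrite /P_supp1 /P_supp2; lia. Qed.
Definition Pmod : dgmod k := twoline P_supp.

(** The interval module itself, with zero differential. *)
Definition S_supp1 (i : int) := (u < i) && (i <= v).
Definition S_supp2 (i : int) := false.
Lemma S_supp i : S_supp1 (i + 1) -> S_supp2 (i + 1) -> S_supp2 (i + 1 + 1) = S_supp1 i.
Proof. by []. Qed.
Definition Smod : dgmod k := twoline S_supp.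

(** The injective model: for [u <= v] its homology is spanned by the [y_i] with
    [u < i <= v], the differential mapping the other [y_i] onto the [x_i]. *)
Definition I_supp1 (i : int) := (i + 1 <= u) && (i + 1 <= v).
Definition I_supp2 (i : int) := i <= v.
Lemma I_supp i : I_supp1 (i + 1) -> I_supp2 (i + 1) -> I_supp2 (i + 1 + 1) = I_supp1 i.
Proof. rewrite /I_supp1 /I_supp2; lia. Qed.
Definition Imod : dgmod k := twoline I_supp.
End Models.

End Intervals.

(** * Powers of X *)
Section OrbitRules.
Variable k : fieldType.
Implicit Types M N : dgmod k.

(** Multiplication by powers of [X] and of [- X], indexed by the target degree.
    The differential exchanges the two ([d_orbX], [d_orbN]), since [d] and [X]
    anticommute. *)
Definition orbX M (p i : int) (x : M p) : M i := orb (dg_X M) i x.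
Definition orbN M (p i : int) (x : M p) : M i :=
  orb (fun j => (\- dg_X M j) : {linear M j -> M (j + 1)}) i x.

Lemma orbX_id M p (x : M p) : orbX p x = x. Proof. exact: orb_id. Qed.
Lemma orbN_id M p (x : M p) : orbN p x = x. Proof. exact: orb_id. Qed.
Lemma orbXS M p i (x : M p) : p <= i -> orbX (i + 1) x = dg_X M i (orbX i x).
Proof. exact: orbS. Qed.
Lemma orbNS M p i (x : M p) : p <= i -> orbN (i + 1) x = - dg_X M i (orbN i x).
Proof. exact: orbS. Qed.
Lemma orbX_linear M p i : linear (@orbX M p i). Proof. exact: orb_linear. Qed.
Lemma orbN_linear M p i : linear (@orbN M p i). Proof. exact: orb_linear. Qed.
HB.instance Definition _ M p i :=
  GRing.isLinear.Build k (M p) (M i) _ (@orbX M p i) (@orbX_linear M p i).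
HB.instance Definition _ M p i :=
  GRing.isLinear.Build k (M p) (M i) _ (@orbN M p i) (@orbN_linear M p i).

Lemma orbN_orbN M p j i (x : M p) : p <= j -> j <= i -> orbN i (orbN j x) = orbN i x.
Proof.
move=> pj; move: i; apply: int_ge_ind => [|i ji IH]; first by rewrite orbN_id.
by rewrite !orbNS ?IH //; lia.
Qed.

Lemma orbX_orbX M p j i (x : M p) : p <= j -> j <= i -> orbX i (orbX j x) = orbX i x.
Proof.
move=> pj; move: i; apply: int_ge_ind => [|i ji IH]; first by rewrite orbX_id.
by rewrite !orbXS ?IH //; lia.
Qed.

Lemma d_orbX M p i (x : M (p + 1)) : p <= i ->
  dg_d M i (orbX (i + 1) x) = orbN i (dg_d M p x).
Proof.
move: i; apply: int_ge_ind => [|i pi IH]; first by rewrite orbX_id orbN_id.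
by rewrite orbXS ?orbNS ?dg_dX ?IH //; lia.
Qed.

Lemma d_orbN M p i (x : M (p + 1)) : p <= i ->
  dg_d M i (orbN (i + 1) x) = orbX i (dg_d M p x).
Proof.
move: i; apply: int_ge_ind => [|i pi IH]; first by rewrite orbX_id orbN_id.
by rewrite orbNS ?orbXS ?dN ?dg_dX ?opprK ?IH //; lia.
Qed.

Lemma dgmap_orbX M N (f : dgmap M N) p i (x : M p) : p <= i -> f i (orbX i x) = orbX i (f p x).
Proof.
move: i; apply: int_ge_ind => [|i pi IH]; first by rewrite !orbX_id.
by rewrite !orbXS // dgf_X IH.
Qed.

Lemma dgmap_orbN M N (f : dgmap M N) p i (x : M p) : p <= i -> f i (orbN i x) = orbN i (f p x).
Proof.
move: i; apply: int_ge_ind => [|i pi IH]; first by rewrite !orbN_id.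
by rewrite !orbNS // fN dgf_X IH.
Qed.
End OrbitRules.

(** * The projective model computes morphisms *)
Section Projective.
Variable k : fieldType.
Implicit Types M N A : dgmod k.
Local Notation "f ~ g" := (homotopic f g) (at level 70).
Local Notation "f <.> g" := (dgcomp f g) (at level 40, left associativity).

Variables u v : int.
Local Notation P := (Pmod k u v).

Lemma P_supp1_off i (m : P i) : i <= u -> out m.1 = 0.
Proof. by move=> iu; rewrite out_off // /P_supp1; lia. Qed.

Lemma P_supp2_off i (m : P i) : i <= v + 1 -> out m.2 = 0.
Proof. by move=> iu; rewrite out_off // /P_supp2; lia. Qed.

Hypothesis uv : u <= v.

Definition gen0 : P (u + 1) := (inn (P_supp1 u (u + 1)) 1, 0).
Definition gen1 : P (v + 1 + 1) := (0, inn (P_supp2 u v (v + 1 + 1)) 1).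

Lemma out_gen0 i : u + 1 <= i -> out (orbX i gen0).1 = 1 /\ out (orbX i gen0).2 = 0.
Proof.
move: i; apply: int_ge_ind => [|i ui [IH1 IH2]].
  rewrite orbX_id /= out_inn out0; split=> //.
  by have -> : P_supp1 u (u + 1) by rewrite /P_supp1; lia.
rewrite orbXS // twoline_X1 twoline_X2 IH1 IH2 oppr0 if_same; split=> //.
by have -> : P_supp1 u (i + 1) by rewrite /P_supp1; lia.
Qed.

Lemma out_gen1 i : v + 1 + 1 <= i -> out (orbN i gen1).1 = 0 /\ out (orbN i gen1).2 = 1.
Proof.
move: i; apply: int_ge_ind => [|i vi [IH1 IH2]].
  rewrite orbN_id /= out_inn out0; split=> //.
  by have -> : P_supp2 u v (v + 1 + 1) by rewrite /P_supp2; lia.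
rewrite orbNS // /= !outN twoline_X1 twoline_X2 IH1 IH2 if_same oppr0; split=> //.
have -> : P_supp2 u v (i + 1) by rewrite /P_supp2; lia.
by rewrite opprK.
Qed.

(** [Pmod] is spanned in each degree by the multiples of its two generators. *)
Lemma Pmod_basis i (m : P i) :
  m = out m.1 *: orbX i gen0 + out m.2 *: orbN i gen1.
Proof.
apply: twoline_ext => /=; rewrite outD !outZ.
- have [iu|ui] := leP i u; first by rewrite !P_supp1_off // !mulr0 addr0.
  have [e1 e2] := out_gen0 (i := i) ltac:(lia); rewrite e1 mulr1.
  have [iv|vi] := leP i (v + 1); first by rewrite (P_supp2_off _ iv) mul0r addr0.
  by have [-> _] := out_gen1 (i := i) ltac:(lia); rewrite mulr0 addr0.
- have [iv|vi] := leP i (v + 1); first by rewrite !P_supp2_off // !mulr0 addr0.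
  have [_ ->] := out_gen0 (i := i) ltac:(lia).
  by have [_ ->] := out_gen1 (i := i) ltac:(lia); rewrite mulr0 mulr1 add0r.
Qed.

Lemma d_gen0 : dg_d P u gen0 = 0.
Proof. by apply: twoline_ext; rewrite ?twoline_d1 ?twoline_d2 ?out0 ?if_same. Qed.

Lemma d_gen1 : dg_d P (v + 1) gen1 = orbX (v + 1) gen0.
Proof.
have [e1 e2] := out_gen0 (i := v + 1) ltac:(lia).
have [e3 e4] := out_gen1 (i := v + 1 + 1) ltac:(lia).
apply: twoline_ext; rewrite ?twoline_d1 ?twoline_d2 ?e1 ?e2 //; rewrite orbN_id in e4; rewrite e4.
by have -> : P_supp1 u (v + 1) by rewrite /P_supp1; lia.
Qed.

Lemma Pmod_val N (f : dgmap P N) i (m : P i) :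
  f i m = out m.1 *: orbX i (f _ gen0) + out m.2 *: orbN i (f _ gen1).
Proof.
rewrite {1}[m]Pmod_basis fD !fZ; congr (_ + _).
- have [iu|ui] := leP i u; first by rewrite P_supp1_off // !scale0r.
  by rewrite dgmap_orbX //; lia.
- have [iv|vi] := leP i (v + 1); first by rewrite P_supp2_off // !scale0r.
  by rewrite dgmap_orbN //; lia.
Qed.

Lemma Pmod_ext N (f g : dgmap P N) : f _ gen0 = g _ gen0 -> f _ gen1 = g _ gen1 ->
  forall i m, f i m = g i m.
Proof. by move=> e0 e1 i m; rewrite (Pmod_val f) (Pmod_val g) e0 e1. Qed.

(** The only relation to respect is that [d] sends the second generator to a
    multiple of the first. *)
Lemma Pmod_map N (z : N (u + 1)) (w : N (v + 1 + 1)) :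
  dg_d N u z = 0 -> dg_d N (v + 1) w = orbX (v + 1) z ->
  exists g : dgmap P N, g _ gen0 = z /\ g _ gen1 = w.
Proof.
move=> dz dw.
have [|||g gE] := @dgmap_ex _ P N
    (fun i m => out m.1 *: orbX i z + out m.2 *: orbN i w).
- move=> i c x y /=; rewrite !outD !outZ !scalerDl scalerDr !scalerA.
  by rewrite addrACA.
- move=> i m; rewrite dD !dZ twoline_d1 twoline_d2 scale0r addr0.
  have [iu|ui] := leP u i; last first.
    rewrite (@P_supp1_off (i + 1)); last by lia.
    rewrite (@P_supp2_off (i + 1)); last by lia.
    by rewrite if_same !scale0r addr0.
  rewrite d_orbX // dz linear0 scaler0 add0r.
  have [iv|vi] := leP i v.
    rewrite (@P_supp2_off (i + 1)); last by lia.
    by rewrite if_same !scale0r.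
  rewrite d_orbN ?dw ?orbX_orbX; try lia.
  by rewrite /P_supp1; case: ifP => [_|] //; lia.
- move=> i m; rewrite XD !XZ twoline_X1 twoline_X2; congr (_ + _).
    have [iu|ui] := leP i u; first by rewrite (@P_supp1_off i) // if_same !scale0r.
    by rewrite orbXS; [rewrite /P_supp1 ifT //; lia | lia].
  have [iv|vi] := leP i (v + 1).
    by rewrite (@P_supp2_off i) // oppr0 if_same !scale0r.
  by rewrite orbNS; [rewrite /P_supp2 ifT ?scaleNr ?scalerN ?opprK //; lia | lia].
exists g; rewrite !gE.
have [e1 e2] := out_gen0 (lexx _); have [e3 e4] := out_gen1 (lexx _).
rewrite orbX_id in e1 e2; rewrite orbN_id in e3 e4.
by rewrite e1 e2 e3 e4 !scale1r !scale0r addr0 add0r orbX_id orbN_id.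
Qed.

(** A homotopy out of a free module is determined by the images [x] and [y] of the
    generators. *)
Lemma Pmod_homotopic N (f g : dgmap P N) (x : N (u + 1 + 1)) (y : N (v + 1 + 1 + 1)) :
  f _ gen0 - g _ gen0 = dg_d N (u + 1) x ->
  f _ gen1 - g _ gen1 = dg_d N (v + 1 + 1) y + orbN (v + 1 + 1) x -> f ~ g.
Proof.
move=> ex ey.
apply: (@homotopic_ex _ P N f g
    (fun i m => out m.1 *: orbN (i + 1) x + out m.2 *: orbX (i + 1) y)).
- move=> i c a b /=; rewrite !outD !outZ !scalerDl scalerDr !scalerA.
  by rewrite addrACA.
- move=> i m; rewrite XD !XZ twoline_X1 twoline_X2 opprD; congr (_ + _).
    have [iu|ui] := leP i u.
      by rewrite (@P_supp1_off i) // if_same !scale0r oppr0.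
    by rewrite orbNS; [rewrite /P_supp1 ifT ?scalerN //; lia | lia].
  have [iv|vi] := leP i (v + 1).
    by rewrite (@P_supp2_off i) // oppr0 if_same !scale0r oppr0.
  by rewrite orbXS; [rewrite /P_supp2 ifT ?scaleNr //; lia | lia].
- move=> i m; rewrite (Pmod_val f) (Pmod_val g) opprD addrACA -!scalerBr -!linearB /=.
  rewrite ex ey dD !dZ out_inn out0 scale0r addr0 -[RHS]addrA; congr (_ + _).
    have [iu|ui] := leP i (u - 1).
      by rewrite (@P_supp1_off (i + 1)) ?scale0r //; lia.
    by rewrite d_orbN //; lia.
  have [iv|vi] := leP i v.
    by rewrite (@P_supp2_off (i + 1)) ?if_same ?scale0r ?addr0 //; lia.
  rewrite linearD /= scalerDr d_orbX ?orbN_orbN //; try lia.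
  by rewrite /P_supp1 ifT //; lia.
Qed.

(** Lift the first generator to a cycle [z']; its multiple in degree [v + 1] is a
    boundary in [N], hence in [A], which lifts the second generator up to a
    cycle; correct by a lift [w2] of this cycle. *)
Lemma Pmod_lift A N (s : dgmap A N) (g : dgmap P N) : quasi_iso s ->
  exists t : dgmap P A, s <.> t ~ g.
Proof.
move=> [si ss]; set z := g _ gen0; set w := g _ gen1.
have cz : cycle z by rewrite /cycle -dgf_d d_gen0 linear0.
have dw : dg_d N (v + 1) w = orbX (v + 1) z.
  by rewrite -dgf_d d_gen1 dgmap_orbX //; lia.
have [z' [cz' [x ex]]] := ss _ z cz.
have [w1 ew1] : boundary (orbX (v + 1) z' : A (v + 1)).
  apply: si; first by rewrite /cycle d_orbX // cz' linear0.
  rewrite dgmap_orbX; last by lia.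
  exists (w - orbN (v + 1 + 1) x); rewrite dB dw d_orbN; last by lia.
  by rewrite -ex linearB /= opprB addrCA subrr addr0.
have [|w2 [cw2 [y ey]]] := ss _ (w - orbN (v + 1 + 1) x - s _ w1).
  rewrite /cycle !dB dw d_orbN; last by lia.
  rewrite -dgf_d -ew1 dgmap_orbX; last by lia.
  by rewrite -ex linearB /= opprB addrCA subrr addr0 subrr.
have [|t [t0 t1]] := @Pmod_map A z' (w1 + w2) cz'.
  by rewrite dD -ew1 cw2 addr0.
exists t; apply: htp_sym; apply: (@Pmod_homotopic _ _ _ x y) => /=.
  by rewrite t0.
rewrite t1 fD -ey opprD addrA; set n := orbN _ x.
by rewrite (addrAC _ (- s _ w2) n) (addrAC _ (- s _ w1) n) subrK.
Qed.

(** The denominator of a fraction is split up to homotopy by [Pmod_lift]. *)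
Lemma hof_surj N (x : hom P N) : exists g : dgmap P N, x = hof g.
Proof.
have [A [s [q [f ->]]]] := fr_ex x; have [t st] := Pmod_lift (dgid P) q.
exists (f <.> t); apply: (@fr_eq _ _ _ _ _ _ _ _ _ _ _ t); first exact: htp_sym.
exact: htp_refl.
Qed.

(** An equality of fractions holds after composition with a quasi-isomorphism
    [w] to [Pmod], which has a section up to homotopy. *)
Lemma hof_inj N (g g' : dgmap P N) : hof g = hof g' -> g ~ g'.
Proof.
move=> /hclP [C [w [w' [/= q ww gg]]]].
have qw : quasi_iso w by apply: quasi_iso_htp q; apply: htp_eq.
have [t wt] := Pmod_lift (dgid P) qw.
have E (f : dgmap P N) (e : dgmap C P) : e ~ w -> f ~ f <.> e <.> t.
  move=> ew; apply: htp_sym; apply: htp_trans (htp_assoc _ _ _) _.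
  apply: (@htp_trans _ _ _ _ (f <.> dgid P)); last exact: htp_eq.
  by apply: htp_compl; apply: htp_trans wt; apply: htp_compr.
apply: htp_trans (E g w (htp_refl _)) _; apply: htp_trans (htp_compr _ gg) _.
apply: htp_sym; apply: E; apply: htp_sym.
by apply: htp_trans (htp_trans _ ww) _; apply: htp_eq.
Qed.

End Projective.

(** * Maps between interval modules *)
Section IntervalHom.
Variable k : fieldType.
Local Notation "f ~ g" := (homotopic f g) (at level 70).
Local Notation "f <.> g" := (dgcomp f g) (at level 40, left associativity).
Local Notation P := (Pmod k).
Local Notation S := (Smod k).

Lemma Pmod_cycleE u v i (z : P u v (i + 1)) : u <= v -> cycle z <-> out z.2 = 0.
Proof.
move=> uv; split=> [cz|z2].
  have : out (dg_d (P u v) i z).1 = 0 by rewrite cz out0.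
  rewrite twoline_d1; case: ifP => // iu _; apply: P_supp2_off => //.
  by move: iu; rewrite /P_supp1; lia.
by rewrite /cycle; apply: twoline_ext; rewrite ?twoline_d1 ?twoline_d2 ?out0 // z2 if_same.
Qed.

Lemma Pmod_exact u v i (z : P u v (i + 1)) : u <= v -> cycle z -> v <= i -> boundary z.
Proof.
move=> uv /(Pmod_cycleE _ uv) z2 vi.
exists ((0, inn (P_supp2 u v (i + 1 + 1)) (out z.1)) : P u v (i + 1 + 1)).
apply: twoline_ext; rewrite ?twoline_d1 ?twoline_d2 //= out_inn.
by rewrite /P_supp1 /P_supp2 !ifT //; lia.
Qed.

Lemma Pmod_to_Smod u v : u <= v -> exists2 p : dgmap (P u v) (S u v),
  quasi_iso p & forall i m, out (p i m).1 = if S_supp1 u v i then out m.1 else 0.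
Proof.
move=> uv.
have [|||p pE] := @dgmap_ex _ (P u v) (S u v)
  (fun i m => ((inn (S_supp1 u v i) (out m.1), 0) : S u v i)).
- move=> i c x y; apply: twoline_ext => /=; last by rewrite scaler0 addr0.
  by rewrite ?twoline_lin1 ?twoline_lin2 !outD !outZ !out_inn; case: ifP => _; ring.
- move=> i m; apply: twoline_ext; rewrite ?twoline_d2 ?twoline_d1 /= ?out0 // !out_inn if_same.
  case: ifP => // iu; case: ifP => // _; apply: P_supp2_off.
  by move: iu; rewrite /S_supp1; lia.
- move=> i m; apply: twoline_ext; rewrite ?twoline_X2 ?twoline_X1 /= ?out0 ?oppr0 // !out_inn.
  case: ifP => //; case: ifP; case: ifP => //; rewrite /P_supp1 /S_supp1.
  - by move=> h1 h2 h3; apply/P_supp1_off; lia.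
  - lia.
exists p => [|i m]; last by rewrite pE /= out_inn.
split=> [i z cz [w zw]|i z _].
  have [vi|iv] := leP v i; first exact: Pmod_exact.
  suff -> : z = 0 by apply: boundary0.
  move/(Pmod_cycleE _ uv): cz => z2; apply: twoline_ext; rewrite ?out0 //.
  have [iu|ui] := leP (i + 1) u; first exact: P_supp1_off.
  move/(congr1 (fun x : S u v (i + 1) => out x.1)): zw.
  rewrite pE twoline_d1 /= out_inn (out_off w.2) // if_same.
  by rewrite /S_supp1 ifT //; lia.
exists ((inn (P_supp1 u (i + 1)) (out z.1), 0) : P u v (i + 1)); split.
  by apply/(Pmod_cycleE _ uv); rewrite out0.
suff -> : z - p (i + 1) (inn (P_supp1 u (i + 1)) (out z.1), 0) = 0 by apply: boundary0.
rewrite pE; apply: twoline_ext => /=; rewrite outD outN ?out_inn ?out0 ?subr0; last exact: out_off.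
have := @out_off _ _ z.1; move: (out z.1) => a.
rewrite /S_supp1 /P_supp1; case: ifP => h1; last by move=> -> //; rewrite subr0.
by rewrite ifT ?subrr //; lia.
Qed.

(** An ext map sends [y_i] to a multiple of [x_i], on which [X] acts with opposite
    signs; hence the alternating coefficient. *)
Definition sign_at (i : int) : k := (-1) ^+ `|i|%N.
Lemma sign_atS i : sign_at (i + 1) = - sign_at i.
Proof.
rewrite /sign_at; have [i0|i0] := leP 0 i.
  by rewrite (_ : `|(i + 1)%R|%N = `|i|%N.+1) ?exprS ?mulN1r //; lia.
by rewrite (_ : `|i|%N = `|(i + 1)%R|%N.+1) ?exprS ?mulN1r ?opprK //; lia.
Qed.
Lemma sign_at_neq0 i : sign_at i != 0.
Proof. by rewrite expf_neq0 // oppr_eq0 oner_eq0. Qed.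

(** Hom maps are induced by maps of interval modules and ext maps by extensions.
    The formulas do not depend on the intervals, so they are stable under
    composition. *)
Definition is_hom_map u v u' v' (f : dgmap (P u v) (P u' v')) : Prop :=
  forall i m, out (f i m).1 = out m.1 /\ out (f i m).2 = out m.2.
Definition is_ext_map u v u' v' (f : dgmap (P u v) (P u' v')) : Prop :=
  forall i m, out (f i m).1 = sign_at i * out m.2 /\ out (f i m).2 = 0.

Lemma is_hom_hom u v u' v' u'' v'' (f : dgmap (P u v) (P u' v'))
  (g : dgmap (P u' v') (P u'' v'')) : is_hom_map g -> is_hom_map f -> is_hom_map (g <.> f).
Proof.
by move=> Hg Hf i m /=; have [-> ->] := Hg i (f i m); apply: Hf.
Qed.
Lemma is_hom_ext u v u' v' u'' v'' (f : dgmap (P u v) (P u' v'))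
  (g : dgmap (P u' v') (P u'' v'')) : is_hom_map g -> is_ext_map f -> is_ext_map (g <.> f).
Proof.
by move=> Hg Hf i m /=; have [-> ->] := Hg i (f i m); apply: Hf.
Qed.
Lemma is_ext_hom u v u' v' u'' v'' (f : dgmap (P u v) (P u' v'))
  (g : dgmap (P u' v') (P u'' v'')) : is_ext_map g -> is_hom_map f -> is_ext_map (g <.> f).
Proof.
by move=> Hg Hf i m /=; have [-> ->] := Hg i (f i m); have [_ ->] := Hf i m.
Qed.

Lemma hom_map_ex u v u' v' : u' <= u -> v' <= v -> exists f : dgmap (P u v) (P u' v'), is_hom_map f.
Proof.
move=> uu vv.
have [|||f fE] := @dgmap_ex _ (P u v) (P u' v')
  (fun i m => ((inn (P_supp1 u' i) (out m.1), inn (P_supp2 u' v' i) (out m.2)) : P u' v' i)).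
- move=> i c x y; apply: twoline_ext => /=;
  by rewrite ?twoline_lin1 ?twoline_lin2 !outD !outZ !out_inn; case: ifP => _; ring.
- move=> i m; apply: twoline_ext; rewrite ?twoline_d2 ?twoline_d1 /= ?out_inn ?out0 ?if_same //.
  have := @out_off _ _ m.2; rewrite /P_supp1 /P_supp2; move: (out m.2) => b bE.
  by do !case: ifP => ? //; rewrite bE //; lia.
- move=> i m; apply: twoline_ext; rewrite ?twoline_X2 ?twoline_X1 /= !out_inn.
    have := @out_off _ _ m.1; rewrite /P_supp1 /P_supp2; move: (out m.1) => a aE.
    by do !case: ifP => ? //; try lia; rewrite aE //; lia.
  have := @out_off _ _ m.2; rewrite /P_supp1 /P_supp2; move: (out m.2) => b bE.
  by do !case: ifP => ? //; try lia; rewrite ?bE ?oppr0 //; lia.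
exists f => i m; rewrite fE /= !out_inn; split; case: ifP => // /negbT h.
  by rewrite out_off //; move: h; rewrite /P_supp1; lia.
by rewrite out_off //; move: h; rewrite /P_supp2; lia.
Qed.

Lemma ext_map_ex u v u' v' : u' <= v + 1 -> exists f : dgmap (P u v) (P u' v'), is_ext_map f.
Proof.
move=> uv.
have [|||f fE] := @dgmap_ex _ (P u v) (P u' v')
  (fun i m => ((inn (P_supp1 u' i) (sign_at i * out m.2), 0) : P u' v' i)).
- move=> i c x y; apply: twoline_ext => /=; last by rewrite scaler0 addr0.
  by rewrite ?twoline_lin2 !outD !outZ !out_inn; case: ifP => _; ring.
- move=> i m; apply: twoline_ext; rewrite ?twoline_d2 ?twoline_d1 /= ?out_inn ?out0 ?if_same //.
  by rewrite mulr0 if_same.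
- move=> i m; apply: twoline_ext; rewrite ?twoline_X2 ?twoline_X1 /= ?out_inn ?out0; last first.
    by rewrite !if_same oppr0 if_same.
  have := @out_off _ _ m.2; rewrite /P_supp1 /P_supp2 sign_atS; move: (out m.2) => b bE.
  do !case: ifP => ? //; try lia; rewrite ?mulrNN //.
  - by rewrite bE ?mulr0 //; lia.
  - by rewrite bE ?mulr0 //; lia.
  - by rewrite mulr0.
exists f => i m; rewrite fE /= out_inn out0; split=> //.
case: ifP => // /negbT h; rewrite (out_off m.2) ?mulr0 //.
by move: h; rewrite /P_supp1 /P_supp2; lia.
Qed.

(** * Nonvanishing *)

Section Nonzero.
Variables u v u' v' : int.
Hypotheses (uv : u <= v).
Variable f : dgmap (P u v) (P u' v').

(** The image of the first generator is a cycle that is not a boundary. *)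
Lemma hom_map_neq0 : is_hom_map f -> u < v' -> hof f <> hzero _ _.
Proof.
move=> fF uv' f0.
have [h [hX hd0]] : f ~ dgzero _ _ by apply: hof_inj uv _ _ _ _.
have hd i m : f (i + 1) m = dg_d _ (i + 1) (h (i + 1) m) + h i (dg_d _ i m).
  by rewrite -hd0; exact/esym/subr0.
have := hd u (gen0 k u v); rewrite d_gen0 linear0 addr0.
move/(congr1 (fun x : P u' v' (u + 1) => out x.1)).
have [-> _] := fF (u + 1) (gen0 k u v).
have [+ _] := out_gen0 k uv (lexx _); rewrite orbX_id => -> /eqP.
rewrite twoline_d1 (@out_off _ _ (h _ _).2) ?if_same ?oner_eq0 //.
by rewrite /P_supp2; lia.
Qed.

(** On the second generator [y], a homotopy [h] to 0 would give [d h y + h d y],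
    where [h y] has no second component and [d y] is a multiple of the first
    generator, whose image under [h] lies in a zero space. *)
Lemma ext_map_neq0 : is_ext_map f -> u + 2 <= u' -> v + 2 <= v' -> hof f <> hzero _ _.
Proof.
move=> fG uu vv f0.
have [h [hX hd0]] : f ~ dgzero _ _ by apply: hof_inj uv _ _ _ _.
have hd i m : f (i + 1) m = dg_d _ (i + 1) (h (i + 1) m) + h i (dg_d _ i m).
  by rewrite -hd0; exact/esym/subr0.
have h0 i : u + 1 <= i -> h i (orbX i (gen0 k u v)) = 0.
  move: i; apply: int_ge_ind => [|i ui IH].
    by apply: twoline_ext; rewrite out0 out_off // /P_supp1 /P_supp2; lia.
  by rewrite orbXS // hX IH linear0 oppr0.
have := hd (v + 1) (gen1 k u v); rewrite d_gen1 // h0 ?addr0; last by lia.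
move/(congr1 (fun x : P u' v' (v + 1 + 1) => out x.1)).
have [-> _] := fG (v + 1 + 1) (gen1 k u v).
have [_] := out_gen1 k uv (lexx _); rewrite orbN_id => -> /eqP.
rewrite twoline_d1 (@out_off _ _ (h _ _).2) ?if_same ?mulr1; last first.
  by rewrite /P_supp2; lia.
by rewrite (negbTE (sign_at_neq0 _)).
Qed.
End Nonzero.

(** * Spaces of morphisms have dimension at most one *)

(** The intervals for which a hom map, respectively an ext map, is not
    null-homotopic. *)
Definition hom_range (u v u' v' : int) : Prop := [/\ u' <= u, u < v' & v' <= v].
Definition ext_range (u v u' v' : int) : Prop :=
  [/\ u + 2 <= u', u' <= v + 1 & v + 2 <= v'].

Section Target.
Variables u v : int.

Lemma Smod_orbN p i (x : S u v p) : u < p -> p <= i -> i <= v ->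
  out (orbN i x).1 = sign_at (i - p) * out x.1.
Proof.
move=> up; move: i; apply: int_ge_ind => [|i pi IH] iv.
  by rewrite orbN_id subrr /sign_at expr0 mul1r.
rewrite orbNS // /= outN out_inn IH; last by lia.
rewrite (_ : i + 1 - p = i - p + 1); last by lia.
by rewrite sign_atS mulNr /S_supp1 ifT //; lia.
Qed.

Lemma Smod_orbX p i (x : S u v p) : u < p -> p <= i -> i <= v -> out (orbX i x).1 = out x.1.
Proof.
move=> up; move: i; apply: int_ge_ind => [|i pi IH] iv; first by rewrite orbX_id.
by rewrite orbXS // twoline_X1 IH /S_supp1 ?ifT //; lia.
Qed.

End Target.

(** The map is given by two scalars, its values on the generators.  The first is
    killed by a power of [X] in the interval module, so it can be nonzero only in
    the hom range; the second matters only modulo the multiples of the elements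
    of degree [u + 2], so up to homotopy only in the ext range. *)
Lemma Smod_null u v u' v' (g : dgmap (P u v) (S u' v')) : u <= v ->
  (hom_range u v u' v' -> out (g _ (gen0 k u v)).1 = 0) ->
  (ext_range u v u' v' -> out (g _ (gen1 k u v)).1 = 0) ->
  g ~ dgzero _ _.
Proof.
move=> uv HF HG.
have S2 i (x : S u' v' i) : out x.2 = 0 by exact: out_off.
have g0 : g _ (gen0 k u v) = 0.
  apply: twoline_ext; rewrite ?out0 ?S2 //.
  have [hu|hu] := leP (u + 1) u'; first by rewrite out_off // /S_supp1; lia.
  have [hv|hv] := leP v' u; first by rewrite out_off // /S_supp1; lia.
  have [vv|vv] := leP v' v; first by apply: HF; split; lia.
  rewrite -(@Smod_orbX _ _ _ (v + 1)) ?dgmap_orbX //; try lia.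
  rewrite -dgmap_orbX; last by lia.
  by rewrite -d_gen1 // dgf_d twoline_d1 S2 if_same.
have null : g _ (gen1 k u v) = 0 -> g ~ dgzero _ _.
  by move=> g1; apply/htp_eq/Pmod_ext => //=; rewrite ?g0 ?g1.
have [hv|hv] : ~ (u' < v + 2 /\ v + 2 <= v') \/ (u' < v + 2 /\ v + 2 <= v') by lia.
  by apply/null/twoline_ext; rewrite ?out0 ?S2 // out_off // /S_supp1; lia.
have [hu|hu] := leP (u + 2) u'.
  by apply/null/twoline_ext; rewrite ?out0 ?S2 //; apply: HG; split; lia.
pose c : k := sign_at (v + 1 + 1 - (u + 1 + 1)).
pose x : S u' v' (u + 1 + 1) := (inn _ (c^-1 * out (g _ (gen1 k u v)).1), 0).
apply: (@Pmod_homotopic _ _ _ uv _ _ _ x 0).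
  rewrite [LHS]subr0 g0; apply: twoline_ext; rewrite ?twoline_d2 ?twoline_d1 !out0 ?if_same //.
rewrite (linear0 (dg_d _ _)) add0r [LHS]subr0.
apply: twoline_ext; rewrite ?S2 // Smod_orbN; try lia.
by rewrite out_inn /S_supp1 ifT ?mulrA ?mulfV ?mul1r ?sign_at_neq0 //; lia.
Qed.

Lemma hof_add M N (f g : dgmap M N) : hof (dgadd f g) = hadd (hof f) (hof g) :> @hom k M N.
Proof. by rewrite /hof -!/(fr (quasi_iso_id _) _) fr_addE. Qed.

Section Span.
Variables u v u' v' : int.
Hypotheses (uv : u <= v) (uv' : u' <= v').

(** [Pmod] and [Smod] are isomorphic in D, so one may compute in [Smod]. *)
Lemma hom_zero (f : hom (P u v) (P u' v')) :
  ~ hom_range u v u' v' -> ~ ext_range u v u' v' -> f = hzero _ _.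
Proof.
move=> nF nG; have [p qp _] := Pmod_to_Smod uv'.
have [q [qp1 _]] := hof_iso qp.
rewrite -[f]hcomp1l -qp1 -hcompA.
have [g ->] := hof_surj uv (hcomp (hof p) f).
by rewrite (hof_htp (@Smod_null _ _ _ _ g uv _ _)) // -/(hzero _ _) hcomp0r.
Qed.

(** A nonzero morphism has a nonzero scalar in the range concerned; subtracting the
    right multiple of it kills the scalar of [f]. *)
Lemma hom_span (e f : hom (P u v) (P u' v')) : e <> hzero _ _ ->
  exists c, f = hscale c e.
Proof.
move=> e0; have [p qp _] := Pmod_to_Smod uv'.
have [q [qp1 qp2]] := hof_iso qp.
have [ge Ee] := hof_surj uv (hcomp (hof p) e).
have [gf Ef] := hof_surj uv (hcomp (hof p) f).
suff [c cE] : exists c, hof gf = hscale c (hof ge).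
  exists c; rewrite -[f]hcomp1l -[e]hcomp1l -qp1 -!hcompA Ef Ee cE.
  by rewrite hcompZr.
have ne : ~ (ge ~ dgzero _ _).
  move=> /hof_htp E; apply: e0; rewrite -[e]hcomp1l -qp1 -hcompA Ee E.
  exact: hcomp0r.
have H c : dgadd gf (dgscale (- c) ge) ~ dgzero _ _ -> hof gf = hscale c (hof ge).
  move=> /hof_htp; rewrite hof_add hof_scale => E; apply: hadd_eq0.
  by rewrite hscaleA mulN1r.
have [cF|nF] := pselect (hom_range u v u' v').
  have nG : ~ ext_range u v u' v' by case: cF => ? ? ? []; lia.
  have z0 : out (ge _ (gen0 k u v)).1 != 0.
    by apply/eqP => z; apply: ne; apply: Smod_null.
  exists (out (gf _ (gen0 k u v)).1 / out (ge _ (gen0 k u v)).1).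
  by apply/H/Smod_null => // _; rewrite /= outD outZ mulNr divfK ?subrr.
exists (out (gf _ (gen1 k u v)).1 / out (ge _ (gen1 k u v)).1).
apply/H/Smod_null => // cG; rewrite /= outD outZ mulNr divfK ?subrr //.
by apply/eqP => z; apply: ne; apply: Smod_null.
Qed.
End Span.

End IntervalHom.

(** * Linear functionals *)
Section Functional.
Local Open Scope classical_set_scope.
Variables (k : fieldType) (V : lmodType k).

Definition partial_functional (G : V -> k -> Prop) : Prop :=
  [/\ G 0 0, forall c x a y b, G x a -> G y b -> G (c *: x + y) (c * a + b) &
      forall a, G 0 a -> a = 0].

(** Zorn's lemma for the graphs of linear functionals on subspaces: a maximal one
    is defined everywhere, since a new vector can be given the value 0. *)
Lemma extend_functional (G : V -> k -> Prop) : partial_functional G ->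
  exists f : V -> k, (forall c x y, f (c *: x + y) = c * f x + f y) /\
    forall x a, G x a -> f x = a.
Proof.
move=> pG.
pose good (X : set (V * k)) :=
  partial_functional (fun x a => X (x, a)) /\ (forall x a, G x a -> X (x, a)).
have [F FP Ft|A [P_supp1 maxA]] := @Zorn_bigcup (V * k)%type
    (fun X => X = set0 \/ good X).
  have [[X0 [FX0 gX0]]|none] := pselect (exists X, F X /\ good X); last first.
    left; rewrite -subset0 => x [X FX Xx].
    case: (FP X FX) => [e|gX]; first by rewrite e in Xx.
    by apply: none; exists X.
  right; split; last by move=> x a Gx; exists X0 => //; apply: gX0.2.
  have up X x : F X -> X x -> good X.
    by move=> FX Xx; case: (FP X FX) => // e; rewrite e in Xx.
  split=> [|c x a y b [X FX Xx] [Y FY Yy]|a [X FX Xa]].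
  - by exists X0 => //; case: gX0.1.
  - case: (Ft X Y FX FY) => sub.
      by exists Y => //; have [[_ h _] _] := up _ _ FY Yy; apply: h => //; apply: sub.
    by exists X => //; have [[_ h _] _] := up _ _ FX Xx; apply: h => //; apply: sub.
  - by have [[_ _ h] _] := up _ _ FX Xa; apply: h.
have gA : good A.
  case: P_supp1 => // A0; case: (maxA [set p | G p.1 p.2]); last by right.
  split; first by rewrite A0.
  by rewrite A0 => /(_ (0, 0)) /=; case: pG => G0 _ _ h; apply: h.
have [[A0 Alin Auniq] GA] := gA.
have Afun x a b : A (x, a) -> A (x, b) -> a = b.
  move=> Aa Ab; apply/eqP; rewrite -subr_eq0; apply/eqP/Auniq.
  have := Alin (-1) x b x a Ab Aa.
  by rewrite scaleN1r addNr mulN1r addrC.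
have Atot x : exists a, A (x, a).
  apply: contrapT => noa.
  pose B : set (V * k) := [set p | exists2 q, A q & exists c, p = (c *: x + q.1, q.2)].
  apply: (maxA B); last right.
    split; first by move=> q Aq; exists q => //; exists 0; rewrite scale0r add0r; case: q Aq.
    move=> BA; apply: noa; exists 0; apply: BA; exists (0, 0) => //; exists 1.
    by rewrite scale1r addr0.
  split=> [|y a Gy]; last by exists (y, a); [apply: GA | exists 0; rewrite scale0r add0r].
  split=> [|c y a z b [[y' a'] Ay [c1 [-> ->]]] [[z' b'] Az [c2 [-> ->]]]|a].
  - by exists (0, 0) => //; exists 0; rewrite scale0r addr0.
  - exists (c *: y' + z', c * a' + b'); first exact: Alin.
    exists (c * c1 + c2) => /=; congr (_, _).
    by rewrite scalerDr scalerA scalerDl addrACA.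
  - move=> [[q b] Aq [c [e ->]]] /=; have [c0|c0] := eqVneq c 0.
      by move: e; rewrite c0 scale0r add0r /= => q0; apply: Auniq; rewrite q0.
    case: noa; exists (- c^-1 * b).
    have := Alin (- c^-1) q b 0 0 Aq A0; rewrite !addr0.
    suff -> : - c^-1 *: q = x by [].
    apply: (scalerI c0); rewrite scalerA mulrN mulfV // scaleN1r.
    by apply/eqP; rewrite eq_sym -addr_eq0 -e.
have [f fA] := choice Atot; exists f; split=> [c x y|x a Gx].
  by apply: Afun (fA _) _; apply: Alin.
by apply: Afun (fA _) _; apply: GA.
Qed.

(** Extend the functional sending [w + a v] to [a], for [w] in [W]. *)
Lemma separating_functional (W : V -> Prop) (v : V) :
  W 0 -> (forall c x y, W x -> W y -> W (c *: x + y)) -> ~ W v ->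
  exists f : V -> k, [/\ forall c x y, f (c *: x + y) = c * f x + f y,
    forall x, W x -> f x = 0 & f v = 1].
Proof.
move=> W0 Wl Wv.
have [|f [fl fG]] := @extend_functional (fun x a => W (x - a *: v)).
  split=> [|c x a y b Wx Wy|a]; first by rewrite scale0r subr0.
    suff -> : c *: x + y - (c * a + b) *: v = c *: (x - a *: v) + (y - b *: v).
      exact: Wl.
    by rewrite scalerBr scalerA addrACA scalerDl opprD.
  rewrite sub0r => Wa; have [//|a0] := eqVneq a 0; case: Wv.
  have := Wl (- a^-1) _ _ Wa W0.
  by rewrite addr0 scaleNr scalerN opprK scalerA mulVf // scale1r.
exists f; split=> // [x Wx|]; apply: fG; first by rewrite scale0r subr0.
by rewrite scale1r subrr.
Qed.

End Functional.

(** * Direct sums *)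
Section DirectSums.
Variable k : fieldType.
Implicit Types M N L A B C : dgmod k.
Local Notation "f ~ g" := (homotopic f g) (at level 70).
Local Notation "f <.> g" := (dgcomp f g) (at level 40, left associativity).

(** The interval module on an empty interval. *)
Definition dg0 : dgmod k := Smod k 0 0.

Lemma dg0E i (x y : dg0 i) : x = y.
Proof.
have h (z : dg0 i) : out z.1 = 0 by rewrite out_off // /S_supp1; lia.
have h2 (z : dg0 i) : out z.2 = 0 by rewrite out_off.
by apply: twoline_ext; rewrite ?h ?h2.
Qed.

(** The homotopy pullback over the zero module is the direct sum, its third
    component being zero. *)
Definition dsum M N : dgmod k := hpb (dgzero M dg0) (dgzero N dg0).
Definition dfst M N : dgmap (dsum M N) M := hpb_fst _ _.
Definition dsnd M N : dgmap (dsum M N) N := hpb_snd _ _.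

Lemma dsum_ext M N i (x y : dsum M N i) :
  dfst M N i x = dfst M N i y -> dsnd M N i x = dsnd M N i y -> x = y.
Proof.
by case: x y => [[a b] c] [[a' b'] c'] /= -> ->; congr (_, _, _); apply: dg0E.
Qed.

Lemma dpair M N L (f : dgmap L M) (g : dgmap L N) : exists h : dgmap L (dsum M N),
  (forall i x, dfst M N i (h i x) = f i x) /\ (forall i x, dsnd M N i (h i x) = g i x).
Proof. by apply: hpb_lift; apply: htp_eq => i x; apply: dg0E. Qed.

Lemma dsum_biproduct M N : exists i0 i1,
  [/\ hcomp (hof (dfst M N)) i0 = hid M, hcomp (hof (dsnd M N)) i1 = hid N,
      hcomp (hof (dfst M N)) i1 = hzero N M, hcomp (hof (dsnd M N)) i0 = hzero M N &
      hadd (hcomp i0 (hof (dfst M N))) (hcomp i1 (hof (dsnd M N))) = hid (dsum M N)].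
Proof.
have [j0 [a0 b0]] := dpair (dgid M) (dgzero M N).
have [j1 [a1 b1]] := dpair (dgzero N M) (dgid N).
exists (hof j0), (hof j1); split; rewrite -!hof_comp -?hof_add; apply/hof_htp/htp_eq => i x.
- exact: a0.
- exact: b1.
- exact: a1.
- exact: b0.
- apply: dsum_ext; rewrite fD /=.
    by have /= -> := a0 i x.1.1; have /= -> := a1 i x.1.2; rewrite addr0.
  by have /= -> := b0 i x.1.1; have /= -> := b1 i x.1.2; rewrite add0r.
Qed.

Definition ord_dec n (l : 'I_n.+1) : (ord0 = l) + {j : 'I_n | lift ord0 j = l}.
Proof.
case: (unliftP ord0 l) => [j|] ->; [right | by left].
by exists j.
Defined.

(** Here [R] is a direct sum of all the objects but the first, so this is the
    induction step for finite direct sums. *)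
Lemma biproduct_cons n (N : 'I_n.+1 -> dgmod k) R B (i0 : hom (N ord0) B)
    (p0 : hom B (N ord0)) (i1 : hom R B) (p1 : hom B R) :
  hcomp p0 i0 = hid _ -> hcomp p1 i1 = hid _ -> hcomp p0 i1 = hzero _ _ ->
  hcomp p1 i0 = hzero _ _ -> hadd (hcomp i0 p0) (hcomp i1 p1) = hid _ ->
  D_direct_sum R (fun j => N (lift ord0 j)) -> D_direct_sum B N.
Proof.
move=> e00 e11 e01 e10 ee /D_direct_sumE [i [p [h1 h2 h3]]]; apply/D_direct_sumE.
pose inj l : hom (N l) B := match ord_dec l with
  | inl e => ecast z (hom (N z) B) e i0
  | inr (exist j e) => ecast z (hom (N z) B) e (hcomp i1 (i j)) end.
pose prj l : hom B (N l) := match ord_dec l with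
  | inl e => ecast z (hom B (N z)) e p0
  | inr (exist j e) => ecast z (hom B (N z)) e (hcomp (p j) p1) end.
have dec0 : ord_dec ord0 = inl erefl :> (ord0 = ord0 :> 'I_n.+1) + _.
  case: (ord_dec _) => [e|[j e]]; first by rewrite (eq_irrelevance e erefl).
  by exfalso; have := neq_lift ord0 j; rewrite e eqxx.
have decS j : ord_dec (lift ord0 j) = inr (exist _ j erefl).
  case: (ord_dec _) => [e|[j' e]].
    by exfalso; have := neq_lift ord0 j; rewrite -e eqxx.
  by have jj := lift_inj e; subst; rewrite (eq_irrelevance e erefl).
have inj0 : inj ord0 = i0 by rewrite /inj dec0.
have prj0 : prj ord0 = p0 by rewrite /prj dec0.
have injS j : inj (lift ord0 j) = hcomp i1 (i j) by rewrite /inj decS.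
have prjS j : prj (lift ord0 j) = hcomp (p j) p1 by rewrite /prj decS.
have mid j j' : hcomp (hcomp (p j) p1) (hcomp i1 (i j')) = hcomp (p j) (i j').
  by rewrite hcompA -(hcompA _ p1) e11 hcomp1r.
exists inj, prj; split=> [l|l l'|].
- case: (unliftP ord0 l) => [j|] ->; last by rewrite inj0 prj0.
  by rewrite injS prjS mid h1.
- case: (unliftP ord0 l) => [j|] ->; case: (unliftP ord0 l') => [j'|] -> ll.
  + rewrite injS prjS mid; apply: h2; apply: contra ll => /eqP -> //.
  + by rewrite injS prj0 hcompA e01 hcomp0l.
  + by rewrite prjS inj0 -hcompA e10 hcomp0r.
  + by rewrite eqxx in ll.
- rewrite -ee /hsum big_ord_recl inj0 prj0; congr hadd.
  rewrite -[p1 in RHS]hcomp1l -h3 hcomp_suml hcomp_sumr; apply: eq_bigr => j _.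
  by rewrite injS prjS !hcompA.
Qed.

Lemma D_direct_sum_iso M B n (N : 'I_n -> dgmod k) :
  D_iso M B -> D_direct_sum B N -> D_direct_sum M N.
Proof.
move=> /D_isoE [f [g [gf fg]]] /D_direct_sumE [i [p [h1 h2 h3]]]; apply/D_direct_sumE.
have mid l l' : hcomp (hcomp (p l') f) (hcomp g (i l)) = hcomp (p l') (i l).
  by rewrite hcompA -(hcompA _ f) fg hcomp1r.
exists (fun l => hcomp g (i l)), (fun l => hcomp (p l) f); split=> [l|l l' ll|].
- by rewrite mid h1.
- by rewrite mid h2.
- rewrite -gf -[f in RHS]hcomp1l -h3 hcomp_suml hcomp_sumr.
  by apply: eq_bigr => l _; rewrite !hcompA.
Qed.

Lemma D_direct_sum_uniq M B n (N : 'I_n -> dgmod k) :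
  D_direct_sum M N -> D_direct_sum B N -> D_iso M B.
Proof.
move=> /D_direct_sumE [i [p [h1 h2 h3]]] /D_direct_sumE [j [q [g1 g2 g3]]].
apply/D_isoE; exists (hsum (fun l => hcomp (j l) (p l))), (hsum (fun l => hcomp (i l) (q l))).
have cross A C (a : forall l, hom (N l) A) (b : forall l, hom C (N l)) X
    (i' : forall l, hom (N l) X) (p' : forall l, hom X (N l)) :
    (forall l, hcomp (p' l) (i' l) = hid _) ->
    (forall l l', l != l' -> hcomp (p' l') (i' l) = hzero _ _) ->
    hcomp (hsum (fun l => hcomp (a l) (p' l))) (hsum (fun l => hcomp (i' l) (b l))) =
    hsum (fun l => hcomp (a l) (b l)).
  move=> e1 e2; rewrite hcomp_suml; apply: eq_bigr => l _.
  rewrite hcomp_sumr /hsum (bigD1 l) //= big1 ?hadd0r => [|l' ll].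
    by rewrite hcompA -(hcompA (a l)) e1 hcomp1r.
  by rewrite hcompA -(hcompA (a l)) e2 // hcomp0r hcomp0l.
by split; rewrite cross // ?h3 ?g3.
Qed.

(** * Finite homology *)

Lemma fin_homology_qis B L (s : dgmap B L) :
  quasi_iso s -> fin_homology L -> fin_homology B.
Proof.
move=> [si ss] [[n nP] sp]; split.
  by exists n => i ni z cz; apply: si => //; apply/nP/cycle_map.
move=> i; have [m [e [ce eP]]] := sp i.
have [y yP] := choice (fun l => ss i _ (ce l)).
exists m, y; split=> [l|z cz]; first by case: (yP l).
have [c cP] := eP _ (cycle_map s cz); exists c; apply: si.
  apply: cycleB => //; apply: (big_ind (@cycle k B i)).
  - by rewrite /cycle linear0.
  - by move=> a b; apply: cycleD.
  - by move=> l _; apply: cycleZ; case: (yP l).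
rewrite fB linear_sum /=; apply: boundary_trans cP.
set a := s _ z; set b := \sum_(l < m) _; set d := \sum_(l < m) _.
have -> : a - b - (a - d) = d - b by rewrite opprB [LHS]addrC addrA subrK.
rewrite -sumrB; apply: (big_ind (@boundary k L (i + 1))).
- exact: boundary0.
- by move=> u v; apply: boundaryD.
- move=> l _; rewrite fZ -scalerBr; apply: boundaryZ; by case: (yP l).
Qed.

Lemma fin_homology_retract C B (i : dgmap C B) (p : dgmap B C) :
  (forall j x, p j (i j x) = x) -> fin_homology B -> fin_homology C.
Proof.
move=> pi [[n nP] sp]; split.
  exists n => j nj z cz; rewrite -(pi _ z); apply: boundary_map; apply: nP => //.
  exact: cycle_map.
move=> j; have [m [e [ce eP]]] := sp j.
exists m, (fun l => p _ (e l)); split=> [l|z cz]; first exact: cycle_map.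
have [c cP] := eP _ (cycle_map i cz); exists c.
have := boundary_map p cP; rewrite fB pi linear_sum /=.
by under eq_bigr => l _ do rewrite fZ.
Qed.

Lemma fin_homology_dsum M N : fin_homology M -> fin_homology N -> fin_homology (dsum M N).
Proof.
have [j0 [a0 b0]] := dpair (dgid M) (dgzero M N).
have [j1 [a1 b1]] := dpair (dgzero N M) (dgid N).
have xE i x : x = j0 i (dfst M N i x) + j1 i (dsnd M N i x).
  by apply: dsum_ext; rewrite fD ?a0 ?a1 ?b0 ?b1 /= ?addr0 ?add0r.
move=> [[n nP] sp] [[n' nP'] sp']; split.
  exists (Num.max n n') => i; rewrite gt_max => /andP [ni ni'] z cz; rewrite (xE _ z).
  by apply: boundaryD; apply: boundary_map; [apply: nP|apply: nP'] => //; apply: cycle_map.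
move=> i; have [m [e [ce eP]]] := sp i; have [m' [e' [ce' eP']]] := sp' i.
exists (m + m')%N, (fun l => match fintype.split l with
  | inl l => j0 _ (e l) | inr l => j1 _ (e' l) end); split=> [l|z cz].
  by case: (fintype.split l) => ?; apply: cycle_map.
have [c cP] := eP _ (cycle_map (dfst M N) cz).
have [c' cP'] := eP' _ (cycle_map (dsnd M N) cz).
exists (fun l => match fintype.split l with inl l => c l | inr l => c' l end).
rewrite big_split_ord /=.
have -> : \sum_(l < m) match fintype.split (lshift m' l) with inl l => c l | inr l => c' l end
   *: match fintype.split (lshift m' l) with inl l => j0 _ (e l) | inr l => j1 _ (e' l) end
   = \sum_(l < m) j0 _ (c l *: e l).
  by apply: eq_bigr => l _; rewrite (unsplitK (inl l)) fZ.
have -> : \sum_(l < m') match fintype.split (rshift m l) with inl l => c l | inr l => c' l end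
   *: match fintype.split (rshift m l) with inl l => j0 _ (e l) | inr l => j1 _ (e' l) end
   = \sum_(l < m') j1 _ (c' l *: e' l).
  by apply: eq_bigr => l _; rewrite (unsplitK (inr l)) fZ.
rewrite [z](xE _) opprD addrACA; apply: boundaryD.
  by have := boundary_map j0 cP; rewrite fB linear_sum.
by have := boundary_map j1 cP'; rewrite fB linear_sum.
Qed.

(** The map from the zero module is then a quasi-isomorphism, over which the
    identity and the zero morphism agree. *)
Lemma D_zero_acyclic L :
  (forall i (z : L (i + 1)), cycle z -> boundary z) -> D_zero L.
Proof.
move=> ac; exists dg0, (dgzero _ _), (dgzero _ _); split; try exact: htp_eq.
split=> [i z cz bz|i z cz]; first by exists 0; apply: dg0E.
exists 0; split; first exact: dg0E.
by rewrite (_ : z - _ = z); [apply: ac | apply: subr0].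
Qed.

Lemma fin_homology0 : fin_homology dg0.
Proof.
split; first by exists 0 => i _ z _; exists 0; apply: dg0E.
move=> i; exists 0%N, (fun _ => 0); split=> [[]//|z _].
by exists (fun _ => 0); exists 0; apply: dg0E.
Qed.

Lemma D_direct_sum_ex n (N : 'I_n -> dgmod k) : (forall l, fin_homology (N l)) ->
  exists R, fin_homology R /\ D_direct_sum R N.
Proof.
elim: n N => [|n IH] N fN.
  exists dg0; split; first exact: fin_homology0.
  apply/D_direct_sumE; exists (fun _ => hzero _ _), (fun _ => hzero _ _); split=> [[]//|[]//|].
  rewrite /hsum big_ord0; apply/esym/D_zeroE/D_zero_acyclic => i z _.
  by exists 0; apply: dg0E.
have [R [fR dR]] := IH _ (fun l => fN (lift ord0 l)).
exists (dsum (N ord0) R); split; first exact: fin_homology_dsum.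
have [i0 [i1 [e1 e2 e3 e4 e5]]] := dsum_biproduct (N ord0) R.
exact: biproduct_cons e1 e2 e3 e4 e5 dR.
Qed.

(** * Splitting off a summand *)

(** [C] is the homotopy fibre of [f].  As [f g] is invertible, each homology class
    of [L] is in a unique way the sum of one coming from [A] and one killed by
    [f]. *)
Lemma split_off A L I (g : dgmap A L) (f : dgmap L I) : quasi_iso (f <.> g) ->
  exists C, exists s : dgmap (dsum A C) L, quasi_iso s.
Proof.
move=> [qi qs]; pose C := hpb f (dgzero dg0 I); exists C.
pose c : dgmap C L := hpb_fst f (dgzero dg0 I).
have Z i (b b' : dg0 i) : b = b' by apply: dg0E.
exists (dgadd (g <.> dfst A C) (c <.> dsnd A C)); split=> [i|i z cz].
  move=> [[x [[y b] n]] b'] /= [dx dy db dn' _ _] [w /= ew].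
  have dn : dg_d I (i + 1) n = f _ y.
    by move: dn' => /eqP; rewrite subr_eq0 => /eqP <-; apply: subr0.
  have [x' ex'] : boundary x.
    apply: qi => //=; exists (f _ w - n); rewrite dB dn -dgf_d -ew fD.
    by rewrite addrK.
  have [|x2 [cx2 [e ee]]] := qs (i + 1) (f _ w - n - f _ (g _ x')).
    rewrite /cycle !dB dn -!dgf_d -ex' -ew fD addrK; exact: subrr.
  (* Subtracting from [w] the image of [x' + x2] leaves an element whose image
     under [f] is, up to the boundary of [e], the third component [n]. *)
  exists ((x' + x2, (w - g _ (x' + x2), 0, e)), 0).
  rewrite /= /hpb_dfun /=; congr ((_, (_, _, _)), _); try exact: Z.
  - by rewrite dD -ex' cx2 addr0.
  - by rewrite dB -ew -dgf_d dD -ex' cx2 addr0 addrAC subrr add0r.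
  - transitivity (f _ w - f _ (g _ x') - f _ (g _ x2) - dg_d I (i + 1 + 1) e).
      by rewrite -ee /= opprB addrA subrK opprB addrA subrK opprB [RHS]addrC subrK.
    by congr (_ - _); rewrite fB !fD [RHS]subr0 opprD addrA.
have [x [cx [e ee]]] := qs i _ (cycle_map f cz).
exists ((x, (z - g _ x, 0, e)), 0); split.
  rewrite /cycle /= /hpb_dfun /=; congr ((_, (_, _, _)), _); try exact: Z.
  - exact: cx.
  - by rewrite dB -dgf_d cx cz linear0 subr0.
  - rewrite -ee fB; apply/eqP; rewrite subr_eq0; apply/eqP; exact: subr0.
rewrite /= [g _ x + _]addrC subrK subrr; exact: boundary0.
Qed.

End DirectSums.

(** * Indecomposable objects are interval modules *)
Section Classification.
Variable k : fieldType.
Implicit Types L M N : dgmod k.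
Local Notation "f ~ g" := (homotopic f g) (at level 70).
Local Notation "f <.> g" := (dgcomp f g) (at level 40, left associativity).
Local Notation P := (Pmod k).
Local Notation I := (Imod k).

Lemma orbN_lin M p i c (x y : M p) : orbN i (c *: x + y) = c *: orbN i x + orbN i y.
Proof. exact: orbN_linear. Qed.

Lemma orbN_orbX M p i (x : M p) : p <= i -> orbN i x = sign_at k (i - p) *: orbX i x.
Proof.
move: i; apply: int_ge_ind => [|i pi IH].
  by rewrite orbN_id orbX_id subrr /sign_at expr0 scale1r.
rewrite orbNS // orbXS // IH XZ (_ : i + 1 - p = i - p + 1); last by lia.
by rewrite sign_atS scaleNr.
Qed.

Lemma orbN_shift M p i (x : M p) : p + 1 <= i -> orbN i (dg_X M p x) = - orbN i x.
Proof.
move=> pi; have := @orb_shift _ _ (fun j => (\- dg_X M j) : {linear M j -> M (j + 1)}) p i x pi.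
by rewrite /= -/(orbN i x) -/(orbN i _) => <-; rewrite -[in LHS](opprK (dg_X M p x)) linearN.
Qed.

Lemma orbX_shift M p i (x : M p) : p + 1 <= i -> orbX i (dg_X M p x) = orbX i x.
Proof. exact: orb_shift. Qed.

Lemma orbX_cycle M p i (x : M (p + 1)) : p <= i -> cycle x -> cycle (orbX (i + 1) x).
Proof. by move=> pi cx; rewrite /cycle d_orbX // cx linear0. Qed.

Lemma orbX_boundary M p i (x : M p) : p <= i -> boundary x -> boundary (orbX i x).
Proof.
move=> pi [w ->]; exists (orbN (i + 1) w); by rewrite d_orbN.
Qed.

(** Among the homology classes choose one surviving a maximal number of
    multiplications by [X].  The last condition also comes from maximality: if the
    multiple in degree [v] of a class of degree one less than that of [z] did not
    vanish, that class would survive one more multiplication.  The degree of [z]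
    is written [u0 + 1 + 1] so that this lower degree has a differential. *)
Lemma top_class L : fin_homology L ->
  ~ (forall i (z : L (i + 1)), cycle z -> boundary z) ->
  exists (u0 v : int) (z : L (u0 + 1 + 1)),
    [/\ u0 + 1 < v, cycle z, ~ boundary (orbX v z), boundary (orbX (v + 1) z) &
        forall y : L (u0 + 1), cycle y -> boundary (orbX v y)].
Proof.
move=> [[b bP] _] nac.
pose Q (r : nat) := exists (j : int) (z : L (j + 1)),
  cycle z /\ ~ boundary (orbX (j + r%:Z + 1) z).
have Q0 : exists r, `[< Q r >].
  exists 0%N; apply/asboolP; apply: contrapT => nQ; apply: nac => i z cz.
  apply: contrapT => bz; apply: nQ; exists i, z; split=> //.
  by rewrite addr0 orbX_id.
have Qb r : `[< Q r >] -> (r <= (`|b|%N).*2.+1)%N.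
  move=> /asboolP [j [z [cz nz]]]; rewrite leqNgt; apply/negP => rb; apply: nz.
  have [jb|jb] := ltP b `|j|; first by apply: orbX_boundary; [lia | exact: bP].
  by apply: bP; [lia | apply: orbX_cycle => //; lia].
have [r /asboolP [j [z [cz nz]]] rmax] := ex_maxnP Q0 Qb.
have nQ s : (r < s)%N -> ~ Q s by move=> rs /asboolP /rmax; lia.
have [u0 e] : exists u0, j = u0 + 1 by exists (j - 1); lia.
subst j; exists u0, (u0 + 1 + r%:Z + 1), z; split=> //; first by lia.
- apply: contrapT => nb; apply: (nQ r.+1) => //; exists (u0 + 1), z; split=> //.
  by rewrite (_ : u0 + 1 + r.+1%:Z + 1 = u0 + 1 + r%:Z + 1 + 1) //; lia.
- move=> y cy; apply: contrapT => nb; apply: (nQ r.+1) => //; exists u0, y; split=> //.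
  by rewrite (_ : u0 + r.+1%:Z + 1 = u0 + 1 + r%:Z + 1) //; lia.
Qed.

(** A map to the injective model is a pair of functionals, on [L v] and on [L u0],
    composed with the powers of [X].  The second is forced on boundaries by the
    first, and consistently so because [phi] vanishes on the multiples of
    cycles; it then extends to [L u0]. *)
Lemma to_Imod L u0 v (phi : L v -> k) : u0 + 1 <= v ->
  (forall c x y, phi (c *: x + y) = c * phi x + phi y) ->
  (forall x, boundary x -> phi x = 0) ->
  (forall y : L (u0 + 1), cycle y -> phi (orbN v y) = 0) ->
  exists f : dgmap L (I (u0 + 1) v),
    forall i l, out (f i l).2 = if i <= v then phi (orbN v l) else 0.
Proof.
move=> uv pl pb pc.
have pB x y : phi (x - y) = phi x - phi y.
  by rewrite addrC -scaleN1r pl mulN1r addrC.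
have pN x : phi (- x) = - phi x by rewrite -sub0r pB pb ?sub0r //; apply: boundary0.
have [|psi [psil psiE]] := @extend_functional _ (L u0)
    (fun x a => exists2 y, x = dg_d L u0 y & a = phi (orbN v y)).
  split=> [|c x a y b [x' -> ->] [y' -> ->]|a [y /esym cy ->]].
  - by exists 0; rewrite ?linear0 //; rewrite pb //; apply: boundary0.
  - by exists (c *: x' + y'); rewrite linearP ?pl.
  - exact: pc.
have psid y : psi (dg_d L u0 y) = phi (orbN v y) by apply: psiE; exists y.
have psi0 : psi 0 = 0 by rewrite -(linear0 (dg_d L u0)) psid linear0 pb //; apply: boundary0.
have [|||f fE] := @dgmap_ex _ L (I (u0 + 1) v) (fun i l =>
   (inn (I_supp1 (u0 + 1) v i) (psi (orbX u0 l)), inn (I_supp2 v i) (phi (orbN v l))) : I (u0 + 1) v i).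
- move=> i c x y; apply: twoline_ext => /=; rewrite outD outZ !out_inn linearP ?psil ?pl;
  by case: ifP => _; rewrite ?mulr0 ?addr0.
- move=> i m; apply: twoline_ext; rewrite ?twoline_d1 ?twoline_d2 /= !out_inn /I_supp1 /I_supp2; last first.
    case: ifP => // iv; apply: pb; exists (orbX (v + 1) m); by rewrite d_orbX.
  case: ifP => // h; rewrite ifT; last by lia.
  by rewrite -d_orbN ?psid ?orbN_orbN //; lia.
- move=> i m; apply: twoline_ext; rewrite ?twoline_X1 ?twoline_X2 /= !out_inn /I_supp1 /I_supp2.
    case: ifP => // h; rewrite ifT; last by lia.
    by rewrite orbX_shift //; lia.
  case: ifP => // h; rewrite ifT; last by lia.
  by rewrite orbN_shift ?pN //; lia.
exists f => i l; rewrite fE /= out_inn /I_supp2 //.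
Qed.

(** Both homologies are spanned by the classes in the degrees of the interval, and
    [q] acts on these by signs. *)
Lemma Pmod_to_Imod_qis u0 v (q : dgmap (P (u0 + 1) v) (I (u0 + 1) v)) : u0 + 1 <= v ->
  (forall i m, i <= v -> out (q i m).2 = sign_at k (v - i) * out m.1) -> quasi_iso q.
Proof.
move=> uv qE.
have cI i (z : I (u0 + 1) v (i + 1)) : cycle z -> i <= u0 -> out z.2 = 0.
  move=> cz iu; have : out (dg_d _ i z).1 = 0 by rewrite cz out0.
  rewrite twoline_d1 ifT //; rewrite /I_supp1; lia.
split=> [i z cz [w zw]|i z cz].
  have [vi|iv] := leP v i; first exact: Pmod_exact.
  suff -> : z = 0 by apply: boundary0.
  move/(Pmod_cycleE _ uv): cz => z2; apply: twoline_ext; rewrite ?out0 //.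
  move/(congr1 (fun x : I (u0 + 1) v (i + 1) => out x.2)): zw.
  rewrite qE ?twoline_d2; last by lia.
  by move/eqP; rewrite mulf_eq0 (negbTE (sign_at_neq0 _ _)) => /eqP.
pose y : P (u0 + 1) v (i + 1) :=
  (inn (P_supp1 (u0 + 1) (i + 1)) ((sign_at k (v - (i + 1)))^-1 * out z.2), 0).
exists y; split; first by apply/(Pmod_cycleE _ uv); rewrite out0.
set w := z - _; have w2 : out w.2 = 0.
  rewrite /w /= outD outN.
  have [iv|vi] := leP (i + 1) v; last first.
    by rewrite !out_off ?subr0 // /I_supp2; lia.
  rewrite qE // out_inn.
  have [iu|ui] := leP i u0.
    by rewrite cI // mulr0 if_same mulr0 subr0.
  by rewrite /P_supp1 ifT ?mulrA ?mulfV ?mul1r ?subrr ?sign_at_neq0 //; lia.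
exists ((0, inn (I_supp2 v (i + 1 + 1)) (out w.1)) : I (u0 + 1) v (i + 1 + 1)).
apply: twoline_ext; rewrite ?twoline_d1 ?twoline_d2 //= out_inn.
have := @out_off _ _ w.1; move: (out w.1) => a; rewrite /I_supp1 /I_supp2.
by case: ifP => [h _|_ ->] //; rewrite ifT //; lia.
Qed.

Lemma brick_Pmod u v : u < v -> brick (P u v).
Proof.
move=> uv; have h0 : hid (P u v) <> hzero _ _.
  by apply: (@hom_map_neq0 _ u v u v _ (dgid _)) => //; lia.
by split=> // f; apply: (hom_span _ _ _ h0); lia.
Qed.

Lemma fin_homology_Pmod u v : u <= v -> fin_homology (P u v).
Proof.
move=> uv; split.
  exists (`|u| + `|v|) => i hi z cz.
  have [vi|iv] := leP v i; first exact: Pmod_exact.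
  suff -> : z = 0 by apply: boundary0.
  move/(Pmod_cycleE _ uv): cz => z2; apply: twoline_ext; rewrite ?out0 // out_off // /P_supp1.
  lia.
move=> i; pose e : P u v (i + 1) := (inn (P_supp1 u (i + 1)) 1, 0).
exists 1%N, (fun _ => e); split=> [_|z cz].
  by apply/(Pmod_cycleE _ uv); rewrite out0.
exists (fun _ => out z.1); rewrite big_ord1.
suff -> : z - out z.1 *: e = 0 by apply: boundary0.
move/(Pmod_cycleE _ uv): cz => z2; apply: twoline_ext => /=; rewrite outD outN outZ.
  rewrite out_inn; have := @out_off _ _ z.1; move: (out z.1) => a.
  by case: ifP => [_ _|_ ->] //; rewrite ?mulr1 ?mulr0 ?subrr ?out0.
by rewrite z2 !out0 mulr0 subrr.
Qed.

(** For a homology class [z] of maximal nilpotency order, the map from [Pmod] given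
    by [z] and the map to [Imod] given by a functional detecting the last
    multiple of [z] compose to a quasi-isomorphism, so an interval module is a
    direct summand of [L]. *)
Lemma Df_indecomposable L : indecomposable (@Df k) L ->
  exists u v, u < v /\ D_iso L (P u v).
Proof.
move=> [fL nL indL].
have [|u0 [v [z [uv cz nz bz bH]]]] := top_class fL.
  by move=> ac; apply: nL; apply: D_zero_acyclic.
exists (u0 + 1), v; split=> //.
have uv' : u0 + 1 <= v by lia.
have [|||phi [pl pb pz]] := @separating_functional _ (L v) (@boundary k L v) (orbX v z).
- exact: boundary0.
- by move=> c x y bx bY; apply: boundaryD => //; apply: boundaryZ.
- exact: nz.
have [y cy|f fE] := to_Imod uv' pl pb.
  apply: pb; rewrite orbN_orbX; last by lia.
  by apply/boundaryZ/bH.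
have [w ew] := bz.
have [g [g0 g1]] := Pmod_map uv' cz (esym ew).
have qfg : quasi_iso (f <.> g).
  apply: Pmod_to_Imod_qis => // i m iv.
  rewrite /= fE iv (Pmod_val uv' g) g0 g1 orbN_lin pl.
  have -> : out m.2 = 0 by apply: P_supp2_off; lia.
  rewrite scale0r linear0 (pb 0) ?addr0; last exact: boundary0.
  have [iu|ui] := leP i (u0 + 1); first by rewrite P_supp1_off // !mulr0 mul0r.
  rewrite orbN_orbX // orbX_orbX; try lia.
  have -> : sign_at k (v - i) *: orbX v z = sign_at k (v - i) *: orbX v z + 0 by rewrite addr0.
  by rewrite pl pz (pb 0) ?addr0 ?mulr1 1?mulrC //; apply: boundary0.
have [C [s qs]] := split_off qfg.
have LB : D_iso L (dsum (P (u0 + 1) v) C) by apply/D_iso_sym/(D_iso_qis qs).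
have fB := fin_homology_qis qs fL.
have [j [a b]] := dpair (dgzero C (P (u0 + 1) v)) (dgid C).
have fC : fin_homology C by apply: (fin_homology_retract b fB).
pose N (l : 'I_2) := if l == ord0 then P (u0 + 1) v else C.
have [i0 [i1 [e1 e2 e3 e4 e5]]] := dsum_biproduct (P (u0 + 1) v) C.
have dN : D_direct_sum (dsum (P (u0 + 1) v) C) N.
  apply: (@biproduct_cons _ _ N C _ i0 _ i1 _ e1 e2 e3 e4 e5).
  by apply: D_direct_sum1; apply: D_iso_refl.
have dL := D_direct_sum_iso LB dN.
have [|l Nl] := indL N _ dL.
  by move=> l; rewrite /N; case: ifP => _ //; apply: fin_homology_Pmod.
have [l0|l1] : l = ord0 \/ l = lift ord0 ord0.
  by case: l {Nl} => [[|[|l]] lt] //; [left | right]; apply: val_inj.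
  move: Nl; rewrite l0 /N /= => /D_zeroE zP.
  by have [] := brick_Pmod uv.
by apply: (@biproduct_zero _ _ N) dL _; rewrite -l1.
Qed.

End Classification.

(** * Interval modules indexed by arcs *)
Section Standard.
Variable k : fieldType.
Implicit Types (a b : int * int) (X Y A : dgmod k).

(** The arc [(m, n)] stands for the interval from [- n] to [- m - 2], so that the
    step [(m, n + 1)] enlarges it at the bottom, the step [(m + 1, n)] shortens it
    at the top, and the suspension shifts it up by one. *)
Definition std a : dgmod k := Pmod k (- a.2 - 1) (- a.1 - 2).

(** The translation of [hom_range] and [ext_range] into arcs. *)
Definition hom_arcs a b : Prop := [/\ a.1 <= b.1, b.1 <= a.2 - 2 & a.2 <= b.2].
Definition ext_arcs a b : Prop := [/\ b.1 <= a.1 - 2, a.1 <= b.2 & b.2 <= a.2 - 2].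

Lemma brick_std a : is_arc a -> brick (std a).
Proof. by rewrite /is_arc => h; apply: brick_Pmod; lia. Qed.

Lemma fin_homology_std a : is_arc a -> fin_homology (std a).
Proof. by rewrite /is_arc => h; apply: fin_homology_Pmod; lia. Qed.

Lemma std_zero a b (f : hom (std a) (std b)) : is_arc a -> is_arc b ->
  ~ hom_arcs a b -> ~ ext_arcs a b -> f = hzero _ _.
Proof.
rewrite /is_arc /hom_arcs /ext_arcs => aa ab nF nG; apply: hom_zero; try lia.
  by move=> [? ? ?]; apply: nF; split; lia.
by move=> [? ? ?]; apply: nG; split; lia.
Qed.

Lemma std_span a b (e f : hom (std a) (std b)) : is_arc a -> is_arc b ->
  e <> hzero _ _ -> exists c, f = hscale c e.
Proof. by rewrite /is_arc => aa ab; apply: hom_span; lia. Qed.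

(** The pattern ext-ext is left out: its composite lies in a second extension
    group, which is zero over a hereditary ring. *)
Definition composable a b c : Prop :=
  [\/ [/\ hom_arcs a b, hom_arcs b c & hom_arcs a c], [/\ ext_arcs a b, hom_arcs b c & ext_arcs a c] |
      [/\ hom_arcs a b, ext_arcs b c & ext_arcs a c]].

Lemma std_comp a b c : is_arc a -> is_arc b -> is_arc c -> composable a b c ->
  exists (g : hom (std a) (std b)) (h : hom (std b) (std c)), hcomp h g <> hzero _ _.
Proof.
rewrite /is_arc => aa ab ac.
have Fx x y : hom_arcs x y -> exists f : dgmap (std x) (std y), is_hom_map f.
  by case=> ? ? ?; apply: hom_map_ex; lia.
have Gx x y : ext_arcs x y -> exists f : dgmap (std x) (std y), is_ext_map f.
  by case=> ? ? ?; apply: ext_map_ex; lia.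
case=> -[].
- move=> /Fx [f Hf] /Fx [g Hg] [? ? ?]; exists (hof f), (hof g); rewrite -hof_comp.
  by apply: hom_map_neq0 (is_hom_hom Hg Hf) _; lia.
- move=> /Gx [f Hf] /Fx [g Hg] [? ? ?]; exists (hof f), (hof g); rewrite -hof_comp.
  by apply: ext_map_neq0 (is_hom_ext Hg Hf) _ _; lia.
- move=> /Fx [f Hf] /Gx [g Hg] [? ? ?]; exists (hof f), (hof g); rewrite -hof_comp.
  by apply: ext_map_neq0 (is_ext_hom Hg Hf) _ _; lia.
Qed.

Lemma composable_id a b : is_arc a -> hom_arcs a b \/ ext_arcs a b -> composable a a b.
Proof.
rewrite /is_arc /composable /hom_arcs /ext_arcs => aa [] [? ? ?]; [apply: Or31 | apply: Or33];
  split; split; lia.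
Qed.

Lemma std_nonzero a b : is_arc a -> is_arc b -> hom_arcs a b \/ ext_arcs a b ->
  exists f : hom (std a) (std b), f <> hzero _ _.
Proof.
move=> aa ab /(composable_id aa) /(std_comp aa aa ab) [g [h hg]].
by exists (hcomp h g).
Qed.

Section Transport.
Variables (X Y S S' : dgmod k).
Hypotheses (XS : D_iso X S) (YS : D_iso Y S').

Lemma transport_hom : exists (phi : hom S S' -> hom X Y) (psi : hom X Y -> hom S S'),
  (forall f, phi (psi f) = f) /\ forall c f, phi (hscale c f) = hscale c (phi f).
Proof.
move: XS YS => /D_isoE [f [g [gf fg]]] /D_isoE [f' [g' [gf' fg']]].
exists (fun x => hcomp g' (hcomp x f)), (fun x => hcomp f' (hcomp x g)); split=> [x|c x].
  by rewrite -!hcompA gf hcomp1r hcompA gf' hcomp1l.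
by rewrite hcompZl hcompZr.
Qed.

Lemma transport_zero : (forall f : hom S S', f = hzero _ _) ->
  forall f : hom X Y, f = hzero _ _.
Proof.
have [phi [psi [pp pZ]]] := transport_hom.
by move=> z f; rewrite -(pp f) (z (psi f)) -(hscale0 (hzero _ _)) pZ hscale0.
Qed.

Lemma transport_span :
  (forall e f : hom S S', e <> hzero _ _ -> exists c, f = hscale c e) ->
  forall e f : hom X Y, e <> hzero _ _ -> exists c, f = hscale c e.
Proof.
have [phi [psi [pp pZ]]] := transport_hom.
move=> sp e f e0; have [|c cE] := sp (psi e) (psi f).
  by move=> z; apply: e0; rewrite -(pp e) z -(hscale0 (hzero _ _)) pZ hscale0.
by exists c; rewrite -(pp f) cE pZ pp.
Qed.
End Transport.

(** Isomorphic objects have the same nonzero morphisms to every third object.  If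
    the left endpoints differ, a very long arc starting at the smaller one
    distinguishes the objects; otherwise the shorter arc itself does. *)
Lemma std_inj a b : is_arc a -> is_arc b -> D_iso (std a) (std b) -> a = b.
Proof.
move=> aa ab iab.
have H x y d : is_arc x -> is_arc y -> is_arc d -> D_iso (std x) (std y) ->
    hom_arcs x d -> ~ hom_arcs y d -> ext_arcs y d.
  move=> ax ay ad ixy Fxd nF; apply: contrapT => nG.
  have [f f0] := std_nonzero ax ad (or_introl Fxd); apply: f0.
  by apply: (transport_zero ixy (D_iso_refl _)) => f'; apply: std_zero.
have iba := D_iso_sym iab.
(* Larger than every endpoint of [a] and [b]. *)
pose N := `|a.1| + `|a.2| + `|b.1| + `|b.2| + 2.
have := H a b (a.1, N) aa ab _ iab; have := H b a (b.1, N) ab aa _ iba.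
have := H a b a aa ab aa iab; have := H b a b ab aa ab iba.
rewrite /is_arc /hom_arcs /ext_arcs /= in aa ab * => h1 h2 h3 h4.
have e1 : a.1 = b.1.
  have [l|l|//] := ltgtP a.1 b.1.
    by case: h4; rewrite /N; try (split; lia); try (case; lia); lia.
  by case: h3; rewrite /N; try (split; lia); try (case; lia); lia.
have e2 : a.2 = b.2.
  have [l|l|//] := ltgtP a.2 b.2.
    by case: h2; try (split; lia); try (case; lia); lia.
  by case: h1; try (split; lia); try (case; lia); lia.
by case: a b e1 e2 {aa ab iab iba N h1 h2 h3 h4} => ? ? [? ?] /= -> ->.
Qed.

(** The composite [h g] spans the morphisms from [X] to [Y]. *)
Lemma rad2_factor (T : subcat k) X A Y (g : hom X A) (h : hom A Y) :
  brick X -> brick A -> brick Y -> ~ D_iso X A -> ~ D_iso A Y -> T A ->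
  (forall e f : hom X Y, e <> hzero _ _ -> exists c, f = hscale c e) ->
  hcomp h g <> hzero _ _ -> forall f : hom X Y, hrad2 T f.
Proof.
move=> bX bA bY XA AY TA sp hg f; have [c ->] := sp _ f hg.
by rewrite -hcompZl; apply: hrad2_comp => //; apply: brick_rad.
Qed.

Lemma brick_rad_iso X Y (f : hom X Y) : D_iso X Y -> brick X -> hrad f -> f = hzero _ _.
Proof.
move=> /D_isoE [u [v [vu uv]]] bX rf.
have := brick_rad0 bX (hrad_compl v rf).
by move/(congr1 (hcomp u)); rewrite hcompA uv hcomp1l hcomp0r.
Qed.

(** A step to [(m, n + 1)] or to [(m + 1, n)] can be taken first. *)
Lemma not_step_factor a b : is_arc a -> is_arc b -> hom_arcs a b \/ ext_arcs a b -> a <> b ->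
  ~ ZA_step a b -> exists c, [/\ is_arc c, c <> a, c <> b & composable a c b].
Proof.
move=> aa ab h nab ns.
have {}ns : ~ (b.1 = a.1 /\ b.2 = a.2 + 1) /\ ~ (b.1 = a.1 + 1 /\ b.2 = a.2).
  split=> -[e1 e2]; apply: ns; [left|right].
    by case: b e1 e2 {ab h nab} => ? ? /= -> ->.
  by case: b e1 e2 {ab h nab} => ? ? /= -> ->.
have {}nab : ~ (a.1 = b.1 /\ a.2 = b.2).
  by move=> [e1 e2]; apply: nab; case: a b e1 e2 {aa ab h ns} => ? ? [? ?] /= -> ->.
have neq (x y : int * int) : x.1 != y.1 \/ x.2 != y.2 -> x <> y.
  by move=> + e; rewrite e !eqxx; case.
rewrite /is_arc in aa ab *.
case: h => [] [h1 h2 h3].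
  have [b2|b2] := ltP a.2 b.2.
    exists (a.1, a.2 + 1); split; [by rewrite /=; lia | | |].
    - by apply: neq; right => /=; lia.
    - by apply: neq => /=; lia.
    - by apply: Or31; split; split => /=; lia.
  exists (a.1 + 1, a.2); split; [by rewrite /=; lia | | |].
  - by apply: neq; left => /=; lia.
  - by apply: neq => /=; lia.
  - by apply: Or31; split; split => /=; lia.
exists (a.1, a.2 + 1); split; [by rewrite /=; lia | | |].
- by apply: neq; right => /=; lia.
- by apply: neq => /=; lia.
- by apply: Or33; split; split => /=; lia.
Qed.

Lemma Df_not_step_rad2 a b X Y : is_arc a -> is_arc b ->
  D_iso X (std a) -> D_iso Y (std b) -> ~ ZA_step a b ->
  forall f : hom X Y, hrad f -> hrad2 (@Df k) f.
Proof.
move=> aa ab Xa Yb ns f rf.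
have bX : brick X by apply: brick_iso (brick_std aa); apply: D_iso_sym.
have bY : brick Y by apply: brick_iso (brick_std ab); apply: D_iso_sym.
have [e|nab] := pselect (a = b).
  rewrite (brick_rad_iso _ bX rf); first exact: hrad2_zero.
  by apply: D_iso_trans Xa _; rewrite e; apply: D_iso_sym.
have [ne|z] := pselect (hom_arcs a b \/ ext_arcs a b); last first.
  have -> : f = hzero _ _; last exact: hrad2_zero.
  apply: (transport_zero Xa Yb) => f'.
  by apply: std_zero => // h; apply: z; [left|right].
have [c [ac ca cb cmp]] := not_step_factor aa ab ne nab ns.
have [g [h hg]] := std_comp aa ac ab cmp.
move: (Xa) (Yb) => /D_isoE [x [x' [x'x xx']]] /D_isoE [y [y' [y'y yy']]].
apply: (@rad2_factor _ X (std c) Y (hcomp g x) (hcomp y' h)) => //.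
- exact: brick_std.
- move=> Xc; apply: ca; apply: std_inj => //.
  by apply: D_iso_trans (D_iso_sym Xc) Xa.
- move=> cY; apply: cb; apply: std_inj => //; exact: D_iso_trans cY Yb.
- exact: fin_homology_std.
- by apply: (transport_span Xa Yb) => e e'; apply: std_span.
- move=> E; apply: hg; rewrite -[hcomp h g]hcomp1l -yy' -[g]hcomp1r -xx'.
  by rewrite -!hcompA (hcompA y') (hcompA g) (hcompA (hcomp y' h)) E hcomp0l hcomp0r.
Qed.

End Standard.

(** * Rigidity of the Auslander-Reiten quiver *)
Lemma shift_const (g : int -> int) :
  (forall m, g (m + 1) = g m + 1) -> forall m, g m = m + g 0.
Proof.
move=> gS m; have [m0|m0] := leP 0 m.
  move: m m0; apply: int_ge_ind => [|i i0 IH]; first by rewrite add0r.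
  by rewrite gS IH addrAC.
have H (n : nat) : g (- n%:Z) = - n%:Z + g 0.
  elim: n => [|n IH]; first by rewrite oppr0 add0r.
  have := gS (- n.+1%:Z); rewrite (_ : - n.+1%:Z + 1 = - n%:Z); last by lia.
  by rewrite IH; move: (g _) (g 0) => x y; lia.
by have := H `|m|%N; rewrite (_ : - (`|m|%N)%:Z = m) //; lia.
Qed.

(** In the quiver, the shortest arcs have one outgoing arrow and all others have
    two.  A bijection preserving arrows cannot send an arc with two outgoing
    arrows to one of the shortest, so every shortest arc is the image of a shortest
    arc; following the arrows from these shows that it is a translation. *)
Section Rigidity.
Variables (s r : int * int -> int * int).
Hypothesis sA : forall a, is_arc a -> is_arc (s a).
Hypothesis rA : forall a, is_arc a -> is_arc (r a).
Hypothesis srK : forall a, is_arc a -> s (r a) = a.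
Hypothesis rsK : forall a, is_arc a -> r (s a) = a.
Hypothesis s_step : forall a b, is_arc a -> is_arc b -> ZA_step a b -> ZA_step (s a) (s b).

Let up a : is_arc a -> is_arc (a.1, a.2 + 1). Proof. rewrite /is_arc /=; lia. Qed.

Lemma pairP (a b : int * int) : a.1 = b.1 -> a.2 = b.2 -> a = b.
Proof. by case: a b => ? ? [? ?] /= -> ->. Qed.

Lemma s_inj a b : is_arc a -> is_arc b -> s a = s b -> a = b.
Proof. by move=> aa ab e; rewrite -(rsK aa) e rsK. Qed.

Lemma r_boundary m : (r (m, m + 2)).2 = (r (m, m + 2)).1 + 2.
Proof.
set a := r _; have am : is_arc (m, m + 2) by rewrite /is_arc /=; lia.
have aa : is_arc a by apply: rA.
have sa : s a = (m, m + 2) by apply: srK.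
have [//|lt] : a.2 = a.1 + 2 \/ a.1 + 3 <= a.2 by move: aa; rewrite /is_arc; lia.
have a1 : is_arc (a.1 + 1, a.2) by rewrite /is_arc /=; lia.
have E b : is_arc b -> ZA_step a b -> s b = (m, m + 3).
  move=> ab st; have := s_step aa ab st; have := sA ab; rewrite sa /is_arc.
  by move=> h [] e; rewrite e /= in h *; [congr pair; lia | lia].
have := s_inj (up aa) a1; rewrite (E _ (up aa)) ?(E _ a1); [|by right|by left].
by move=> /(_ erefl) [] /=; lia.
Qed.

(** The arcs [(m, m + 2)] and [(m + 1, m + 3)] are joined by a path of two arrows
    through [(m, m + 3)], whose second arrow returns to the shortest arcs. *)
Lemma r_shift m : r (m + 1, m + 1 + 2) = ((r (m, m + 2)).1 + 1, (r (m, m + 2)).2 + 1).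
Proof.
have am i : is_arc (i, i + 2) by rewrite /is_arc /=; lia.
set a := r (m, m + 2); have aa : is_arc a by apply: rA.
have a2 : a.2 = a.1 + 2 by apply: r_boundary.
have sa : s a = (m, m + 2) by apply: srK.
have sb : s (a.1, a.2 + 1) = (m, m + 3).
  have := s_step aa (up aa) (or_introl erefl); have := sA (up aa); rewrite sa /is_arc.
  by move=> h [] e; rewrite e /= in h *; [congr pair; lia | lia].
have c1 : is_arc (a.1 + 1, a.2 + 1) by move: aa; rewrite /is_arc /=; lia.
have c2 : is_arc (a.1, a.2 + 1 + 1) by move: aa; rewrite /is_arc /=; lia.
have s1 := s_step (up aa) c1 (or_intror erefl).
have s2 := s_step (up aa) c2 (or_introl erefl).
rewrite sb in s1 s2.
suff E : s (a.1 + 1, a.2 + 1) = (m + 1, m + 1 + 2) by rewrite -E rsK.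
case: s1 => e1; last by rewrite e1 /=; congr pair; lia.
case: s2 => e2.
  by have := s_inj c1 c2; rewrite e1 e2 => /(_ erefl) [] /=; lia.
have := r_boundary (m + 1); have := rsK c2.
rewrite e2 /= (_ : m + 3 = m + 1 + 2); last by lia.
by move=> -> /=; lia.
Qed.

(** Induction on length: of the two arrows leaving an arc, one leads to an arc with
    the same left endpoint, one longer, and the other to a shorter arc whose image
    is known; injectivity determines the first. *)
Lemma s_translation : exists c, forall a, is_arc a -> s a = (a.1 - c, a.2 - c).
Proof.
pose g m := (r (m, m + 2)).1; exists (g 0).
have gS m : g (m + 1) = g m + 1 by rewrite /g r_shift.
have gE := shift_const gS.
have am i (n : nat) : is_arc (i, i + 2 + n%:Z) by rewrite /is_arc /=; lia.
have main (n : nat) m : s (m + g 0, m + g 0 + 2 + n%:Z) = (m, m + 2 + n%:Z).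
  elim/ltn_ind: n m => -[|n] IH m.
    rewrite !addr0 -[RHS]srK; last by rewrite /is_arc /=; lia.
    congr s; apply: pairP => /=; first by rewrite -gE.
    by rewrite r_boundary -/(g m) (gE m).
  have IHn := IH n (ltnSn n) m.
  have st : ZA_step (m + g 0, m + g 0 + 2 + n%:Z) (m + g 0, m + g 0 + 2 + n.+1%:Z).
    by left => /=; congr pair; lia.
  have := s_step (am _ n) (am _ n.+1) st; rewrite IHn => -[] /= E.
    by rewrite E; congr pair; lia.
  case: n IH IHn st E => [|n] IH IHn st E.
    by have := sA (am (m + g 0) 1%N); rewrite E /is_arc /=; lia.
  have IHn' := IH n ltac:(lia) (m + 1).
  exfalso; have := s_inj (am (m + g 0) n.+2) (am (m + 1 + g 0) n).
  rewrite E IHn' => H.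
  have e : (m + 1, m + 2 + n.+1%:Z) = (m + 1, m + 1 + 2 + n%:Z) by congr pair; lia.
  by case: (H e); move: (g 0); lia.
move=> a aa; move: (aa); rewrite /is_arc => h.
have := main `|(a.2 - a.1 - 2)%R|%N (a.1 - g 0).
rewrite (_ : (_, _) = a); last by apply: pairP => /=; lia.
by move=> ->; apply: pairP => /=; lia.
Qed.

End Rigidity.

(** * Objects given by a coordinate system *)
Section Coordinates.
Variables (k : fieldType) (coord : int * int -> dgmod k).
Hypothesis coordP : is_coordinate_system coord.

Lemma has_card_inhabited (A : Type) n : has_card A n -> A -> exists m, n = m.+1.
Proof.
case: n => [|n] [f [g fK gK]] x; last by exists n.
by case: (g x).
Qed.

Lemma coord_indecomposable a : is_arc a -> indecomposable (@Df k) (coord a).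
Proof. by move=> aa; case: coordP => [[h _ _ _] _]; apply: (h (exist _ a aa)). Qed.

Lemma coord_inj a b : is_arc a -> is_arc b -> D_iso (coord a) (coord b) -> a = b.
Proof.
move=> aa ab ab_iso; case: coordP => [[_ h _ _] _].
by have /(congr1 sval) := h (exist _ a aa) (exist _ b ab) ab_iso.
Qed.

Lemma coord_surj M : indecomposable (@Df k) M -> exists2 a, is_arc a & D_iso M (coord a).
Proof.
by move=> iM; case: coordP => [[_ _ h _] _]; have [[a aa] ?] := h M iM; exists a.
Qed.

(** An arrow of the Auslander-Reiten quiver is an irreducible morphism. *)
Lemma coord_step a b : is_arc a -> is_arc b -> ZA_step a b ->
  exists2 f : hom (coord a) (coord b), hrad f & ~ hrad2 (@Df k) f.
Proof.
move=> aa ab st; case: coordP => [[_ _ _ h] _].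
have [n [cn irr]] := h (exist _ a aa) (exist _ b ab).
pose p : arrow ZA_infty := exist _ (exist _ a aa, exist _ b ab) st.
have [m e] := has_card_inhabited cn (exist _ p (conj erefl erefl)).
by subst; apply: irr_dim_pos irr.
Qed.

(** Indecomposable objects are interval modules and conversely, whence a bijection
    [s] of the set of arcs with itself; it preserves steps, because a morphism
    between interval modules that are not one step apart is in the square of the
    radical. *)
Lemma coord_std : exists c, forall a, is_arc a ->
  D_iso (coord a) (std k (a.1 - c, a.2 - c)).
Proof.
have [s sP] : exists s : int * int -> int * int, forall a, is_arc a ->
    is_arc (s a) /\ D_iso (coord a) (std k (s a)).
  suff /choice [f fP] : forall a, exists b, is_arc a -> is_arc b /\ D_iso (coord a) (std k b) by exists f.
  move=> a; have [aa|na] := pselect (is_arc a); last by exists a.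
  have [u [v [uv i]]] := Df_indecomposable (coord_indecomposable aa).
  exists (- v - 2, - u - 1) => _; split; first by rewrite /is_arc /=; lia.
  have eu : - (- u - 1) - 1 = u by lia.
  have ev : - (- v - 2) - 2 = v by lia.
  by rewrite /std /= eu ev; exact: i.
have [r rP] : exists r : int * int -> int * int, forall a, is_arc a ->
    is_arc (r a) /\ D_iso (std k a) (coord (r a)).
  suff /choice [f fP] : forall a, exists b, is_arc a -> is_arc b /\ D_iso (std k a) (coord b) by exists f.
  move=> a; have [aa|na] := pselect (is_arc a); last by exists a.
  have [|b ab i] := @coord_surj (std k a); last by exists b.
  by apply: brick_indecomposable; [apply: fin_homology_std | apply: brick_std].
have sA a (h : is_arc a) := (sP a h).1; have rA a (h : is_arc a) := (rP a h).1.
have srK a : is_arc a -> s (r a) = a.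
  move=> aa; apply: (@std_inj k) => //; first by apply/sA/rA.
  apply: D_iso_trans (D_iso_sym (sP _ (rA _ aa)).2) _.
  exact: D_iso_sym (rP _ aa).2.
have rsK a : is_arc a -> r (s a) = a.
  move=> aa; apply: coord_inj => //; first by apply/rA/sA.
  apply: D_iso_trans (D_iso_sym (rP _ (sA _ aa)).2) _.
  exact: D_iso_sym (sP _ aa).2.
have s_step a b : is_arc a -> is_arc b -> ZA_step a b -> ZA_step (s a) (s b).
  move=> aa ab st; apply: contrapT => ns.
  have [f rf nf] := coord_step aa ab st; apply: nf.
  exact: (Df_not_step_rad2 (sA _ aa) (sA _ ab) (sP _ aa).2 (sP _ ab).2 ns).
have [c cE] := s_translation sA rA srK rsK s_step.
by exists c => a aa; rewrite -cE //; apply: (sP _ aa).2.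
Qed.

Lemma coord_brick a : is_arc a -> brick (coord a).
Proof.
move=> aa; have [c cP] := coord_std.
apply: brick_iso (D_iso_sym (cP _ aa)) _; apply: brick_std.
by move: aa; rewrite /is_arc /=; lia.
Qed.

Let shift_arc c (a : int * int) : is_arc a -> is_arc (a.1 - c, a.2 - c).
Proof. by rewrite /is_arc /=; lia. Qed.

Let shift_hom c a b : hom_arcs (a.1 - c, a.2 - c) (b.1 - c, b.2 - c) <-> hom_arcs a b.
Proof. by rewrite /hom_arcs /=; split=> -[? ? ?]; split; lia. Qed.

Let shift_ext c a b : ext_arcs (a.1 - c, a.2 - c) (b.1 - c, b.2 - c) <-> ext_arcs a b.
Proof. by rewrite /ext_arcs /=; split=> -[? ? ?]; split; lia. Qed.

Lemma coord_zero a b (f : hom (coord a) (coord b)) : is_arc a -> is_arc b ->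
  ~ (hom_arcs a b \/ ext_arcs a b) -> f = hzero _ _.
Proof.
move=> aa ab ne; have [c cP] := coord_std.
apply: (transport_zero (cP _ aa) (cP _ ab)) => f'.
apply: std_zero; try exact: shift_arc.
  by move/shift_hom => h; apply: ne; left.
by move/shift_ext => h; apply: ne; right.
Qed.

Lemma coord_span a b (e f : hom (coord a) (coord b)) : is_arc a -> is_arc b ->
  e <> hzero _ _ -> exists c, f = hscale c e.
Proof.
move=> aa ab; have [c cP] := coord_std.
apply: (transport_span (cP _ aa) (cP _ ab)) => e' f'.
by apply: std_span; apply: shift_arc.
Qed.

Lemma coord_comp a b d : is_arc a -> is_arc b -> is_arc d -> composable a b d ->
  exists (g : hom (coord a) (coord b)) (h : hom (coord b) (coord d)),
    hcomp h g <> hzero _ _.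
Proof.
move=> aa ab ad cmp; have [c cP] := coord_std.
have [||||g [h hg]] := @std_comp k (a.1 - c, a.2 - c) (b.1 - c, b.2 - c) (d.1 - c, d.2 - c).
- exact: shift_arc.
- exact: shift_arc.
- exact: shift_arc.
- case: cmp => -[h1 h2 h3]; [apply: Or31 | apply: Or32 | apply: Or33];
    by split; (apply/shift_hom || apply/shift_ext).
move: (cP _ aa) (cP _ ab) (cP _ ad) => /D_isoE [x [x' [x'x xx']]].
move=> /D_isoE [y [y' [y'y yy']]] /D_isoE [z [z' [z'z zz']]].
exists (hcomp y' (hcomp g x)), (hcomp z' (hcomp h y)) => E; apply: hg.
rewrite -[hcomp h g]hcomp1l -[hcomp h g]hcomp1r -zz' -xx' -[g]hcomp1l -yy'.
transitivity (hcomp z (hcomp (hcomp (hcomp z' (hcomp h y)) (hcomp y' (hcomp g x))) x')).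
  by rewrite !hcompA.
by rewrite E hcomp0l hcomp0r.
Qed.

Lemma coord_nonzero a b : is_arc a -> is_arc b -> hom_arcs a b \/ ext_arcs a b ->
  exists f : hom (coord a) (coord b), f <> hzero _ _.
Proof.
move=> aa ab /(composable_id aa) /(coord_comp aa aa ab) [g [h hg]].
by exists (hcomp h g).
Qed.

End Coordinates.

(** * Triangulations *)
Section Triangulations.
Variable t : set (int * int).
Hypothesis tP : triangulation t.

Lemma t_arc a : t a -> is_arc a.
Proof. by case: tP => [[h _] _]; apply: h. Qed.

Lemma edge_noncrossing a e : edge t a -> edge t e -> ~ crossing a e.
Proof.
move=> [ta|sa] [te|se]; rewrite /crossing; try by move: sa; rewrite /is_side; lia.
  by case: tP => [[_ h] _]; apply: h.
by move: se; rewrite /is_side; lia.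
Qed.

(** By maximality: adding an arc that is crossed by no arc of [t] would give a
    larger set of pairwise noncrossing arcs. *)
Lemma crossed_or_edge i j : i < j -> edge t (i, j) \/ exists2 b, t b & crossing b (i, j).
Proof.
move=> ij; have [s|ns] := eqVneq j (i + 1); first by left; right.
have aa : is_arc (i, j) by move: ns; rewrite /is_arc /=; lia.
have [ex|nex] := pselect (exists2 b, t b & crossing b (i, j)); first by right.
left; left; case: tP => [[tA tN] tM].
have <- : [set a | t a \/ a = (i, j)]%classic = t.
  apply: tM; last by move=> a ta; left.
  split=> [a [/tA //|-> //]|a b [ta|->] [tb|->]].
  - exact: tN.
  - by move=> c; apply: nex; exists a.
  - by move=> c; apply: nex; exists b => //; move: c; rewrite /crossing /=; lia.
  - by rewrite /crossing /=; lia.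
by right.
Qed.

(** The arrows of the exchange quiver between mutable vertices, described by the
    third edge of their triangle: the arrow goes from [(i, j)] to [(i, k)], from
    [(i, k)] to [(j, k)], or from [(j, k)] to [(i, j)]. *)
Definition qarrow (a b : int * int) : Prop :=
  [\/ [/\ a.1 = b.1, a.2 < b.2 & edge t (a.2, b.2)],
      [/\ a.2 = b.2, a.1 < b.1 & edge t (a.1, b.1)] |
      [/\ b.2 = a.1 & edge t (b.1, a.2)]].

Lemma qarrow_hom a b : t a -> t b -> qarrow a b -> a <> b /\ (hom_arcs a b \/ ext_arcs a b).
Proof.
move=> /t_arc aa /t_arc ab; rewrite /is_arc /hom_arcs /ext_arcs in aa ab *.
have ne : a.1 <> b.1 \/ a.2 <> b.2 -> a <> b by move=> + e; rewrite e; case.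
case=> [[e1 e2 _]|[e1 e2 _]|[e1 _]]; (split; first by apply: ne; lia).
- by left; split; lia.
- by left; split; lia.
- by right; split; lia.
Qed.

(** Such an arc [c] would have the common endpoint of [a] and [b] as an endpoint and
    lie between them around it, so it would cross the third edge. *)
Lemma qarrow_no_middle a b c : t a -> t b -> t c -> qarrow a b -> c <> a -> c <> b ->
  hom_arcs a c \/ ext_arcs a c -> hom_arcs c b \/ ext_arcs c b -> False.
Proof.
move=> ta tb tc q ca cb h1 h2.
have {}ca : c.1 <> a.1 \/ c.2 <> a.2.
  by apply: contrapT => h; apply: ca; apply: pairP; lia.
have {}cb : c.1 <> b.1 \/ c.2 <> b.2.
  by apply: contrapT => h; apply: cb; apply: pairP; lia.
have x1 := edge_noncrossing (or_introl tc) (or_introl ta).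
have x2 := edge_noncrossing (or_introl tc) (or_introl tb).
have := t_arc ta; have := t_arc tb; have := t_arc tc.
rewrite /is_arc; move: x1 x2; rewrite /crossing.
case: q => [[e1 e2 /(edge_noncrossing (or_introl tc))]|
  [e1 e2 /(edge_noncrossing (or_introl tc))]|[e1 /(edge_noncrossing (or_introl tc))]];
  rewrite /crossing /=; case: h1 h2 => [] [? ? ?] [] [? ? ?]; lia.
Qed.

(** The third edge is missing, so an arc [c] of [t] crosses it.  As [c] crosses
    neither [a] nor [b], it has their common endpoint as an endpoint, and lies
    between them around it. *)
Lemma not_qarrow_middle a b : t a -> t b -> ~ qarrow a b -> a <> b ->
  hom_arcs a b \/ ext_arcs a b -> exists c, [/\ t c, c <> a, c <> b & composable a c b].
Proof.
move=> ta tb nq ab h.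
have {}ab : ~ (a.1 = b.1 /\ a.2 = b.2) by move=> [? ?]; apply: ab; apply: pairP.
have x0 := edge_noncrossing (or_introl ta) (or_introl tb).
have := t_arc ta; have := t_arc tb; rewrite /is_arc => ab1 aa1.
have mid (i j : int) : i < j -> ~ edge t (i, j) ->
    (forall c : int * int, c.1 <= c.2 - 2 -> ~ crossing c a -> ~ crossing c b -> crossing c (i, j) ->
      [/\ ~ (c.1 = a.1 /\ c.2 = a.2), ~ (c.1 = b.1 /\ c.2 = b.2) & composable a c b]) ->
    exists c, [/\ t c, c <> a, c <> b & composable a c b].
  move=> ij ne H; case: (crossed_or_edge ij) => // -[c tc cr].
  have [|||n1 n2 cm] := H c _ _ _ cr.
  - exact: t_arc.
  - exact: edge_noncrossing (or_introl tc) (or_introl ta).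
  - exact: edge_noncrossing (or_introl tc) (or_introl tb).
  exists c; split=> // e; [apply: n1 | apply: n2]; by rewrite e.
move: x0; rewrite /crossing => x0.
case: h => [] [h1 h2 h3].
  have [[e1 e2]|[e1 e2]] : (a.1 = b.1 /\ a.2 < b.2) \/ (a.2 = b.2 /\ a.1 < b.1) by lia.
    apply: (mid a.2 b.2) => // [e|c ac]; first by apply: nq; apply: Or31.
    rewrite /crossing /= => c1 c2 c3.
    by split; [lia | lia | apply: Or31; split; split; lia].
  apply: (mid a.1 b.1) => // [e|c ac]; first by apply: nq; apply: Or32.
  rewrite /crossing /= => c1 c2 c3.
  by split; [lia | lia | apply: Or31; split; split; lia].
have e1 : b.2 = a.1 by lia.
apply: (mid b.1 a.2); [by lia | by move=> e; apply: nq; apply: Or33 | move=> c ac].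
rewrite /crossing /= => c1 c2 c3; split; [lia | lia |].
have [c0|c0] := ltP c.1 b.1; [apply: Or32 | apply: Or33]; split; split; lia.
Qed.

End Triangulations.

(** * The subcategory of a triangulation *)
Section ArcSubcategory.
Variables (k : fieldType) (coord : int * int -> dgmod k).
Hypothesis coordP : is_coordinate_system coord.
Variable t : set (int * int).
Hypothesis tP : triangulation t.
Local Notation T := (arc_subcat coord t).

Lemma coord_in_T a : t a -> T (coord a).
Proof.
move=> ta; split; first by case: (coord_indecomposable coordP (t_arc tP ta)).
by exists 1%N, (fun _ => a); split=> //; apply: D_direct_sum1; apply: D_iso_refl.
Qed.

Lemma T_indecomposable_coord a : t a -> indecomposable T (coord a).
Proof.
move=> ta; apply: brick_indecomposable; first exact: coord_in_T.
by apply: coord_brick => //; apply: t_arc ta.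
Qed.

(** Separate the first summand from the sum [R] of the others: one of the two is
    zero, and it is not the first. *)
Lemma T_indecomposable M : indecomposable T M -> exists2 a, t a & D_iso M (coord a).
Proof.
move=> [[fM [n [a [ta dM]]]] nz indM].
case: n a ta dM => [|n] a ta dM.
  case: nz; apply/D_zeroE; move/D_direct_sumE: dM => [i [p [_ _ <-]]].
  by rewrite /hsum big_ord0.
have [|R [fR dR]] := @D_direct_sum_ex _ n (fun l => coord (a (lift ord0 l))).
  by move=> l; case: (coord_in_T (ta (lift ord0 l))).
exists (a ord0); first exact: ta.
pose N (l : 'I_2) := if l == ord0 then coord (a ord0) else R.
have [i0 [i1 [e1 e2 e3 e4 e5]]] := dsum_biproduct (coord (a ord0)) R.
have dB : D_direct_sum (dsum (coord (a ord0)) R) (fun l => coord (a l)).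
  exact: (@biproduct_cons _ _ (fun l => coord (a l)) R _ i0 _ i1 _ e1 e2 e3 e4 e5).
have dB2 : D_direct_sum (dsum (coord (a ord0)) R) N.
  apply: (@biproduct_cons _ _ N R _ i0 _ i1 _ e1 e2 e3 e4 e5).
  by apply: D_direct_sum1; apply: D_iso_refl.
have dM2 := D_direct_sum_iso (D_direct_sum_uniq dM dB) dB2.
have [|l Nl] := indM N _ dM2.
  move=> l; rewrite /N; case: ifP => _; first exact: coord_in_T.
  by split=> //; exists n, (fun l => a (lift ord0 l)).
have [l0|l1] : l = ord0 \/ l = lift ord0 ord0.
  by case: l {Nl} => [[|[|l]] lt] //; [left | right]; apply: val_inj.
  move: Nl; rewrite l0 /N /= => /D_zeroE z.
  by have [] := coord_brick coordP (t_arc tP (ta ord0)).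
by apply: (@biproduct_zero _ _ N) dM2 _; rewrite -l1.
Qed.

(** The morphism from [a] to [b] is irreducible: by [rad_comp_sum0] a sum of radical
    composites reduces to composites through arcs of [t], and those vanish by
    [qarrow_no_middle]. *)
Lemma irr_dim_arrow a b : t a -> t b -> qarrow t a b -> irr_dim T (coord a) (coord b) 1.
Proof.
move=> ta tb q; have aa := t_arc tP ta; have ab := t_arc tP tb.
have [nab ne] := qarrow_hom tP ta tb q.
have [e e0] := coord_nonzero coordP aa ab ne.
have ba := coord_brick coordP aa; have bb := coord_brick coordP ab.
have niso x y : is_arc x -> is_arc y -> x <> y -> ~ D_iso (coord x) (coord y).
  by move=> ax ay xy /(coord_inj coordP ax ay).
apply: (irr_dim1 (e := e)) => //.
- by apply: brick_rad => //; apply: niso.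
- by move=> f; apply: coord_span.
move=> f [n [L [g [h [gh ->]]]]]; apply: hsum0 => l.
have [[_ [m [c [tc dL]]]] rg rh] := gh l.
apply: (rad_comp_sum0 dL) => // j.
have [->|ca] := pselect (c j = a); first by apply: Or31.
have [->|cb] := pselect (c j = b); first by apply: Or32.
apply: Or33 => u v; have ac := t_arc tP (tc j).
have [h1|h1] := pselect (hom_arcs a (c j) \/ ext_arcs a (c j)); last first.
  by rewrite (coord_zero coordP u aa ac h1) hcomp0r.
have [h2|h2] := pselect (hom_arcs (c j) b \/ ext_arcs (c j) b); last first.
  by rewrite (coord_zero coordP v ac ab h2) hcomp0l.
by case: (qarrow_no_middle tP ta tb (tc j) q ca cb h1 h2).
Qed.

Lemma irr_dim_no_arrow a b : t a -> t b -> ~ qarrow t a b ->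
  irr_dim T (coord a) (coord b) 0.
Proof.
move=> ta tb nq; have aa := t_arc tP ta; have ab := t_arc tP tb.
have ba := coord_brick coordP aa; have bb := coord_brick coordP ab.
apply: irr_dim0 => f rf.
have [e|nab] := pselect (a = b).
  rewrite (brick_rad_iso _ ba rf); first exact: hrad2_zero.
  by rewrite e; apply: D_iso_refl.
have [ne|z] := pselect (hom_arcs a b \/ ext_arcs a b); last first.
  by rewrite (coord_zero coordP f aa ab z); apply: hrad2_zero.
have [c [tc ca cb cmp]] := not_qarrow_middle tP ta tb nq nab ne.
have ac := t_arc tP tc.
have [g [h hg]] := coord_comp coordP aa ac ab cmp.
apply: (rad2_factor ba (coord_brick coordP ac) bb _ _ (coord_in_T tc) _ hg).
- by move=> /(coord_inj coordP aa ac) e; apply: ca.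
- by move=> /(coord_inj coordP ac ab).
- by move=> e e'; apply: coord_span.
Qed.

End ArcSubcategory.

(** * Arrows of the exchange quiver *)
Section ExchangeQuiverArrows.
Variable t : set (int * int).
Hypothesis tP : triangulation t.

Lemma triangle_eq (x y : triangle t) :
  tri_i x = tri_i y -> tri_j x = tri_j y -> tri_k x = tri_k y -> x = y.
Proof.
case: x y => i j l p1 p2 e1 e2 e3 [i' j' l' p1' p2' e1' e2' e3'] /= hi hj hl; subst.
by congr Triangle; apply: Prop_irrelevance.
Qed.

Lemma sval_inj (A : Type) (Q : A -> Prop) (x y : {a | Q a}) : sval x = sval y -> x = y.
Proof.
case: x y => a p [b q] /= e; subst; congr exist; exact: Prop_irrelevance.
Qed.

Lemma has_card1 (A : Type) (x : A) : (forall y, y = x) -> has_card A 1.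
Proof.
move=> h; exists (fun _ => x); exists (fun _ => ord0) => [i|y]; first by rewrite [RHS]ord1.
by rewrite (h y).
Qed.

Lemma has_card0 (A : Type) : (A -> False) -> has_card A 0.
Proof.
move=> h; have f : 'I_0 -> A by case.
by exists f; exists (fun x => False_rect _ (h x)) => [[]|x] //; case: (h x).
Qed.

(** The type of an arrow is visible on its endpoints: the two arcs share the left
    endpoint, share the right one, or are consecutive.  In each case they
    determine the triangle. *)
Lemma tri_arrow_eq (x y : tri_arrow t) :
  sval (tri_source x) = sval (tri_source y) ->
  sval (tri_target x) = sval (tri_target y) -> x = y.
Proof.
case: x => x; case: y => y /=;
  have ? := tri_lt_ij x; have ? := tri_lt_jk x;
  have ? := tri_lt_ij y; have ? := tri_lt_jk y => -[? ?] [? ?];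
  try (by congr (_ _); apply: triangle_eq; lia); lia.
Qed.

Local Notation Q := (exchange_quiver t).

Lemma mutable_arc_t (v : vertex (principal_part Q)) : t (mutable_arc v).
Proof. by case: v => -[a [ta|sa]] nf //; case: nf. Qed.

Lemma mutable_arc_inj (v w : vertex (principal_part Q)) :
  mutable_arc v = mutable_arc w -> v = w.
Proof. by move=> e; apply: sval_inj; apply: sval_inj. Qed.

Lemma mutable_arc_surj a : t a -> exists v : vertex (principal_part Q), mutable_arc v = a.
Proof.
move=> ta; have nf : ~ frozen (exist (edge t) a (or_introl ta) : vertex Q).
  by have := t_arc tP ta; rewrite /= /efrozen /is_side /is_arc /=; lia.
by exists (exist _ (exist _ a (or_introl ta)) nf).
Qed.

Definition underlying (a : arrow (principal_part Q)) : tri_arrow t := sval (sval a).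

Lemma underlying_source (a : arrow (principal_part Q)) :
  sval (tri_source (underlying a)) = mutable_arc (source a).
Proof. by []. Qed.

Lemma underlying_target (a : arrow (principal_part Q)) :
  sval (tri_target (underlying a)) = mutable_arc (target a).
Proof. by []. Qed.

Lemma qarrow_of_tri (x : tri_arrow t) a b :
  sval (tri_source x) = a -> sval (tri_target x) = b -> qarrow t a b.
Proof.
move=> <- <-; case: x => -[i j l /= p1 p2 e1 e2 e3].
- by apply: Or31; split.
- by apply: Or32; split.
- by apply: Or33; split.
Qed.

Lemma tri_of_qarrow a b : t a -> t b -> qarrow t a b -> exists x : tri_arrow t,
  sval (tri_source x) = a /\ sval (tri_target x) = b.
Proof.
case: a b => a1 a2 [b1 b2] ta tb; have aa := t_arc tP ta; have ab := t_arc tP tb.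
rewrite /is_arc /= in aa ab.
case=> /= [[e1 lt e]|[e1 lt e]|[e1 e]]; subst.
- have l1 : b1 < a2 by lia.
  by exists (IJ_to_IK (Triangle l1 lt (or_introl ta) e (or_introl tb))).
- have l1 : b1 < b2 by lia.
  by exists (IK_to_JK (Triangle lt l1 e (or_introl tb) (or_introl ta))).
- have l1 : b1 < a1 by lia.
  have l2 : a1 < a2 by lia.
  by exists (JK_to_IJ (Triangle l1 l2 (or_introl tb) (or_introl ta) e)).
Qed.

Lemma arrows_card1 (v w : vertex (principal_part Q)) :
  qarrow t (mutable_arc v) (mutable_arc w) -> has_card (arrows_between v w) 1.
Proof.
move=> /(tri_of_qarrow (mutable_arc_t v) (mutable_arc_t w)) [x [xs xt]].
have sv : tri_source x = sval v by apply: sval_inj.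
have tw : tri_target x = sval w by apply: sval_inj.
have nv : ~ efrozen (tri_source x) by rewrite sv; apply: (svalP v).
have nw : ~ efrozen (tri_target x) by rewrite tw; apply: (svalP w).
have np : ~ (efrozen (tri_source x) /\ efrozen (tri_target x)) by case.
pose a1 : arrow Q := exist _ x np.
pose a : arrow (principal_part Q) := exist _ a1 (conj nv nw).
have as_ : source a = v by apply: mutable_arc_inj.
have at_ : target a = w by apply: mutable_arc_inj.
apply: (has_card1 (x := exist _ a (conj as_ at_))) => -[b [bs bt]].
apply: sval_inj; apply: sval_inj; apply: sval_inj => /=.
apply: tri_arrow_eq; rewrite -/(underlying b).
  by rewrite underlying_source bs xs.
by rewrite underlying_target bt xt.
Qed.

Lemma arrows_card0 (v w : vertex (principal_part Q)) :
  ~ qarrow t (mutable_arc v) (mutable_arc w) -> has_card (arrows_between v w) 0.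
Proof.
move=> nq; apply: has_card0 => -[a [as_ at_]]; apply: nq.
apply: (@qarrow_of_tri (underlying a)).
  by rewrite underlying_source as_.
by rewrite underlying_target at_.
Qed.

(** * The ice quiver axioms *)

Lemma finite_subsingleton (A : Type) (S : set A) :
  (forall x y, S x -> S y -> x = y) -> finite_set S.
Proof.
move=> h; have [[x Sx]|n] := pselect (exists x, S x).
  by apply: (@sub_finite_set _ _ [set x]%classic) (finite_set1 x) => y Sy; apply: h.
apply: (@sub_finite_set _ _ set0) (finite_set0 _) => y Sy.
by apply: n; exists y.
Qed.

(** Two triangles with a common edge in the same role have crossing edges, unless
    they agree. *)
Lemma triangle_unique (role : triangle t -> evertex t) (x y : triangle t) :
  role = @tri_ij t \/ role = @tri_jk t \/ role = @tri_ik t ->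
  sval (role x) = sval (role y) -> x = y.
Proof.
have n1 := edge_noncrossing tP (tri_edge_ij x) (tri_edge_ik y).
have n2 := edge_noncrossing tP (tri_edge_jk x) (tri_edge_ik y).
have n3 := edge_noncrossing tP (tri_edge_ik x) (tri_edge_jk y).
have n4 := edge_noncrossing tP (tri_edge_ik x) (tri_edge_ij y).
have n5 := edge_noncrossing tP (tri_edge_ij x) (tri_edge_jk y).
have n6 := edge_noncrossing tP (tri_edge_jk x) (tri_edge_ij y).
have ? := tri_lt_ij x; have ? := tri_lt_jk x; have ? := tri_lt_ij y; have ? := tri_lt_jk y.
case=> [->|[->|->]] /= [e1 e2]; apply: triangle_eq => //.
- move: n2 n3; clear n1 n4 n5 n6; rewrite /crossing /=; lia.
- move: n1 n4; clear n2 n3 n5 n6; rewrite /crossing /=; lia.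
- move: n5 n6; clear n1 n2 n3 n4; rewrite /crossing /=; lia.
Qed.

(** At most nine arrows: three types of arrows in each of three triangles. *)
Lemma arrows_at_finite (v : vertex Q) :
  finite_set [set a : arrow Q | source a = v \/ target a = v]%classic.
Proof.
pose S (role : triangle t -> evertex t) (kind : triangle t -> tri_arrow t) :=
  [set a : arrow Q | exists2 x, sval a = kind x & role x = v]%classic.
have fS role kind : role = @tri_ij t \/ role = @tri_jk t \/ role = @tri_ik t ->
    finite_set (S role kind).
  move=> h; apply: finite_subsingleton => a b [x ax rx] [y bY ry].
  have xy : x = y by apply: (triangle_unique h); rewrite rx ry.
  by apply: sval_inj; rewrite ax bY xy.
pose R role := (S role (@IJ_to_IK t) `|` S role (@IK_to_JK t) `|` S role (@JK_to_IJ t))%classic.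
have fR role : role = @tri_ij t \/ role = @tri_jk t \/ role = @tri_ik t ->
    finite_set (R role).
  by move=> h; rewrite /R !finite_setU; do !split; apply: fS.
apply: (@sub_finite_set _ _ (R (@tri_ij t) `|` R (@tri_jk t) `|` R (@tri_ik t))%classic).
  move=> [[x|x|x] nf] /= [e|e].
  - by left; left; left; left; exists x.
  - by right; left; left; exists x.
  - by right; left; right; exists x.
  - by left; right; left; right; exists x.
  - by left; right; right; exists x.
  - by left; left; right; exists x.
rewrite 2!finite_setU; split; [split|]; apply: fR;
  by [left | right; left | right; right].
Qed.

Lemma ice_exchange_quiver : is_ice_quiver Q.
Proof.
split.
- by move=> [a nf].
- move=> [[x|x|x] nf] /= /(congr1 sval) /= e;
    have := congr1 fst e; have := congr1 snd e; rewrite /=;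
    have := tri_lt_ij x; have := tri_lt_jk x; lia.
- move=> [[x|x|x] nf] [[y|y|y] nf'] /= [/(congr1 sval) /= e /(congr1 sval) /= e'];
    have := congr1 fst e; have := congr1 snd e;
    have := congr1 fst e'; have := congr1 snd e'; rewrite /=;
    have := tri_lt_ij x; have := tri_lt_jk x; have := tri_lt_ij y;
    have := tri_lt_jk y; lia.
- exact: arrows_at_finite.
Qed.

End ExchangeQuiverArrows.

(** * The quiver of the subcategory *)
Theorem theorem3p12 (k : fieldType) (coord : int * int -> dgmod k)
    (coordP : is_coordinate_system coord)
    (t : set (int * int)) (tP : triangulation t)
    (t_lf_or_fountain : locally_finite t \/ has_fountain t) :
  is_ice_quiver (exchange_quiver t) /\
  is_gabriel_quiver (arc_subcat coord t)
    (Q := principal_part (exchange_quiver t)) (fun v => coord (mutable_arc v)).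
Proof.
split; first exact: ice_exchange_quiver.
split=> [v|v w i|M /(T_indecomposable coordP tP) [a ta i]|v w].
- exact: (T_indecomposable_coord coordP tP (mutable_arc_t v)).
- apply: mutable_arc_inj; apply: (coord_inj coordP) i;
    exact: (t_arc tP (mutable_arc_t _)).
- by have [v va] := mutable_arc_surj tP ta; exists v; rewrite va.
- have [q|nq] := pselect (qarrow t (mutable_arc v) (mutable_arc w)).
    exists 1%N; split; first exact: arrows_card1.
    exact: (irr_dim_arrow coordP tP (mutable_arc_t _) (mutable_arc_t _) q).
  exists 0%N; split; first exact: arrows_card0.
  exact: (irr_dim_no_arrow coordP tP (mutable_arc_t _) (mutable_arc_t _) nq).
Qed.
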